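(* Let $S$ be a closed connected oriented surface of genus $g\ge 2$. Then the set of Liouville currents $\{L_m \mid (S,m)\in \mathrm{Teich}(S)\}\subset \mathcal{C}(S)$ is a linearly independent set of vectors over $\mathbb{R}$.
   Context: Teichmüller space: $\mathrm{Teich}(S)=\{(X,f_X)\}/\sim$, where $X$ is a hyperbolic surface and $f_X:S\to X$ is an orientation-preserving homeomorphism, with $(X,f_X)\sim(Y,f_Y)$ iff there is an isometry $h:X\to Y$ such that $h\circ f_X$ is isotopic to $f_Y$. Isometries here are orientation-preserving. A point of $\mathrm{Teich}(S)$ is also written $(S,m)$, where $m$ is a hyperbolic metric on $S$ (considered up to isotopy). Geodesic currents: let $\Gamma=\pi_1(S)$, with Gromov boundary $\partial\Gamma$, which is homeomorphic to the circle $\mathbb{S}^1$. Let $\partial^{(2)}\Gamma=(\partial\Gamma\times\partial\Gamma\setminus\Delta)/(\mathbb{Z}/2\mathbb{Z})$, where $\Delta$ is the diagonal and $\mathbb{Z}/2\mathbb{Z}$ exchanges the two factors. A geodesic current is a $\Gamma$-invariant (Radon) measure on $\partial^{(2)}\Gamma$; $\mathcal{C}(S)$ denotes the space of geodesic currents. Linear independence is understood in the real vector space of signed $\Gamma$-invariant Radon measures on $\partial^{(2)}\Gamma$, i.e. linear combinations are finite with arbitrary real coefficients. Liouville current: let $\mathbb{S}^1=\partial\mathbb{H}^2$ be the boundary of the unit disc model of the hyperbolic plane. The Liouville measure $L=\dfrac{d\alpha\,d\beta}{|e^{i\alpha}-e^{i\beta}|^2}$ is a $\mathrm{PSL}_2(\mathbb{R})$-invariant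 measure on the space of unordered pairs of distinct points of $\mathbb{S}^1$. A hyperbolic metric $m$ on $S$ gives an orientation-preserving isometric diffeomorphism $\phi_m:\tilde S\to\mathbb{H}^2$ from the universal cover, well defined up to composition with an element of $\mathrm{PSL}_2(\mathbb{R})$, hence a boundary homeomorphism $\partial\phi_m:\partial\tilde S\simeq\partial\Gamma\to\partial\mathbb{H}^2$. The Liouville current $L_m\in\mathcal{C}(S)$ is the pull-back of $L$ by the map induced by $\partial\phi_m$ on unordered pairs of distinct points; it depends only on the class of $m$ in $\mathrm{Teich}(S)$. *)

(* Defs.v *)
From HB Require Import structures.
From mathcomp Require Import all_boot all_order all_algebra generic_quotient.
From mathcomp Require Import complex.
From mathcomp Require Import all_classical all_reals all_analysis.
From mathcomp Require Import lra.

Set Implicit Arguments.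
Unset Strict Implicit.
Unset Printing Implicit Defensive.

Import Order.TTheory GRing.Theory Num.Theory numFieldNormedType.Exports.

Local Open Scope classical_set_scope.
Local Open Scope ring_scope.
Local Open Scope quotient_scope.

Lemma continuous_pair (X Y Z : topologicalType) (f : X -> Y) (g : X -> Z) (x : X) :
  {for x, continuous f} -> {for x, continuous g} ->
  {for x, continuous (fun y => (f y, g y))}.
Proof. by move=> cf cg; apply: cvg_pair. Qed.

Section homotopy.
Context {R : realType} {T : topologicalType}.
Implicit Types (a b c : R -> T).

(* Paths are continuous functions on R of which only the restriction to [0, 1]
   matters; since [0, 1] is a retract of R this is no restriction. Homotopies are
   relative to the endpoints. *)
Definition path_homotopic a b := exists H : R * R -> T,
  [/\ continuous H,
      forall t, 0 <= t <= 1 -> H (0, t) = a t /\ H (1, t) = b t &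
      forall s, 0 <= s <= 1 -> H (s, 0) = a 0 /\ H (s, 1) = a 1].

Definition path_cat a b : R -> T :=
  fun t => if t <= 2^-1 then a (2 * t) else b (2 * t - 1).

Definition path_rev a : R -> T := fun t => a (1 - t).

Lemma continuous_paste (X : topologicalType) (h : X -> R) (k : R)
    (f g : X -> T) :
  continuous h -> continuous f -> continuous g ->
  (forall x, h x = k -> f x = g x) ->
  continuous (fun x => if h x <= k then f x else g x).
Proof.
move=> hc fc gc fg; set F := fun x => _.
have cA : closed [set x | h x <= k].
  exact: (@preimage_closed _ _ h [set y | y <= k] (fun x _ => hc x) (@closed_le _ k)).
have cB : closed [set x | k <= h x].
  exact: (@preimage_closed _ _ h [set y | k <= y] (fun x _ => hc x) (@closed_ge _ k)).
have : {within [set x | h x <= k] `|` [set x | k <= h x], continuous F}.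
  apply: withinU_continuous => //.
  - apply: (@subspace_eq_continuous _ _ _ f) => [x /set_mem /= hx|].
      by rewrite /from_subspace /F hx.
    exact: continuous_subspaceT.
  - apply: (@subspace_eq_continuous _ _ _ g) => [x /set_mem /= hx|].
      rewrite /from_subspace /F; case: ifPn => // hx'.
      by rewrite fg //; apply/eqP; rewrite eq_le hx hx'.
    exact: continuous_subspaceT.
rewrite (_ : _ `|` _ = setT); first by move=> cF; apply/continuous_subspace_setT.
by apply/seteqP; split=> x //= _; case: (leP (h x) k) => hx; [left|right; exact: ltW].
Qed.

Lemma path_cat_continuous a b : continuous a -> continuous b ->
  a 1 = b 0 -> continuous (path_cat a b).
Proof.
move=> ca cb ab; apply: continuous_paste => [x|x|x|x ->].
- exact: cvg_id.
- apply: (@continuous_comp _ _ _ (fun t : R => 2 * t) a); last exact: ca.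
  by apply: cvgM; [exact: cvg_cst|exact: cvg_id].
- apply: (@continuous_comp _ _ _ (fun t : R => 2 * t - 1) b); last exact: cb.
  apply: cvgB; last exact: cvg_cst.
  by apply: cvgM; [exact: cvg_cst|exact: cvg_id].
- by rewrite divff ?subrr.
Qed.

Lemma path_rev_continuous a : continuous a -> continuous (path_rev a).
Proof.
move=> ca x; apply: (@continuous_comp _ _ _ (fun t : R => 1 - t) a); last exact: ca.
by apply: cvgB; [exact: cvg_cst|exact: cvg_id].
Qed.

Lemma path_cat0 a b : path_cat a b 0 = a 0.
Proof. by rewrite /path_cat mulr0 invr_ge0 ler0n. Qed.

Lemma path_cat1 a b : path_cat a b 1 = b 1.
Proof.
rewrite /path_cat ifN; last by rewrite -ltNge invf_lt1 ?ltr0n// ltr1n.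
by congr b; lra.
Qed.

Lemma path_homotopic_refl a : continuous a -> path_homotopic a a.
Proof.
move=> ca; exists (a \o snd); split=> // x.
by apply: continuous_comp; [exact: cvg_snd|exact: ca].
Qed.

Lemma path_homotopic_ends a b : path_homotopic a b -> a 0 = b 0 /\ a 1 = b 1.
Proof.
move=> [H [_ H0 H1]]; split.
  have [<- _] := H1 1 (ltac:(lra)).
  by have [_ <-] := H0 0 (ltac:(lra)).
have [_ <-] := H1 1 (ltac:(lra)).
by have [_ <-] := H0 1 (ltac:(lra)).
Qed.

Lemma path_homotopic_sym a b : path_homotopic a b -> path_homotopic b a.
Proof.
move=> hab; have [ab0 ab1] := path_homotopic_ends hab.
have [H [cH H0 H1]] := hab.
exists (fun x => H (1 - x.1, x.2)); split=> [x|t t01|s s01] /=.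
- apply: (@continuous_comp _ _ _ (fun x : R * R => (1 - x.1, x.2)) H); last exact: cH.
  apply: continuous_pair; last exact: cvg_snd.
  by apply: cvgB; [exact: cvg_cst|exact: cvg_fst].
- by rewrite subr0 subrr; have [-> ->] := H0 t t01.
- by rewrite -ab0 -ab1; apply: H1; lra.
Qed.

Definition clamp01 (t : R) : R := Num.max 0 (Num.min t 1).

Lemma clamp01_continuous : continuous clamp01.
Proof.
move=> x; apply: (@continuous_max _ _ (fun=> 0) (fun t : R => Num.min t 1)).
  exact: cvg_cst.
by apply: (@continuous_min _ _ id (fun=> 1)); [exact: cvg_id|exact: cvg_cst].
Qed.

Lemma clamp01_in t : 0 <= clamp01 t <= 1.
Proof. by rewrite /clamp01 le_max lexx /= ge_max ge_min lexx orbT ler01. Qed.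

Lemma clamp01_id t : 0 <= t <= 1 -> clamp01 t = t.
Proof. by rewrite /clamp01 => /andP[t0 t1]; rewrite min_l// max_r. Qed.

Lemma path_homotopic_trans a b c :
  path_homotopic a b -> path_homotopic b c -> path_homotopic a c.
Proof.
move=> hab hbc; have [ab0 ab1] := path_homotopic_ends hab.
have [H [cH H0 H1]] := hab; have [K [cK K0 K1]] := hbc.
exists (fun x => if x.1 <= 2^-1 then H (2 * x.1, clamp01 x.2)
                 else K (2 * x.1 - 1, clamp01 x.2)); split=> [|t t01|s s01].
- apply: continuous_paste => [x|x|x|x ->].
  + exact: cvg_fst.
  + apply: (@continuous_comp _ _ _ (fun x : R * R => (2 * x.1, clamp01 x.2)) H);
      last exact: cH.
    apply: continuous_pair.
      by apply: cvgM; [exact: cvg_cst|exact: cvg_fst].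
    by apply: continuous_comp; [exact: cvg_snd|exact: clamp01_continuous].
  + apply: (@continuous_comp _ _ _ (fun x : R * R => (2 * x.1 - 1, clamp01 x.2)) K);
      last exact: cK.
    apply: continuous_pair.
      apply: cvgB; last exact: cvg_cst.
      by apply: cvgM; [exact: cvg_cst|exact: cvg_fst].
    by apply: continuous_comp; [exact: cvg_snd|exact: clamp01_continuous].
  + rewrite divff// subrr.
    by have [_ ->] := H0 _ (clamp01_in x.2); have [-> _] := K0 _ (clamp01_in x.2).
- rewrite /= clamp01_id// mulr0 invr_ge0 ler0n; have [-> _] := H0 t t01.
  rewrite ifN; last by rewrite -ltNge; lra.
  by rewrite (_ : 2 * 1 - 1 = 1); [have [_ ->] := K0 t t01|lra].
- rewrite /= !clamp01_id; [|lra|lra].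
  case: ifPn => hs; first by apply: H1; lra.
  by rewrite ab0 ab1; apply: K1; move: hs; rewrite -ltNge; lra.
Qed.

Lemma path_homotopic_cat a a' b b' : a 1 = b 0 ->
  path_homotopic a a' -> path_homotopic b b' ->
  path_homotopic (path_cat a b) (path_cat a' b').
Proof.
move=> ab [H [cH H0 H1]] [K [cK K0 K1]].
exists (fun x => if x.2 <= 2^-1 then H (clamp01 x.1, 2 * x.2)
                 else K (clamp01 x.1, 2 * x.2 - 1)); split=> [|t t01|s s01].
- apply: continuous_paste => [x|x|x|x ->].
  + exact: cvg_snd.
  + apply: (@continuous_comp _ _ _ (fun x : R * R => (clamp01 x.1, 2 * x.2)) H);
      last exact: cH.
    apply: continuous_pair.
      by apply: continuous_comp; [exact: cvg_fst|exact: clamp01_continuous].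
    by apply: cvgM; [exact: cvg_cst|exact: cvg_snd].
  + apply: (@continuous_comp _ _ _ (fun x : R * R => (clamp01 x.1, 2 * x.2 - 1)) K);
      last exact: cK.
    apply: continuous_pair.
      by apply: continuous_comp; [exact: cvg_fst|exact: clamp01_continuous].
    apply: cvgB; last exact: cvg_cst.
    by apply: cvgM; [exact: cvg_cst|exact: cvg_snd].
  + rewrite divff// subrr.
    by have [_ ->] := H1 _ (clamp01_in x.1); have [-> _] := K1 _ (clamp01_in x.1).
- rewrite /= !clamp01_id; [|lra|lra]; rewrite /path_cat.
  by case: ifPn; rewrite -?ltNge => ht; [apply: H0|apply: K0]; lra.
- rewrite path_cat0 path_cat1 /= clamp01_id// mulr0 invr_ge0 ler0n.
  rewrite ifN; last by rewrite -ltNge; lra.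
  rewrite (_ : 2 * 1 - 1 = 1); last lra.
  by have [-> _] := H1 s s01; have [_ ->] := K1 s s01.
Qed.

Lemma path_homotopic_rev a b :
  path_homotopic a b -> path_homotopic (path_rev a) (path_rev b).
Proof.
move=> [H [cH H0 H1]]; exists (fun x => H (x.1, 1 - x.2)).
split=> [x|t t01|s s01].
- apply: (@continuous_comp _ _ _ (fun x : R * R => (x.1, 1 - x.2)) H); last exact: cH.
  apply: continuous_pair; first exact: cvg_fst.
  by apply: cvgB; [exact: cvg_cst|exact: cvg_snd].
- by apply: (H0 (1 - t)); move: t01; lra.
- by rewrite /path_rev /= subr0 subrr; have [-> ->] := H1 s s01.
Qed.

Lemma path_homotopic_reparam a b c (phi psi : R -> R) :
  continuous c -> continuous phi -> continuous psi ->
  phi 0 = psi 0 -> phi 1 = psi 1 ->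
  (forall t, 0 <= t <= 1 -> a t = c (phi t)) ->
  (forall t, 0 <= t <= 1 -> b t = c (psi t)) ->
  path_homotopic a b.
Proof.
move=> cc cphi cpsi e0 e1 ac bc.
exists (fun x => c ((1 - x.1) * phi x.2 + x.1 * psi x.2)); split=> [x|t t01|s s01] /=.
- apply: (@continuous_comp _ _ _
    (fun x : R * R => (1 - x.1) * phi x.2 + x.1 * psi x.2) c); last exact: cc.
  apply: cvgD; apply: cvgM.
  + by apply: cvgB; [exact: cvg_cst|exact: cvg_fst].
  + by apply: continuous_comp; [exact: cvg_snd|exact: cphi].
  + exact: cvg_fst.
  + by apply: continuous_comp; [exact: cvg_snd|exact: cpsi].
- rewrite subr0 subrr !mul0r !mul1r addr0 add0r.
  by rewrite ac// bc.
- rewrite ac; last lra.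
  rewrite ac; last lra.
  by rewrite -e0 -e1 -!mulrDl subrK !mul1r.
Qed.

Lemma path_cat_cst a (x : T) : continuous a -> a 0 = x ->
  path_homotopic (path_cat (cst x) a) a.
Proof.
move=> ca ax.
apply: (@path_homotopic_reparam _ _ a (fun t => Num.max 0 (2 * t - 1)) id) => //.
- move=> t; apply: (@continuous_max _ _ (fun=> 0) (fun t : R => 2 * t - 1)).
    exact: cvg_cst.
  apply: cvgB; last exact: cvg_cst.
  by apply: cvgM; [exact: cvg_cst|exact: cvg_id].
- by move=> t; exact: cvg_id.
- by rewrite /= max_l//; lra.
- by rewrite /= max_r//; lra.
- move=> t t01; rewrite /path_cat /=; case: ifPn; rewrite -?ltNge => ht.
    by rewrite max_l//; lra.
  by rewrite max_r//; lra.
Qed.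

Lemma path_cat_cstr a (x : T) : continuous a -> a 1 = x ->
  path_homotopic (path_cat a (cst x)) a.
Proof.
move=> ca ax.
apply: (@path_homotopic_reparam _ _ a (fun t => Num.min (2 * t) 1) id) => //.
- move=> t; apply: (@continuous_min _ _ (fun t : R => 2 * t) (fun=> 1)).
    by apply: cvgM; [exact: cvg_cst|exact: cvg_id].
  exact: cvg_cst.
- by move=> t; exact: cvg_id.
- by rewrite /= min_l//; lra.
- by rewrite /= min_r//; lra.
- move=> t t01; rewrite /path_cat /=; case: ifPn; rewrite -?ltNge => ht.
    by rewrite min_l//; lra.
  by rewrite min_r//; lra.
Qed.

Lemma path_cat_rev a : continuous a ->
  path_homotopic (path_cat a (path_rev a)) (cst (a 0)).
Proof.
move=> ca.
apply: (@path_homotopic_reparam _ _ a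
  (fun t => Num.min (2 * t) (2 - 2 * t)) (fun=> 0)) => //.
- move=> t; apply: (@continuous_min _ _ (fun t : R => 2 * t) (fun t => 2 - 2 * t)).
    by apply: cvgM; [exact: cvg_cst|exact: cvg_id].
  apply: cvgB; first exact: cvg_cst.
  by apply: cvgM; [exact: cvg_cst|exact: cvg_id].
- by move=> t; exact: cvg_cst.
- by rewrite /= min_l//; lra.
- by rewrite /= min_r//; lra.
- move=> t t01; rewrite /path_cat /path_rev /=; case: ifPn; rewrite -?ltNge => ht.
    by rewrite min_l//; lra.
  by rewrite min_r; [congr a; lra|lra].
Qed.

Lemma path_catA a b c : continuous a -> continuous b -> continuous c ->
  a 1 = b 0 -> b 1 = c 0 ->
  path_homotopic (path_cat a (path_cat b c)) (path_cat (path_cat a b) c).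
Proof.
move=> ca cb cc ab bc.
apply: (@path_homotopic_reparam _ _ (path_cat (path_cat a b) c)
  (fun t => Num.max (t / 2) (Num.max (t - 4^-1) (2 * t - 1))) id) => //.
- apply: path_cat_continuous => //; last by rewrite path_cat1.
  exact: path_cat_continuous.
- move=> t; apply: (@continuous_max _ _ (fun t : R => t / 2)
    (fun t => Num.max (t - 4^-1) (2 * t - 1))).
    by apply: cvgM; [exact: cvg_id|exact: cvg_cst].
  apply: (@continuous_max _ _ (fun t : R => t - 4^-1) (fun t => 2 * t - 1)).
    by apply: cvgB; [exact: cvg_id|exact: cvg_cst].
  apply: cvgB; last exact: cvg_cst.
  by apply: cvgM; [exact: cvg_cst|exact: cvg_id].
- by move=> t; exact: cvg_id.
- by rewrite /= max_l ?mul0r// ge_max; lra.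
- by rewrite /= max_r ?le_max; [rewrite max_r; lra|lra].
- move=> t t01; rewrite /path_cat /=; case: ifPn; rewrite -?ltNge => ht.
    rewrite max_l; last by rewrite ge_max; lra.
    rewrite ifT; last lra.
    by rewrite ifT; [congr a|]; lra.
  case: ifPn; rewrite -?ltNge => ht'.
    rewrite max_r; last by rewrite le_max; lra.
    rewrite max_l; last lra.
    rewrite ifT; last lra.
    by rewrite ifF; [congr b|apply/negbTE; rewrite -ltNge]; lra.
  rewrite max_r; last by rewrite le_max; lra.
  rewrite max_r; last lra.
  by rewrite ifF; [congr c|apply/negbTE; rewrite -ltNge]; lra.
Qed.

End homotopy.

Section fundamental_group.
Context (R : realType) (T : topologicalType) (x0 : T).

Record loop := Loop {
  loop_fun :> R -> T;
  loop_continuous : continuous loop_fun;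
  loop0 : loop_fun 0 = x0;
  loop1 : loop_fun 1 = x0 }.

Lemma loop_inj (a b : loop) : loop_fun a = loop_fun b -> a = b.
Proof.
case: a b => f cf f0 f1 [g cg g0 g1] /= fg; move: cg g0 g1; rewrite -fg.
by move=> cg g0 g1; congr Loop; exact: Prop_irrelevance.
Qed.

HB.instance Definition _ := gen_eqMixin loop.
HB.instance Definition _ := gen_choiceMixin loop.

Definition loop_rel (a b : loop) : bool := `[< path_homotopic a b >].

Lemma loop_rel_refl : reflexive loop_rel.
Proof. by move=> a; apply/asboolP/path_homotopic_refl/loop_continuous. Qed.

Lemma loop_rel_sym : symmetric loop_rel.
Proof.
by move=> a b; apply/asboolP/asboolP; exact: path_homotopic_sym.
Qed.

Lemma loop_rel_trans : transitive loop_rel.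
Proof.
move=> a b c /asboolP hab /asboolP hbc.
by apply/asboolP; exact: path_homotopic_trans hab hbc.
Qed.

Canonical loop_equiv :=
  EquivRel loop_rel loop_rel_refl loop_rel_sym loop_rel_trans.

Definition pi1 : Type := {eq_quot loop_equiv}.

HB.instance Definition _ := Choice.on pi1.
HB.instance Definition _ := Quotient.on pi1.
HB.instance Definition _ := EqQuotient.on pi1.

Definition loop_cst : loop :=
  @Loop (cst x0) (fun=> @cvg_cst _ _ _ _ _) erefl erefl.

Definition loop_cat (a b : loop) : loop := @Loop (path_cat a b)
  (path_cat_continuous (loop_continuous (l:=a)) (loop_continuous (l:=b))
    (etrans (loop1 a) (esym (loop0 b))))
  (etrans (path_cat0 a b) (loop0 a)) (etrans (path_cat1 a b) (loop1 b)).

Lemma loop_rev0 (a : loop) : path_rev a 0 = x0.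
Proof. by rewrite /path_rev subr0 loop1. Qed.

Lemma loop_rev1 (a : loop) : path_rev a 1 = x0.
Proof. by rewrite /path_rev subrr loop0. Qed.

Definition loop_rev (a : loop) : loop := @Loop (path_rev a)
  (path_rev_continuous (loop_continuous (l:=a))) (loop_rev0 a) (loop_rev1 a).

Definition pi1_mul (g h : pi1) : pi1 := \pi_pi1 (loop_cat (repr g) (repr h)).
Definition pi1_one : pi1 := \pi_pi1 loop_cst.
Definition pi1_inv (g : pi1) : pi1 := \pi_pi1 (loop_rev (repr g)).

Lemma pi1P (a b : loop) : \pi_pi1 a = \pi_pi1 b <-> path_homotopic a b.
Proof.
by split=> [/eqmodP/asboolP|ab]; [|apply/eqmodP/asboolP].
Qed.

Lemma repr_pi1 (a : loop) : path_homotopic (repr (\pi_pi1 a)) a.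
Proof. by apply/pi1P; rewrite reprK. Qed.

Lemma pi1_mulE a b : pi1_mul (\pi_pi1 a) (\pi_pi1 b) = \pi_pi1 (loop_cat a b).
Proof.
apply/pi1P; apply: path_homotopic_cat; [|exact: repr_pi1..].
by rewrite loop1 loop0.
Qed.

Lemma pi1_invE a : pi1_inv (\pi_pi1 a) = \pi_pi1 (loop_rev a).
Proof. by apply/pi1P; apply: path_homotopic_rev; exact: repr_pi1. Qed.

Lemma pi1_mulA : associative pi1_mul.
Proof.
move=> g h k; elim/quotW: g => a; elim/quotW: h => b; elim/quotW: k => c.
rewrite (pi1_mulE b c) (pi1_mulE a b) !pi1_mulE.
apply/pi1P => /=; apply: path_catA; rewrite ?loop0 ?loop1//;
exact: loop_continuous.
Qed.

Lemma pi1_mul1g : left_id pi1_one pi1_mul.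
Proof.
move=> g; elim/quotW: g => a; rewrite pi1_mulE; apply/pi1P => /=.
by apply: path_cat_cst; [exact: loop_continuous|exact: loop0].
Qed.

Lemma pi1_mulg1 : right_id pi1_one pi1_mul.
Proof.
move=> g; elim/quotW: g => a; rewrite pi1_mulE; apply/pi1P => /=.
by apply: path_cat_cstr; [exact: loop_continuous|exact: loop1].
Qed.

Lemma pi1_mulgV : right_inverse pi1_one pi1_inv pi1_mul.
Proof.
move=> g; elim/quotW: g => a; rewrite pi1_invE pi1_mulE; apply/pi1P.
rewrite /= -[X in cst X](loop0 a).
by apply: path_cat_rev; exact: loop_continuous.
Qed.

Lemma pi1_mulVg : left_inverse pi1_one pi1_inv pi1_mul.
Proof.
move=> g; rewrite -[X in pi1_mul _ X](_ : pi1_inv (pi1_inv g) = g).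
  exact: pi1_mulgV.
elim/quotW: g => a; rewrite (pi1_invE a) pi1_invE; congr (\pi_pi1 _).
apply: loop_inj; apply/funext => t.
by rewrite /= /path_rev opprB addrCA subrr addr0.
Qed.

HB.instance Definition _ := isGroup.Build pi1
  pi1_mulA pi1_mul1g pi1_mulg1 pi1_mulVg pi1_mulgV.

End fundamental_group.

Section topology.
Context {R : realType}.

Definition homeomorphism (X Y : topologicalType) (f : X -> Y) :=
  [/\ bijective f, continuous f & forall U, open U -> open (f @` U)].

(* A homeomorphism of the open set U onto an open subset of Y. *)
Definition open_embedding (X Y : topologicalType) (U : set X) (f : X -> Y) :=
  [/\ open U, {in U &, injective f}, {within U, continuous f} &
      forall V, open V -> V `<=` U -> open (f @` V)].

Definition path_connected (X : topologicalType) := forall x y : X,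
  exists a : R -> X, [/\ continuous a, a 0 = x & a 1 = y].

Definition simply_connected (X : topologicalType) :=
  path_connected X /\
  forall (x : X) (a : loop R x), path_homotopic a (cst x).

Definition evenly_covered (X Y : topologicalType) (p : X -> Y) (U : set Y) :=
  exists V : set (set X),
    [/\ trivIset V id, \bigcup_(W in V) W = p @^-1` U &
        forall W, V W -> open_embedding W p /\ p @` W = U].

Definition covering (X Y : topologicalType) (p : X -> Y) :=
  [/\ continuous p, range p = [set: Y] &
      forall y, exists2 U, open_nbhs y U & evenly_covered p U].

Definition universal_covering (X Y : topologicalType) (p : X -> Y) :=
  covering p /\ simply_connected X.

(* As for paths, only the restriction of a to [0, 1] matters. *)
Definition simple_closed_curve (X : topologicalType) (J : set X) :=
  exists a : R -> X, [/\ continuous a, a 0 = a 1,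
    {in `[0, 1[ &, injective a} & J = a @` `[0, 1]].

Definition nonseparating_curves (X : topologicalType) (n : nat) :=
  exists J : 'I_n -> set X,
    [/\ forall i, simple_closed_curve (J i), trivIset setT J &
        connected (~` \bigcup_i J i)].

(* The genus is the largest number of disjoint simple closed curves
   that together do not disconnect the surface. *)
Definition has_genus (X : topologicalType) (g : nat) :=
  nonseparating_curves X g /\
  forall n, nonseparating_curves X n -> (n <= g)%N.

End topology.
Arguments path_connected R X : clear implicits.
Arguments simply_connected R X : clear implicits.
Arguments universal_covering R {X Y} p.
Arguments has_genus R X g : clear implicits.

Section surfaces.
Context {R : realType}.
Local Open Scope complex_scope.

Definition cis (t : R) : R[i]^o := cos t +i* sin t.

Record chart (X : topologicalType) := Chart {
  chart_dom : set X;
  chart_map :> X -> R[i]^o }.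

Definition atlas (X : topologicalType) (A : set (chart X)) :=
  (forall c, A c -> open_embedding (chart_dom c) c) /\
  (forall x, exists2 c, A c & chart_dom c x).

(* The closed curve a, restricted to [0, 1], has winding number +1 around w. *)
Definition winds_once (a : R -> R[i]^o) (w : R[i]^o) :=
  exists theta : R -> R, [/\ continuous theta,
    forall t, a t <> w /\ a t - w = `|a t - w| * cis (theta t) &
    theta 1 = theta 0 + 2 * pi].

(* In the charts c at x and d at f x, the images of the small circles around x
   wind once, positively, around f x; f is a homeomorphism near x, so this says
   that its local degree is +1. No differentiability is needed. *)
Definition orientation_preserving_at (X Y : topologicalType)
    (c : chart X) (d : chart Y) (f : X -> Y) (x : X) :=
  exists2 e : R, 0 < e & forall r, 0 < r < e ->
    exists2 a : R -> X,
      forall t, [/\ chart_dom c (a t), chart_dom d (f (a t)) &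
                    c (a t) = c x + r%:C * cis (2 * pi * t)] &
      winds_once (d \o f \o a) (d (f x)).

Definition orientation_preserving (X Y : topologicalType)
    (A : set (chart X)) (B : set (chart Y)) (f : X -> Y) :=
  forall x c d, A c -> B d -> chart_dom c x -> chart_dom d (f x) ->
    orientation_preserving_at c d f x.

(* For `|a| ^+ 2 - `|b| ^+ 2 = 1 these are the orientation-preserving isometries
   of the unit disc model of the hyperbolic plane, i.e. PSL_2(R) conjugated by the
   Cayley transform (the group PSU(1, 1)). *)
Definition mobius (a b z : R[i]) : R[i]^o := (a * z + b) / (b^* * z + a^*).

Definition locally_mobius (X : topologicalType) (f g : X -> R[i]^o) (x : X) :=
  exists a b : R[i], `|a| ^+ 2 - `|b| ^+ 2 = 1 /\
    \forall y \near x, g y = mobius a b (f y).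

Definition unit_disc : set R[i]^o := [set z | `|z| < 1].

Definition oriented_atlas (X : topologicalType) (A : set (chart X)) :=
  atlas A /\ orientation_preserving A A id.

(* Charts in the hyperbolic plane whose coordinate changes are locally
   orientation-preserving isometries; such an atlas carries both the hyperbolic
   metric and the orientation. *)
Definition hyperbolic_atlas (X : topologicalType) (A : set (chart X)) :=
  [/\ atlas A,
      forall c, A c -> c @` chart_dom c `<=` unit_disc &
      forall c d x, A c -> A d -> chart_dom c x -> chart_dom d x ->
        locally_mobius c d x].

End surfaces.
Arguments unit_disc : clear implicits.
Arguments chart R X : clear implicits.

Record oriented_surface (R : realType) := OrientedSurface {
  surface_space :> topologicalType;
  surface_atlas : set (chart R surface_space);
  surface_hausdorff : hausdorff_space surface_space;
  surface_oriented : oriented_atlas surface_atlas }.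

Definition closed_connected (X : topologicalType) :=
  compact [set: X] /\ connected [set: X].

Record hyperbolic_surface (R : realType) := HyperbolicSurface {
  hyperbolic_space :> topologicalType;
  hyperbolic_charts : set (chart R hyperbolic_space);
  hyperbolic_hausdorff : hausdorff_space hyperbolic_space;
  hyperbolic_chartsP : hyperbolic_atlas hyperbolic_charts }.

Definition isometry (R : realType) (X Y : hyperbolic_surface R) (h : X -> Y) :=
  homeomorphism h /\
  forall x c d, hyperbolic_charts c -> hyperbolic_charts d ->
    chart_dom c x -> chart_dom d (h x) -> locally_mobius c (d \o h) x.

(* Only the times 0 <= t <= 1 matter. *)
Definition isotopic (R : realType) (X Y : topologicalType) (f g : X -> Y) :=
  exists H : R * X -> Y, [/\ continuous H,
    forall t, 0 <= t <= 1 -> homeomorphism (fun x => H (t, x)),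
    forall x, H (0, x) = f x & forall x, H (1, x) = g x].
Arguments isotopic R {X Y} f g.

Section teichmuller.
Context {R : realType} (S : oriented_surface R).

Record marked_surface := MarkedSurface {
  marked_target : hyperbolic_surface R;
  marking :> S -> marked_target;
  marking_homeo : homeomorphism marking;
  marking_oriented : orientation_preserving (surface_atlas (o:=S))
    (hyperbolic_charts (h:=marked_target)) marking }.

Definition marking_equiv (m n : marked_surface) :=
  exists2 h : marked_target m -> marked_target n,
    isometry h & isotopic R (h \o m) n.

(* A point is an equivalence class of marked surfaces, given as a predicate
   because [set marked_surface] is ruled out by universe levels. *)
Record teichmuller := Teichmuller {
  teich_class :> marked_surface -> Prop;
  teich_classP : exists m, forall n, teich_class n <-> marking_equiv m n }.

End teichmuller.

Section gromov_boundary.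
Context (G : groupType) (E : seq G).
Local Open Scope group_scope.

Definition generates := forall g : G, exists2 s : seq G,
  all (fun x => (x \in E) || (x^-1 \in E)) s & g = \big[*%g/1]_(x <- s) x.

(* The word distance from g to h with respect to E is at most n. *)
Definition word_dist_le (n : nat) (g h : G) := exists2 s : seq G,
  (size s <= n)%N && all (fun x => (x \in E) || (x^-1 \in E)) s &
  g^-1 * h = \big[*%g/1]_(x <- s) x.

(* Geodesic rays of the Cayley graph starting at any vertex, with the topology
   of pointwise convergence. *)
Definition geodesic_ray : set (prod_topology (fun _ : nat => discrete_topology G)) :=
  [set nu | forall i j n, (i <= j)%N ->
    (word_dist_le n (nu i) (nu j) <-> (j - i <= n)%N)].

Definition asymptotic (nu xi : geodesic_ray) : bool :=
  `[< exists K, forall n, word_dist_le K (val nu n) (val xi n) >].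


Lemma word_dist_refl (g : G) n : word_dist_le n g g.
Proof. by exists [::]; rewrite ?big_nil ?mulVg. Qed.

Lemma word_dist_sym n (g h : G) : word_dist_le n g h -> word_dist_le n h g.
Proof.
move=> [s /andP[sn /allP sE] gh]; exists (rev [seq x^-1 | x <- s]).
  rewrite size_rev size_map sn /=; apply/allP => x; rewrite mem_rev.
  by move=> /mapP[y /sE]; rewrite orbC => yE ->; rewrite invgK.
rewrite -[LHS]invgK invgM invgK gh; elim: s {sn sE gh} => [|x s IHs].
  by rewrite !big_nil invg1.
by rewrite map_cons rev_cons big_rcons /= big_cons invgM IHs.
Qed.

Lemma word_dist_trans m n (g h k : G) : word_dist_le m g h ->
  word_dist_le n h k -> word_dist_le (m + n) g k.
Proof.
move=> [s /andP[sm sE] gh] [t /andP[tn tE] hk]; exists (s ++ t).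
  by rewrite size_cat leq_add//= all_cat sE.
by rewrite big_cat /= -gh -hk -mulgA mulVKg.
Qed.

Lemma asymptotic_refl : reflexive asymptotic.
Proof. by move=> nu; apply/asboolP; exists 0%N => n; exact: word_dist_refl. Qed.

Lemma asymptotic_sym : symmetric asymptotic.
Proof.
by move=> nu xi; apply/asboolP/asboolP => -[K hK]; exists K => n;
  apply: word_dist_sym.
Qed.

Lemma asymptotic_trans : transitive asymptotic.
Proof.
move=> xi nu om /asboolP[K hK] /asboolP[L hL]; apply/asboolP.
by exists (K + L)%N => n; exact: word_dist_trans (hK n) (hL n).
Qed.

Canonical asymptotic_equiv :=
  EquivRel asymptotic asymptotic_refl asymptotic_sym asymptotic_trans.

Definition gromov_boundary : Type :=
  quotient_topology {eq_quot asymptotic_equiv}.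

HB.instance Definition _ := Topological.on gromov_boundary.
HB.instance Definition _ := Quotient.on gromov_boundary.

Lemma translate_subproof (g : G) (nu : geodesic_ray) :
  (fun n => g * val nu n : discrete_topology G) \in geodesic_ray.
Proof.
apply/mem_set => i j n ij; have /set_mem/(_ i j n ij) <- := valP nu.
by rewrite /word_dist_le invgM -mulgA mulKg.
Qed.

Definition translate_ray (g : G) (nu : geodesic_ray) : geodesic_ray :=
  exist (fun x => x \in geodesic_ray) _ (translate_subproof g nu).

(* The action of g on the boundary induced by left translation. *)
Definition boundary_act (g : G) (xi : gromov_boundary) : gromov_boundary :=
  \pi_gromov_boundary (translate_ray g (repr xi)).

End gromov_boundary.

Section unordered_pairs.
Context (T : topologicalType).

Definition off_diagonal : set (T * T) := [set x | x.1 <> x.2].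

Definition upair_rel (x y : off_diagonal) : bool :=
  (val x == val y) || (val x == ((val y).2, (val y).1)).

Lemma upair_rel_refl : reflexive upair_rel.
Proof. by move=> x; rewrite /upair_rel eqxx. Qed.

Lemma upair_rel_sym : symmetric upair_rel.
Proof.
move=> x y; rewrite /upair_rel [val x == val y]eq_sym; congr orb.
by case: (val x) (val y) => a b [c d] /=; rewrite !xpair_eqE andbC;
  congr andb; exact: eq_sym.
Qed.

Lemma upair_rel_trans : transitive upair_rel.
Proof.
move=> y x z; rewrite /upair_rel.
case: (val x) (val y) (val z) => [a b] [c d] [e f] /=.
by move=> /orP[/eqP[-> ->]|/eqP[-> ->]] /orP[/eqP[-> ->]|/eqP[-> ->]] /=;
  rewrite eqxx ?orbT.
Qed.

Canonical upair_equiv :=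
  EquivRel upair_rel upair_rel_refl upair_rel_sym upair_rel_trans.

Definition upair : Type := quotient_topology {eq_quot upair_equiv}.

HB.instance Definition _ := Topological.on upair.
HB.instance Definition _ := Quotient.on upair.

Definition ends (q : upair) : set T :=
  [set (val (repr q)).1; (val (repr q)).2].

End unordered_pairs.

Definition upair_image (T U : topologicalType) (f : T -> U)
    (A : set (upair T)) : set (upair U) :=
  [set q | exists2 p, A p & ends q = f @` ends p].

Section borel.
Context (T : topologicalType) (x : T).

(* The measurable types of the library carry a default point; x plays that
   role and has no influence on the sigma-algebra. *)
Definition pointed_at : Type := let _ := x in T.
HB.instance Definition _ := Topological.on pointed_at.
HB.instance Definition _ := isPointed.Build pointed_at x.

Definition borel : Type := g_sigma_algebraType (@open pointed_at).
HB.instance Definition _ := Measurable.on borel.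
End borel.

Definition radon (R : realType) (T : topologicalType) (x : T)
    (mu : {measure set (borel x) -> \bar R}) :=
  (forall K : set T, compact K -> (mu K < +oo)%E) /\
  (forall A : set T, measurable (A : set (borel x)) ->
    mu A = ereal_sup [set mu K | K in [set K : set T | compact K /\ K `<=` A]]).

Section currents.
Context {R : realType} (G : groupType) (E : seq G).

Definition double_boundary : topologicalType := upair (gromov_boundary E).

Record geodesic_current := GeodesicCurrent {
  current_base : double_boundary;
  current_measure :> {measure set (borel current_base) -> \bar R};
  current_radon : radon current_measure;
  current_invariant : forall (g : G) (A : set double_boundary),
    measurable (A : set (borel current_base)) ->
    current_measure (upair_image (boundary_act g) A) = current_measure A }.

Definition bounded_borel (A : set double_boundary) :=
  <<s @open double_boundary >> A /\
  exists2 K : set double_boundary, compact K & A `<=` K.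

(* A signed Radon measure may have infinite positive and negative parts; it is a
   real-valued set function on relatively compact Borel sets, and these form a
   real vector space under pointwise operations. The value 0 elsewhere is a dummy,
   so that two currents have the same vector iff they agree as Borel measures. *)
Definition current_vector (mu : geodesic_current) :
    set double_boundary -> R^o :=
  fun A => if pselect (bounded_borel A) then fine (mu A) else 0.

End currents.
Arguments geodesic_current R {G} E.

Section liouville_measure.
Context {R : realType}.

Definition circle : set R[i]^o := [set z | `|z| = 1].

(* Every unordered pair of distinct points of the circle is {cis alpha, cis beta}
   for exactly one 0 <= alpha < beta < 2 pi, so the density is integrated over these
   (alpha, beta). *)
Definition liouville (B : set (upair circle)) : \bar R :=
  \int[(lebesgue_measure \x lebesgue_measure)%E]_(t in
      [set t : measurableTypeR R * measurableTypeR R |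
        [/\ 0 <= t.1, t.1 < t.2, t.2 < 2 * pi &
            exists2 q, B q & val @` ends q = [set cis t.1; cis t.2]]])
    ((Normc.normc (cis t.1 - cis t.2) ^+ 2)^-1)%:E.

End liouville_measure.

Section liouville_current.
Context {R : realType} (S : oriented_surface R) (St : topologicalType).
Context (p : St -> S) (y0 : St) (E : seq (pi1 R (p y0))).

(* y is the image of y0 under g acting by deck transformations: the endpoint of
   the lift from y0 of a loop in the class g. *)
Definition orbit_point (g : pi1 R (p y0)) (y : St) :=
  exists2 a : loop R (p y0), \pi_(pi1 R (p y0)) a = g &
    exists c : R -> St, [/\ continuous c, c 0 = y0, c 1 = y &
      forall t, 0 <= t <= 1 -> p (c t) = a t].

(* phi is an orientation-preserving isometry onto the hyperbolic plane from St
   with the hyperbolic metric pulled back by m \o p. *)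
Definition lifted_isometry (m : marked_surface S) (phi : St -> R[i]^o) :=
  [/\ open_embedding setT phi, range phi = unit_disc R &
      forall y c, hyperbolic_charts c -> chart_dom c (m (p y)) ->
        locally_mobius (c \o m \o p) phi y].

(* bphi is the boundary value of phi: the Gromov boundary of the group is
   identified with that of St through the orbit of y0. *)
Definition boundary_extension (phi : St -> R[i]^o)
    (bphi : gromov_boundary E -> circle (R := R)) :=
  forall (nu : geodesic_ray E) (y : nat -> St),
    (forall n, orbit_point (val nu n) (y n)) ->
    phi (y n) @[n --> \oo] --> val (bphi (\pi_(gromov_boundary E) nu)).

Definition is_liouville_current (m : marked_surface S)
    (L : geodesic_current R E) :=
  exists phi bphi, [/\ lifted_isometry m phi, homeomorphism bphi,
    boundary_extension phi bphi &
    forall A : set (double_boundary E), <<s @open (double_boundary E) >> A ->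
      L A = liouville (upair_image bphi A)].

Definition liouville_currents : set (set (double_boundary E) -> R^o) :=
  [set v | exists (x : teichmuller S) m L,
    [/\ x m, is_liouville_current m L & v = current_vector L]].

End liouville_current.
Arguments liouville_currents {R S St p y0} E.

Definition linearly_independent (K : pzRingType) (V : lmodType K) (B : set V) :=
  forall (n : nat) (v : 'I_n -> V), injective v -> (forall i, B (v i)) ->
  forall c : 'I_n -> K, \sum_i c i *: v i = 0 -> forall i, c i = 0.

(* Main.v *)
(* Each marked hyperbolic structure is seen only through the homeomorphism [h i] from
   the boundary X of the group to the circle which extends its developing map; the deck
   transformations act on X, and [h i] conjugates this action to elements of PSU(1, 1).
   The Liouville measure of the box spanned by two disjoint arcs is the logarithm of a
   cross ratio of their endpoints.

   Let [F i] be the coordinate on the circle vanishing at [h i o] and infinite at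
   [h i w]. A relation sum_i c_i L_i = 0 evaluated on the box spanned by the arcs (o, u)
   and (p, w) reads sum_i c_i ln (1 - F_i(u) / F_i(p)) = 0. Let o, w be the fixed
   points of a hyperbolic deck transformation t acting on [F i] by the factor [q i] < 1,
   let q be the largest of the [q i] with c_i <> 0 and J the set of indices where it is
   attained. For u = t^n x, dividing by q^n yields sum_(i in J) c_i F_i(x) / F_i(p) = 0.
   Taking x = g (t^n y) with g a deck transformation, the sum becomes a rational
   function of q^n with infinitely many zeros, so two of its poles coincide: for every y
   there are i <> j in J with F_i(y) / F_i(v) = F_j(y) / F_j(v), where g v = w. Finitely
   many closed sets cover X, so one pair (i, j) serves for an open set, on which the
   cross ratios of [h i] and [h j] agree. By compactness of S, deck transformations
   contract arbitrary configurations into that open set, so the cross ratios agree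
   everywhere. Hence L_i and L_j agree on boxes, and therefore are equal. *)
Require Import Defs.
From HB Require Import structures.
From mathcomp Require Import all_boot all_order all_algebra generic_quotient.
From mathcomp Require Import complex.
From mathcomp Require Import all_classical all_reals all_analysis.
From mathcomp Require Import measurable_realfun.
From mathcomp Require Import ring lra.

Set Implicit Arguments.
Unset Strict Implicit.
Unset Printing Implicit Defensive.

Import Order.TTheory GRing.Theory Num.Theory numFieldNormedType.Exports.

Local Open Scope classical_set_scope.
Local Open Scope ring_scope.
Local Open Scope quotient_scope.

(** Compactness of S enters in one form only: the deck orbit of the centre of the disc comes close
    to every point of the circle, with large coefficients. This yields a hyperbolic deck
    transformation, one that does not preserve a given pair of points, and the contraction of finite
    configurations. Attracting fixed points are described by limits in X, so they are common to all
    indices although they are found on one circle. The density of [liouville] is written with angles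
    in [[0, 2 pi[], which cuts the circle at 1. The arcs of a box must therefore avoid the finitely
    many points that the [h i] send to 1. Hence p is chosen once for each side of o, as near to w as
    these points require, and a sequence tending to o is only known to return infinitely often to
    one of the sides. The relations are accordingly stated for some boolean b and arbitrarily large
    n, which is all that limits and zeros of polynomials require. The boundary maps may run along
    the circle in either direction, so box measures appear as absolute values of logarithms of cross
    ratios. *)

Section disc_automorphisms.
Context {R : realType}.
Local Notation C := R[i].
Local Notation normc := Normc.normc.
Local Notation rc := (real_complex R).
Implicit Types (A B : C * C) (z w : C).

(** * The group SU(1, 1) acting on the closed unit disc *)

Lemma normE z : `|z| = rc (normc z).
Proof. by []. Qed.

Lemma normc_ge0 z : 0 <= normc z.
Proof. by rewrite -ler0c -normE. Qed.

Lemma sqr_normcE z : rc ((normc z) ^+ 2) = z * z^*.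
Proof. by rewrite -normCK normE rmorphXn. Qed.

Lemma normcJE z : normc z^* = normc z.
Proof. by apply: complexI; rewrite -!normE norm_conjC. Qed.

Lemma normc_gt0 z : z != 0 -> 0 < normc z.
Proof. by rewrite -ltcR -normE normr_gt0. Qed.

Lemma normcNE z : normc (- z) = normc z.
Proof. by apply: complexI; rewrite -!normE normrN. Qed.

Lemma normc_triangle z w : normc (z + w) <= normc z + normc w.
Proof. by rewrite -lecR rmorphD -!normE ler_normD. Qed.

Lemma normcB z w : normc (z - w) = normc (w - z).
Proof. by rewrite -normcNE opprB. Qed.

Lemma le_normcB z w : normc z - normc w <= normc (z - w).
Proof. by rewrite lerBlDr -[X in normc X <= _](subrK w) normc_triangle. Qed.

Lemma conjcDE z w : ((z + w : C)^* : C) = z^* + w^* :> C. Proof. exact: rmorphD. Qed.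
Lemma conjcME z w : ((z * w : C)^* : C) = z^* * w^* :> C. Proof. exact: rmorphM. Qed.
Lemma conjcNE z : ((- z : C)^* : C) = - z^* :> C. Proof. exact: rmorphN. Qed.
Lemma conjcVE z : ((z^-1 : C)^* : C) = (z^*)^-1 :> C. Proof. exact: fmorphV. Qed.
Lemma conjc0E : (0 : C)^* = 0 :> C. Proof. exact: rmorph0. Qed.
Lemma conjc1E : (1 : C)^* = 1 :> C. Proof. exact: rmorph1. Qed.
Lemma conjcKE z : (z^* : C)^* = z :> C. Proof. exact: conjCK. Qed.

Definition conjcE := (conjcDE, conjcNE, conjcME, conjcVE, conjc0E, conjc1E, conjcKE).

(* The pair (a, b) stands for the map [mobius a b]. *)
Definition su11 A := A.1 * A.1^* - A.2 * A.2^* = 1.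

(** When [su11 A], the derivative of [su_act A] at z is [(su_den A z)^-2]: a small denominator marks
    the points near which A expands. *)
Definition su_den A z := A.2^* * z + A.1^*.

Definition su_act A z : C := mobius A.1 A.2 z.

Definition su_mul A B :=
  (A.1 * B.1 + A.2 * B.2^*, A.1 * B.2 + A.2 * B.1^*).

Definition su_inv A := (A.1^*, - A.2).

Lemma su_actE A z : su_act A z = (A.1 * z + A.2) / su_den A z.
Proof. by []. Qed.

Lemma su11_normP A :
  su11 A <-> (normc A.1) ^+ 2 = 1 + (normc A.2) ^+ 2.
Proof.
rewrite /su11 -!sqr_normcE -rmorphB.
split=> [/complexI<-|->]; first by rewrite subrK.
by rewrite addrK.
Qed.

Lemma su11_lt A : su11 A -> normc A.2 < normc A.1.
Proof.
move=> /su11_normP h.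
by rewrite -(@ltr_pXn2r _ 2%N)// ?nnegrE ?normc_ge0// h ltrDr.
Qed.

Lemma su11_ge1 A : su11 A -> 1 <= normc A.1.
Proof.
move=> /su11_normP h.
by rewrite -(@ler_pXn2r _ 2%N)// ?nnegrE ?normc_ge0// h expr1n lerDl sqr_ge0.
Qed.

Lemma su11_mul A B : su11 A -> su11 B -> su11 (su_mul A B).
Proof.
case: A B => a b [c d]; rewrite /su11 /su_mul /= => hA hB.
transitivity ((a * a^* - b * b^*) * (c * c^* - d * d^*)).
  by rewrite !conjcE; ring.
by rewrite hA hB mulr1.
Qed.

Lemma su11_inv A : su11 A -> su11 (su_inv A).
Proof. by case: A => a b; rewrite /su11 /su_inv /= !conjcE mulrNN mulrC. Qed.

Lemma su_invK A : su_inv (su_inv A) = A.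
Proof. by case: A => a b; rewrite /su_inv /= !conjcE opprK. Qed.

Lemma le_normc_den A z : su11 A ->
  normc A.1 - normc A.2 * normc z <= normc (su_den A z).
Proof.
move=> hA; have := le_normcB A.1^* (- (A.2^* * z)).
by rewrite opprK normcNE Normc.normcM !normcJE addrC [A.1^* + _]addrC.
Qed.

Lemma su_den_neq0 A z : su11 A -> normc z <= 1 -> su_den A z != 0.
Proof.
move=> hA z1; apply/negP => /eqP d0.
have := le_normc_den z hA; rewrite d0 Normc.normc0 leNgt => /negP; apply.
rewrite subr_gt0 (le_lt_trans _ (su11_lt hA))//.
by rewrite ler_piMr ?normc_ge0.
Qed.

Lemma su_act_mul A B z : su_den B z != 0 ->
  su_act (su_mul A B) z = su_act A (su_act B z).
Proof.
case: A B => a b [c d]; rewrite !su_actE /su_den /su_mul /= => h.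
have -> : (a * c + b * d^*) * z + (a * d + b * c^*) =
  (a * ((c * z + d) / (d^* * z + c^*)) + b) * (d^* * z + c^*) by field.
have -> : (a * d + b * c^*)^* * z + (a * c + b * d^*)^* =
  (b^* * ((c * z + d) / (d^* * z + c^*)) + a^*) * (d^* * z + c^*).
  by rewrite !conjcE; field.
by rewrite -mulf_div divff// mulr1.
Qed.

Lemma su_mulVg A : su11 A -> su_mul (su_inv A) A = (1, 0).
Proof.
case: A => a b h; rewrite /su_mul /=; congr (_, _); last by ring.
by rewrite -[RHS]h /=; ring.
Qed.

Lemma su_act1 z : su_act (1, 0) z = z.
Proof. by rewrite su_actE /su_den /= !conjcE mul0r add0r mul1r addr0 divr1. Qed.

Lemma su_actK A z : su11 A -> normc z <= 1 -> su_act (su_inv A) (su_act A z) = z.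
Proof.
by move=> hA z1; rewrite -su_act_mul ?su_den_neq0// su_mulVg// su_act1.
Qed.

(** The numerator of the difference is [z - w] times the determinant of A, which is 1. The
    invariance of cross ratios and the multipliers at fixed points come from this identity. *)
Lemma su_actB A z w : su11 A -> su_den A z != 0 -> su_den A w != 0 ->
  su_act A z - su_act A w = (z - w) / (su_den A z * su_den A w).
Proof.
case: A => a b; rewrite !su_actE /su_den /su11 /= => hA hz hw.
rewrite -[z - w]mul1r -hA; field.
by rewrite hz hw.
Qed.

(** A preserves the Hermitian form [|z1|^2 - |z2|^2], and [su_den A z] is the second coordinate of
    the image of the vector [(z, 1)]. *)
Lemma su_act_norm A z : su11 A -> su_den A z != 0 ->
  1 - (normc (su_act A z)) ^+ 2 = (1 - (normc z) ^+ 2) / (normc (su_den A z)) ^+ 2.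
Proof.
move=> hA hz.
have n0 : normc (su_den A z) ^+ 2 != 0 by rewrite expf_neq0// gt_eqF// normc_gt0.
apply: (mulIf n0); rewrite divfK// mulrBl mul1r -exprMn -Normc.normcM.
rewrite su_actE divfK//; apply: complexI.
rewrite !rmorphB rmorph1 /= -!/(rc _) !sqr_normcE; move: hA; rewrite /su11 /su_den.
case: A hz n0 => a b /= _ _ hA; rewrite !conjcE.
transitivity ((a * a^* - b * b^*) * (1 - z * z^*)); first by ring.
by rewrite hA mul1r.
Qed.
End disc_automorphisms.

(** * Fixed points on the circle and the coordinates adapted to them *)

Section circle_fixed_points.
Context {R : realType}.
Local Notation C := R[i].
Local Notation normc := Normc.normc.
Local Notation rc := (real_complex R).
Implicit Types (A B : C * C) (z w e f : C).

Lemma circle_neq0 z : normc z = 1 -> z != 0.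
Proof. by move=> z1; apply/eqP => z0; move: z1; rewrite z0 Normc.normc0 => /eqP; rewrite eq_sym oner_eq0. Qed.

Lemma circle_mulJ z : normc z = 1 -> z * z^* = 1.
Proof. by move=> z1; rewrite -sqr_normcE z1 expr1n rmorph1. Qed.

Lemma circle_conj z : normc z = 1 -> z^* = z^-1.
Proof.
move=> z1; have z0 := circle_neq0 z1.
by apply: (mulfI z0); rewrite circle_mulJ// divff.
Qed.

Lemma su_den_circle A z : su11 A -> normc z = 1 -> su_den A z != 0.
Proof. by move=> hA z1; rewrite su_den_neq0// z1. Qed.

(** [A.2 / A.1^*] is the image of the centre 0. When [normc A.1] is large, A brings the points of
    the disc close to that image, except where [su_den A] is small. *)
Lemma su_act_centerB A z : su11 A -> normc z <= 1 ->
  normc (su_act A z - A.2 / A.1^*) = normc z / (normc A.1 * normc (su_den A z)).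
Proof.
move=> hA z1.
have d0 : su_den A 0 != 0 by rewrite su_den_neq0// Normc.normc0 ler01.
have -> : A.2 / A.1^* = su_act A 0 by rewrite su_actE /su_den !mulr0 !add0r.
rewrite su_actB// ?su_den_neq0// subr0 !Normc.normcM Normc.normcV Normc.normcM.
by congr (_ / _); rewrite mulrC; congr (_ * _); rewrite /su_den mulr0 add0r normcJE.
Qed.

(** On the circle the numerator of [su_act A e] is e times the conjugate of the denominator. *)
Lemma su_den_fixed A e : su11 A -> normc e = 1 -> su_act A e = e ->
  (su_den A e)^* = su_den A e.
Proof.
move=> hA e1; have d0 := su_den_circle hA e1.
rewrite su_actE => /(congr1 ( *%R^~ (su_den A e))); rewrite divfK// => h.
have e0 := circle_neq0 e1.
apply: (mulfI e0); rewrite -h.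
move: h; rewrite /su_den => h; rewrite !conjcE mulrDr mulrCA circle_mulJ// mulr1.
by rewrite mulrC addrC.
Qed.

Lemma su_den_fixed_real A e : su11 A -> normc e = 1 -> su_act A e = e ->
  exists2 k : R, k != 0 & su_den A e = rc k.
Proof.
move=> hA e1 he; have := su_den_fixed hA e1 he.
have := su_den_circle hA e1.
case: (su_den A e) => x y h /eqP; rewrite eq_complex /= => /andP[_ /eqP hy].
have y0 : y = 0 by move: hy; lra.
exists x; last by rewrite y0.
by apply: contra_neq h => ->; rewrite y0.
Qed.

Lemma su_den_fixed2 A e f : su11 A -> normc e = 1 -> normc f = 1 ->
  e != f -> su_act A e = e -> su_act A f = f -> su_den A e * su_den A f = 1.
Proof.
move=> hA e1 f1 ef he hf.
have := su_actB hA (su_den_circle hA e1) (su_den_circle hA f1).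
have ef0 : e - f != 0 by rewrite subr_eq0.
have d0 : su_den A e * su_den A f != 0 by rewrite mulf_neq0// su_den_circle.
rewrite he hf => /(congr1 ( *%R^~ (su_den A e * su_den A f))).
by rewrite divfK// -[RHS]mulr1 => /(mulfI ef0).
Qed.

(* The coordinate of the circle that vanishes at e and is infinite at f. *)
Definition fpcoord e f z := (z - e) / (z - f).

Lemma fpcoord_eq0 e f z : z != f -> (fpcoord e f z == 0) = (z == e).
Proof. by move=> zf; rewrite mulf_eq0 invr_eq0 !subr_eq0 (negbTE zf) orbF. Qed.

Lemma fpcoord_inj e f z w : e != f -> z != f -> w != f ->
  fpcoord e f z = fpcoord e f w -> z = w.
Proof.
move=> ef zf wf /eqP.
rewrite eqr_div ?subr_eq0// -subr_eq0.
have -> : (z - e) * (w - f) - (w - e) * (z - f) = (z - w) * (e - f) by ring.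
by rewrite mulf_eq0 !subr_eq0 (negbTE ef) orbF => /eqP.
Qed.

Lemma fpcoordB e f z w : z != f -> w != f ->
  fpcoord e f z - fpcoord e f w = (z - w) * (e - f) / ((z - f) * (w - f)).
Proof.
by move=> zf wf; rewrite /fpcoord; field; rewrite !subr_eq0 zf wf.
Qed.

(** By [su_den_fixed2] the denominators at e and f are inverse to each other. The one at f is real,
    so the multiplier is a positive square. *)
Lemma fpcoord_act A e f z : su11 A -> normc e = 1 -> normc f = 1 ->
  e != f -> su_act A e = e -> su_act A f = f -> normc z = 1 -> z != f ->
  fpcoord e f (su_act A z) = su_den A f ^+ 2 * fpcoord e f z.
Proof.
move=> hA e1 f1 ef he hf z1 zf; rewrite /fpcoord.
rewrite -[X in (_ - X) / _]he -[X in _ / (_ - X)]hf.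
have dz := su_den_circle hA z1; have de := su_den_circle hA e1.
have df := su_den_circle hA f1.
rewrite !su_actB//.
have kk : su_den A e = (su_den A f)^-1.
  by apply: (mulIf df); rewrite su_den_fixed2// mulVf.
by rewrite kk; field; rewrite dz df subr_eq0 zf.
Qed.

(** In the coordinate [fpcoord e f] the map B is a homography whose pole is the coordinate of n, the
    point sent to f. This is its expansion in partial fractions, arranged so that the constant term
    is its value at e, where the coordinate is 0. *)
Lemma fpcoord_pole B e f n z : su11 B -> normc e = 1 -> normc f = 1 ->
  normc n = 1 -> normc z = 1 -> e != f -> n != e -> n != f ->
  su_act B n = f -> z != f -> z != n ->
  fpcoord e f (su_act B z) = fpcoord e f (su_act B e) +
    su_den B n ^+ 2 * (e - f) ^+ 2 / (e - n) ^+ 2 *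
      (fpcoord e f z / (1 - fpcoord e f z / fpcoord e f n)).
Proof.
move=> hB e1 f1 n1 z1 ef ne nf hn zf zn.
have dz := su_den_circle hB z1; have de := su_den_circle hB e1.
have dn := su_den_circle hB n1.
have BzB w : normc w = 1 -> w != n -> su_act B w != f.
  move=> w1 wn; apply: contra_neq wn => hw.
  by rewrite -(su_actK hB (_ : normc w <= 1)) ?w1// hw -hn su_actK// n1.
apply/eqP; rewrite addrC -subr_eq fpcoordB ?BzB//; last by rewrite eq_sym.
rewrite -[X in _ / ((_ - X) * _)]hn -[X in _ / (_ * (_ - X))]hn !su_actB//.
apply/eqP; rewrite /fpcoord; field.
rewrite !subr_eq0 ?dz ?de ?dn ?ne ?nf ?zf ?zn ?ef /= [e == n]eq_sym ne /=.
rewrite ?andbT.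
rewrite -subr_eq0.
have -> : (z - f) * (n - e) - (z - e) * (n - f) = (z - n) * (f - e) by ring.
by rewrite mulf_neq0// subr_eq0// eq_sym.
Qed.

(** The right-hand side is a cross ratio of the four points; its modulus will be the exponential of
    minus the measure of a box. *)
Lemma fpcoord_ratioB e f z p : z != f -> p != f -> p != e ->
  1 - fpcoord e f z / fpcoord e f p =
  ((z - p) * (f - e)) / ((z - f) * (p - e)).
Proof.
by move=> zf pf pe; rewrite /fpcoord; field; rewrite !subr_eq0 zf pf pe.
Qed.

(** Conjugation is inversion on the circle, so it multiplies [fpcoord e f] by the constant [f / e]:
    the coordinate takes its values on a single real line through 0. *)
Lemma fpcoord_ratio_real e f z p : normc e = 1 -> normc f = 1 -> normc z = 1 ->
  normc p = 1 -> z != f -> p != f -> p != e ->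
  exists r : R, fpcoord e f z = rc r * fpcoord e f p.
Proof.
move=> e1 f1 z1 p1 zf pf pe.
have Fp0 : fpcoord e f p != 0 by rewrite fpcoord_eq0.
have cF w : normc w = 1 -> w != f -> (fpcoord e f w)^* = f / e * fpcoord e f w.
  move=> w1 wf; rewrite /fpcoord !conjcE !circle_conj//.
  have := circle_neq0 w1; have := circle_neq0 e1; have := circle_neq0 f1.
  move=> f0 e0 w0; field.
  by rewrite e0 f0 w0 mulN1r !subr_eq0 wf eq_sym wf.
have : (fpcoord e f z / fpcoord e f p)^* = fpcoord e f z / fpcoord e f p.
  rewrite conjcME conjcVE !cF//.
  have := circle_neq0 e1; have := circle_neq0 f1 => f0 e0.
  by field; rewrite Fp0 f0 e0.
move: (divfK Fp0 (fpcoord e f z)).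
case: (_ / _) => x y <- /eqP; rewrite eq_complex /= => /andP[_ /eqP hy].
by exists x; have -> : y = 0 by move: hy; lra.
Qed.

Lemma circle_third e f : normc e = 1 -> exists z, [/\ normc z = 1, z != e & z != f].
Proof.
move=> e1; have e0 := circle_neq0 e1.
have i1 : normc 'i%C = 1 :> R by rewrite /= expr0n expr1n add0r sqrtr1.
have [fe|fe] := eqVneq f (- e); last first.
  exists (- e); split; rewrite ?normcNE//; last by rewrite eq_sym.
  by rewrite eq_sym -addr_eq0 -mulr2n mulrn_eq0.
exists ('i%C * e); split; first by rewrite Normc.normcM i1 e1 mulr1.
  rewrite -subr_eq0 -[X in _ - X]mul1r -mulrBl mulf_neq0//.
  by rewrite subr_eq0 eq_complex /= eq_sym oner_eq0.
rewrite fe -addr_eq0 -[X in _ + X]mul1r -mulrDl mulf_neq0//.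
by rewrite eq_complex /= add0r oner_eq0.
Qed.

(** For coefficients a and b, the fixed points solve [b^* z^2 - 2 i Im(a) z - b = 0]. Since
    [|b|^2 = |a|^2 - 1], a quarter of the discriminant is [Re(a)^2 - 1], and s is either of its
    square roots. *)
Lemma su_fixed_root A (s : R) : su11 A -> s ^+ 2 = complex.Re A.1 ^+ 2 - 1 ->
  s != 0 ->
  [/\ normc ((s +i* complex.Im A.1)%C / A.2^*) = 1,
     su_act A ((s +i* complex.Im A.1)%C / A.2^*) = (s +i* complex.Im A.1)%C / A.2^* &
     su_den A ((s +i* complex.Im A.1)%C / A.2^*) = rc (s + complex.Re A.1)].
Proof.
move=> hA hs s0; have := hA => /su11_normP hn.
have b2 : normc A.2 ^+ 2 = s ^+ 2 + complex.Im A.1 ^+ 2.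
  move: hn; case: (A.1) hs => x y /= ->.
  by rewrite sqr_sqrtr ?addr_ge0 ?sqr_ge0//; lra.
have b0 : A.2 != 0.
  apply/eqP => b0; move: b2; rewrite b0 Normc.normc0 expr0n /= => /esym/eqP.
  by rewrite paddr_eq0 ?sqr_ge0// sqrf_eq0 (negbTE s0).
have bJ0 : A.2^* != 0 by rewrite conjC_eq0.
set u := (s +i* _)%C.
have e1 : normc (u / A.2^*) = 1.
  rewrite Normc.normcM Normc.normcV normcJE.
  have -> : normc u = normc A.2.
    by rewrite /u /= -b2 sqrtr_sqr ger0_norm// normc_ge0.
  by rewrite divff// gt_eqF// normc_gt0.
have hd : su_den A (u / A.2^*) = rc (s + complex.Re A.1).
  rewrite /su_den mulrC divfK// /u; case: (A.1) => x y /=.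
  by apply/eqP; rewrite eq_complex /= subrr !eqxx.
split=> //; rewrite su_actE hd; have d0 := su_den_circle hA e1.
rewrite hd in d0; apply: (mulIf d0); rewrite divfK//.
apply: (mulIf bJ0); have hw : u / A.2^* * A.2^* = u by rewrite divfK.
rewrite mulrDl [in RHS]mulrAC -[A.1 * _ * _]mulrA hw -sqr_normcE b2.
rewrite /u; case: (A.1) hs => x y /= hs.
by apply/eqP; rewrite eq_complex /=; apply/andP; split; apply/eqP; nra.
Qed.

Lemma hyperbolic_fixed_points A : su11 A -> 1 < `|complex.Re A.1| ->
  exists e f, [/\ normc e = 1, normc f = 1, e != f,
    su_act A e = e /\ su_act A f = f &
    exists2 z, normc z = 1 & su_act A z != z].
Proof.
move=> hA hR; set x := complex.Re A.1 in hR *.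
have x2 : 0 < x ^+ 2 - 1.
  by rewrite subr_gt0 -real_normK ?num_real// exprn_egt1// gtr0_norm ?(lt_trans _ hR).
pose s := Num.sqrt (x ^+ 2 - 1).
have s0 : s != 0 by rewrite gt_eqF// sqrtr_gt0.
have hs : s ^+ 2 = x ^+ 2 - 1 by rewrite sqr_sqrtr// ltW.
have [e1 he de] := su_fixed_root hA hs s0.
have hsN : (- s) ^+ 2 = x ^+ 2 - 1 by rewrite sqrrN.
have sN0 : - s != 0 by rewrite oppr_eq0.
have [f1 hf df] := su_fixed_root hA hsN sN0.
move: e1 he de f1 hf df; set e := (_ / _); set f := (_ / _) => e1 he de f1 hf df.
have ef : e != f.
  apply/eqP => ef; move: de; rewrite ef df => /complexI /addIr /eqP.
  by rewrite -subr_eq0 -opprD oppr_eq0 -mulr2n mulrn_eq0 (negbTE s0).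
exists e, f; split=> //.
have [z [z1 ze zf]] := circle_third f e1.
exists z => //; apply/eqP => hz.
have := fpcoord_act hA e1 f1 ef he hf z1 zf.
have F0 : fpcoord e f z != 0 by rewrite fpcoord_eq0.
rewrite hz -[LHS]mul1r => /(mulIf F0); rewrite df -rmorphXn -[LHS](rmorph1 rc) => /complexI.
(* With [s^2 = x^2 - 1], a multiplier [(x - s)^2] equal to 1 would give [s = 0] or [s = x], both
   impossible. *)
move=> h1; have : s * (s - x) = 0 by move: h1; rewrite -/x; lra.
move/eqP; rewrite mulf_eq0 (negbTE s0) subr_eq0 => /eqP sx.
by move: hs; rewrite sx; lra.
Qed.
End circle_fixed_points.

(** * The topology of [R[i]] through the real norm *)

Section complex_topology.
Context {R : realType}.
Local Notation C := R[i].
Local Notation normc := Normc.normc.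
Local Notation rc := (real_complex R).

(** The radii of balls in [R[i]^o] are complex numbers; a positive one has imaginary part 0, which
    reduces convergence to a statement over R. *)
Lemma cvgC_normc (T : Type) (F : set_system T) {FF : Filter F} (u : T -> R[i]^o)
    (l : R[i]^o) :
  u @ F --> l <-> (fun t => normc (u t - l)) @ F --> (0 : R).
Proof.
split.
  move=> /cvgrPdist_lt ul; apply/cvgrPdist_lt => e e0.
  have := ul (rc e); rewrite ltcR => /(_ e0); apply: filterS => t.
  by rewrite normE ltcR normcB sub0r normrN ger0_norm// normc_ge0.
move=> /cvgrPdist_lt ul; apply/cvgrPdist_lt => -[e e'].
rewrite ltcE /= => /andP[/eqP -> e0].
have := ul e e0; apply: filterS => t.
by rewrite normE ltcR normcB sub0r normrN ger0_norm// normc_ge0.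
Qed.

Lemma normc_continuous : continuous (@Normc.normc R : R[i]^o -> R).
Proof.
move=> z; apply/(@cvgrPdist_lt _ _ _ (nbhs z)) => e e0.
have /cvgC_normc/cvgrPdist_lt/(_ e e0) : id @ z --> z by exact: cvg_id.
apply: filterS => w; rewrite sub0r normrN ger0_norm ?normc_ge0// normcB.
apply: le_lt_trans; rewrite ler_norml le_normcB andbT lerNl opprB.
by rewrite normcB le_normcB.
Qed.

Lemma cvgC_subr (T : Type) (F : set_system T) {FF : Filter F} (u : T -> R[i]^o)
    (l z : R[i]^o) : u @ F --> l -> u t - z @[t --> F] --> l - z.
Proof.
move=> ul; apply/cvgC_normc.
have -> : (fun t => normc (u t - z - (l - z))) = (fun t => normc (u t - l)).
  by apply/funext => t; congr normc; rewrite opprB addrA subrK.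
exact/cvgC_normc.
Qed.

Lemma ler_Re_normc (z : C) : `|complex.Re z| <= normc z.
Proof. by rewrite -lecR -normE normc_ge_Re. Qed.

Lemma ler_Im_normc (z : C) : `|complex.Im z| <= normc z.
Proof.
have := ler_Re_normc (z * 'i%C); rewrite ReiNIm normrN.
by rewrite Normc.normcM /= expr0n expr1n add0r sqrtr1 mulr1.
Qed.

Lemma Re_continuous : continuous (@complex.Re R : R[i]^o -> R).
Proof.
move=> z; apply/(@cvgrPdist_lt _ _ _ (nbhs z)) => e e0.
have /cvgC_normc/cvgrPdist_lt/(_ e e0) : id @ z --> z by exact: cvg_id.
apply: filterS => w; rewrite sub0r normrN ger0_norm ?normc_ge0// normcB.
by apply: le_lt_trans; rewrite -raddfB; exact: ler_Re_normc.
Qed.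

Lemma Im_continuous : continuous (@complex.Im R : R[i]^o -> R).
Proof.
move=> z; apply/(@cvgrPdist_lt _ _ _ (nbhs z)) => e e0.
have /cvgC_normc/cvgrPdist_lt/(_ e e0) : id @ z --> z by exact: cvg_id.
apply: filterS => w; rewrite sub0r normrN ger0_norm ?normc_ge0// normcB.
by apply: le_lt_trans; rewrite -raddfB; exact: ler_Im_normc.
Qed.

Lemma complex_continuous (T : topologicalType) (f g : T -> R) :
  continuous f -> continuous g ->
  continuous ((fun t => (f t +i* g t)%C) : T -> R[i]^o).
Proof.
move=> cf cg t; apply/cvgC_normc.
have -> : (fun t0 => normc ((f t0 +i* g t0)%C - (f t +i* g t)%C)) =
  (fun t0 => Num.sqrt ((f t0 - f t) ^+ 2 + (g t0 - g t) ^+ 2)) by [].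
have <- : Num.sqrt ((f t - f t) ^+ 2 + (g t - g t) ^+ 2) = 0.
  by rewrite !subrr expr0n addr0 sqrtr0.
suff : {for t, continuous (@Num.sqrt R \o
    (fun t0 => (f t0 - f t) ^+ 2 + (g t0 - g t) ^+ 2))} by [].
apply: continuous_comp; last exact: sqrt_continuous.
apply: cvgD.
  apply: (@continuous_comp _ _ _ (fun t0 => f t0 - f t) (fun x : R => x ^+ 2)).
    by apply: cvgB; [exact: cf|exact: cvg_cst].
  exact: exprn_continuous.
apply: (@continuous_comp _ _ _ (fun t0 => g t0 - g t) (fun x : R => x ^+ 2)).
  by apply: cvgB; [exact: cg|exact: cvg_cst].
exact: exprn_continuous.
Qed.

Lemma cis_continuous : continuous (@cis R).
Proof.
apply: complex_continuous; [exact: continuous_cos|exact: continuous_sin].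
Qed.

Lemma normc_cis (t : R) : normc (cis t) = 1.
Proof. by rewrite /cis /= cos2Dsin2 sqrtr1. Qed.

Lemma cis0 : cis 0 = 1 :> C.
Proof. by rewrite /cis cos0 sin0. Qed.

Lemma cisD (s t : R) : cis (s + t) = cis s * cis t :> C.
Proof.
apply/eqP; rewrite eq_complex /= cosD sinD eqxx /=.
by apply/eqP; ring.
Qed.

Lemma cis_2pi : cis (2 * pi) = 1 :> C.
Proof. by rewrite /cis mulr_natl cos2pi sin2pi. Qed.

Lemma normc_cisB (s t : R) : normc (cis s - cis t) = 2 * `|sin ((s - t) / 2)|.
Proof.
apply/eqP; rewrite -(@eqrXn2 _ 2)// ?normc_ge0 ?mulr_ge0//.
rewrite exprMn real_normK ?num_real//.
apply/eqP; rewrite /= sqr_sqrtr ?addr_ge0 ?sqr_ge0//.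
have hs : s = (s + t) / 2 + (s - t) / 2 by lra.
have ht : t = (s + t) / 2 - (s - t) / 2 by lra.
move: hs ht; set a := (s - t) / 2; set b := (s + t) / 2 => -> ->.
rewrite cosD cosB sinD sinB.
have := cos2Dsin2 b; nra.
Qed.

End complex_topology.

(** * Dynamics of the deck group on the circle *)

Section deck_dynamics.
Context {R : realType} {I : finType} {X : topologicalType}.
Local Notation C := R[i].
Local Notation normc := Normc.normc.
Local Notation rc := (real_complex R).
Context (h : I -> X -> R[i]^o) (D : set (I -> C * C)).

(** X stands for the boundary and D for the deck group, an element being given by its matrices in
    all structures at once. [deck_cvg] is the continuity of the inverse of [h i], for sequences. In
    [deck_approx] the quotient of the coefficients is the image of the centre of the disc. *)
Record deck_system : Prop := DeckSystem {
  deck_circle : forall i x, normc (h i x) = 1;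
  deck_inj : forall i, injective (h i);
  deck_surj : forall i z, normc z = 1 -> exists x, h i x = z;
  deck_cont : forall i, continuous (h i);
  deck_cvg : forall i x (u : nat -> X),
    h i (u n) @[n --> \oo] --> h i x -> u n @[n --> \oo] --> x;
  deck_su : forall A, D A -> forall i, su11 (A i);
  deck_mul : forall A B, D A -> D B -> D (fun i => su_mul (A i) (B i));
  deck_inv : forall A, D A -> D (fun i => su_inv (A i));
  deck_map : forall A, D A -> exists t : X -> X,
    forall i x, h i (t x) = su_act (A i) (h i x);
  deck_approx : forall i z (e N : R), normc z = 1 -> 0 < e ->
    exists A, [/\ D A, N < normc (A i).1 &
                  normc ((A i).2 / (A i).1^* - z) < e] }.

Hypothesis hD : deck_system.

Lemma normc_real (x : R) : normc (rc x) = `|x|.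
Proof. by rewrite /= expr0n addr0 sqrtr_sqr. Qed.

(** Here [Im^2 >= |a|^2 - 1 >= 3/4 |a|^2], and [3/4 > (4/5)^2]. *)
Lemma Im_large (a : C) : 2 < normc a -> `|complex.Re a| <= 1 ->
  4 / 5 * normc a <= `|complex.Im a|.
Proof.
case: a => x y /= ha hx; set r := Num.sqrt _ in ha *.
have hr : r ^+ 2 = x ^+ 2 + y ^+ 2 by rewrite sqr_sqrtr// addr_ge0 ?sqr_ge0.
have hx2 : x ^+ 2 <= 1 by rewrite -real_normK ?num_real// expr_le1.
rewrite -(@ler_pXn2r _ 2)// ?nnegrE//; last by rewrite mulr_ge0//; nra.
by rewrite real_normK ?num_real//; nra.
Qed.

(** Let A and B bring the centre near 1 and near -1. If neither is hyperbolic, the coefficients a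
    and a' are almost imaginary. As [b / a^*] is near 1 and [b' / a'^*] near -1, the product has its
    first coefficient near [a' (a - a^* )], whose real part [- 2 Im(a) Im(a')] is large. *)
Lemma deck_hyperbolic i : exists2 A, D A & 1 < `|complex.Re (A i).1|.
Proof.
have e0 : 0 < 16^-1 :> R by rewrite invr_gt0.
have [A [DA hA hA1]] := deck_approx hD i 2 (@Normc.normc1 R) e0.
have [B [DB hB hB1]] := deck_approx hD i 2 (etrans (normcNE 1) (@Normc.normc1 R)) e0.
have [hRA|hRA] := ltP 1 `|complex.Re (A i).1|; first by exists A.
have [hRB|hRB] := ltP 1 `|complex.Re (B i).1|; first by exists B.
exists (fun j => su_mul (A j) (B j)); first exact: deck_mul.
rewrite /su_mul /=; have := Im_large hA hRA; have := Im_large hB hRB.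
move: hA1 hB1; case: (A i) hA hRA (deck_su hD DA i) => a b /= hA hRA sA.
case: (B i) hB hRB (deck_su hD DB i) => a' b' /= hB hRB sB.
have aJ0 : a^* != 0 by rewrite conjC_eq0; apply/eqP => a0; move: hA; rewrite a0 Normc.normc0 ltrn0.
have a'0 : a' != 0 by apply/eqP => a0; move: hB; rewrite a0 Normc.normc0 ltrn0.
have aJ'0 : a'^* != 0 by rewrite conjC_eq0.
set d := b / a^* - 1; set d' := b' / a'^* - -1 => dl dl' ylb ylb'.
have hb : b = a^* * (1 + d) by rewrite /d; field.
have hb' : b'^* = a' * (d'^* - 1).
  by rewrite /d' opprK conjcDE conjc1E conjcME conjcVE conjcKE addrK mulrC divfK.
set w := a' * a^* * (d'^* - d + d * d'^*).
have -> : a * a' + b * b'^* = a' * (a - a^*) + w.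
  by rewrite hb' hb /w; ring.
(* The tolerance 1/16 was chosen for [1/16 + 1/16 + 1/256 < 1/5], an error absorbed by the main
   term, at least [2 * (4/5)^2], both relative to [|a| |a'|]. *)
have hw : normc w <= normc a * normc a' * 5^-1.
  rewrite /w !Normc.normcM normcJE [normc a' * _]mulrC ler_wpM2l//.
    by rewrite mulr_ge0 ?normc_ge0.
  rewrite (le_trans (normc_triangle _ _))// Normc.normcM.
  have := normc_triangle d'^* (- d); rewrite normcNE !normcJE.
  have := normc_ge0 d; have := normc_ge0 d'; nra.
have hRw := ler_Re_normc w.
have -> : complex.Re (a' * (a - a^*) + w) =
  - 2 * complex.Im a * complex.Im a' + complex.Re w.
  rewrite raddfD /=; congr (_ + _).
  case: (a) => x y; case: (a') => x' y' /=; ring.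
set y := complex.Im a in ylb' *; set y' := complex.Im a' in ylb *.
have yy : (4 / 5 * normc a) * (4 / 5 * normc a') <= `|y * y'|.
  by rewrite normrM ler_pM// mulr_ge0// normc_ge0.
have := ler_normD (- 2 * y * y' + complex.Re w) (- complex.Re w).
rewrite normrN addrK -mulrA [`|_ * (y * y')|]normrM normrN (ger0_norm (ler0n _ 2)).
have P4 : 4 <= normc a * normc a' by nra.
by move: yy; lra.
Qed.

Definition fpc i o w x := fpcoord (h i o) (h i w) (h i x).

Lemma h_neq i x y : x != y -> h i x != h i y.
Proof. by apply: contra_neq => /(deck_inj hD). Qed.

Lemma fpc_eq0 i o w x : x != w -> (fpc i o w x == 0) = (x == o).
Proof. by move=> xw; rewrite fpcoord_eq0 ?h_neq// (inj_eq (@deck_inj hD i)). Qed.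

Lemma fpc_inj i o w x y : o != w -> x != w -> y != w ->
  fpc i o w x = fpc i o w y -> x = y.
Proof.
by move=> ow xw yw /fpcoord_inj H; apply: (deck_inj hD); apply: H; exact: h_neq.
Qed.

Lemma fpc_swap i o w x : fpc i w o x = (fpc i o w x)^-1.
Proof. by rewrite /fpc /fpcoord invf_div. Qed.

Lemma fpc_cvg0 i o w (u : nat -> X) : (forall n, u n != w) ->
  normc (fpc i o w (u n)) @[n --> \oo] --> (0 : R) -> u n @[n --> \oo] --> o.
Proof.
move=> uw hu; apply: (@deck_cvg hD i); apply/cvgC_normc.
apply: (@squeeze_cvgr _ _ _ _ (fun=> 0) (fun n => 2 * normc (fpc i o w (u n)))).
- apply: nearW => n; rewrite normc_ge0 /=.
  have -> : h i (u n) - h i o = fpc i o w (u n) * (h i (u n) - h i w).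
    by rewrite divfK// subr_eq0 h_neq.
  rewrite Normc.normcM mulrC ler_wpM2r ?normc_ge0//.
  by rewrite (le_trans (normc_triangle _ _))// normcNE !deck_circle.
- exact: cvg_cst.
- by rewrite -[X in _ --> X](mulr0 2); apply: cvgM => //; exact: cvg_cst.
Qed.

Lemma cvg_fpc0 i o w (u : nat -> X) : o != w ->
  u n @[n --> \oo] --> o -> normc (fpc i o w (u n)) @[n --> \oo] --> (0 : R).
Proof.
move=> ow hu.
have hc : h i (u n) @[n --> \oo] --> h i o.
  by apply: (cvg_comp _ _ hu); exact: deck_cont.
have c1 (p : X) : normc (h i (u n) - h i p) @[n --> \oo] --> normc (h i o - h i p).
  apply: (@cvg_comp _ _ _ (fun n => h i (u n) - h i p) (@Normc.normc R) _ _ _ _ (@normc_continuous R _)).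
  by apply: cvgC_subr.
have -> : (fun n => normc (fpc i o w (u n))) =
  (fun n => normc (h i (u n) - h i o) / normc (h i (u n) - h i w)).
  by apply/funext => n; rewrite /fpc /fpcoord Normc.normcM Normc.normcV.
rewrite -[X in _ --> X](mul0r (normc (h i o - h i w))^-1).
apply: cvgM; last by apply: cvgV => //; rewrite gt_eqF// normc_gt0// subr_eq0 h_neq.
by have := c1 o; rewrite subrr Normc.normc0.
Qed.

(* [t] moves everything but [w] towards [o], contracting by [q i] the coordinate
   attached to [h i]. *)
Definition loxodromic (t : X -> X) o w (q : I -> R) :=
  [/\ o != w, t o = o, t w = w &
      forall i, 0 < q i < 1 /\
        forall x, x != w -> fpc i o w (t x) = rc (q i) * fpc i o w x].

Lemma lox_neq t o w q (i : I) x : loxodromic t o w q -> x != w -> t x != w.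
Proof.
move=> [ow to tw /(_ i)[/andP[q0 q1] htx]] xw; apply/eqP => txw.
have := htx x xw; rewrite txw {1}/fpc /fpcoord subrr invr0 mulr0 => /esym/eqP.
rewrite mulf_eq0 fpc_eq0// => /orP[/eqP/complexI q00|/eqP xo].
  by rewrite q00 ltxx in q0.
by move: txw; rewrite xo to => /eqP; rewrite (negbTE ow).
Qed.

Lemma lox_neqo t o w q (i : I) x : loxodromic t o w q -> x != w -> x != o -> t x != o.
Proof.
move=> L xw xo; have txw := lox_neq i L xw.
have [ow to tw /(_ i)[/andP[q0 q1] htx]] := L.
rewrite -(@fpc_eq0 i _ w)// htx// mulf_eq0 fpc_eq0// (negbTE xo) orbF.
by rewrite -(rmorph0 rc) (inj_eq (@complexI R)) gt_eqF.
Qed.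

Lemma lox_iter t o w q (i : I) x n : loxodromic t o w q -> x != w ->
  iter n t x != w /\ fpc i o w (iter n t x) = rc (q i ^+ n) * fpc i o w x.
Proof.
move=> L xw; elim: n => [|n [IHw IH]]; first by rewrite expr0 rmorph1 mul1r.
split; first exact: (lox_neq i L).
have [ow to tw /(_ i)[/andP[q0 q1] htx]] := L.
by rewrite iterS htx// IH exprS rmorphM mulrA.
Qed.

Lemma lox_cvg t o w q (i : I) x : loxodromic t o w q -> x != w ->
  iter n t x @[n --> \oo] --> o.
Proof.
move=> L xw; apply: (@fpc_cvg0 i _ w) => [n|]; first by have [] := lox_iter i n L xw.
have -> : (fun n => normc (fpc i o w (iter n t x))) =
  (fun n => q i ^+ n * normc (fpc i o w x)).
  have [ow to tw /(_ i)[/andP[q0 q1] htx]] := L.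
  apply/funext => n; have [_ ->] := lox_iter i n L xw.
  by rewrite Normc.normcM normc_real ger0_norm// exprn_ge0// ltW.
rewrite -[X in _ --> X](mul0r (normc (fpc i o w x))).
apply: cvgM; last exact: cvg_cst.
have [ow to tw /(_ i)[/andP[q0 q1] htx]] := L.
by apply: cvg_expr; rewrite ger0_norm// ltW.
Qed.

Definition realizes (A : I -> C * C) (t : X -> X) :=
  D A /\ forall i x, h i (t x) = su_act (A i) (h i x).

Lemma realizes_inj A t (i : I) : realizes A t -> injective t.
Proof.
move=> [DA ht] x y /(congr1 (h i)); rewrite !ht => hxy.
have sA := deck_su hD DA i.
apply: (deck_inj hD (i := i)).
rewrite -(su_actK sA (_ : normc (h i x) <= 1)) ?deck_circle// hxy su_actK//.
by rewrite deck_circle.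
Qed.

Lemma realizes_inv A t : realizes A t -> I ->
  exists t', [/\ realizes (fun i => su_inv (A i)) t', cancel t t' & cancel t' t].
Proof.
move=> [DA ht] i; have DA' := deck_inv hD DA.
have [t' ht'] := deck_map hD DA'; exists t'; split; first by [].
  move=> x; apply: (deck_inj hD (i := i)); rewrite ht' ht su_actK ?deck_circle//.
  exact: deck_su.
move=> x; apply: (deck_inj hD (i := i)); rewrite ht ht'.
rewrite -[X in su_act X _](su_invK (A i)) su_actK ?deck_circle//.
exact: (deck_su hD DA').
Qed.

Lemma deck_multiplier A t o w z (i : I) : realizes A t -> o != w -> t o = o -> t w = w ->
  t z != z -> exists q : R, [/\ 0 < q, q != 1 &
    forall x, x != w -> fpc i o w (t x) = rc q * fpc i o w x].
Proof.
move=> At ow to tw tz; have [DA ht] := At; have sA := deck_su hD DA i.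
have ho : su_act (A i) (h i o) = h i o by rewrite -ht to.
have hw : su_act (A i) (h i w) = h i w by rewrite -ht tw.
have [k k0 hk] := su_den_fixed_real sA (deck_circle hD i w) hw.
have hF x : x != w -> fpc i o w (t x) = rc (k ^+ 2) * fpc i o w x.
  move=> xw; rewrite /fpc ht fpcoord_act ?deck_circle ?h_neq// hk.
  by rewrite rmorphXn.
have zw : z != w by apply: contra_neq tz => ->.
exists (k ^+ 2); split=> //.
  by rewrite lt_neqAle sqr_ge0 andbT eq_sym expf_neq0.
apply: contra_neq tz => k1.
apply: (@fpc_inj i o w) => //; last by rewrite hF// k1 rmorph1 mul1r.
by apply: contra_neq zw; rewrite -[in RHS]tw => /(realizes_inj i At).
Qed.

(** All multipliers differ from 1. That they lie on the same side of 1 is seen in X: the iterates of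
    x tend to o or not, independently of the index. If the multipliers exceed 1, o and w are
    exchanged. *)
Lemma lox_exists (i0 : I) : exists A t o w q,
  realizes A t /\ loxodromic t o w q.
Proof.
have [A DA hA] := deck_hyperbolic i0.
have [t ht] := deck_map hD DA.
have At : realizes A t by [].
have [e [f [e1 f1 ef [he hf] [z z1 hz]]]] := hyperbolic_fixed_points (deck_su hD DA i0) hA.
have [ o ho] := deck_surj hD i0 e1; have [w hw] := deck_surj hD i0 f1.
have [x hx] := deck_surj hD i0 z1.
have ow : o != w by apply: contra_neq ef; rewrite -ho -hw => ->.
have to : t o = o by apply: (deck_inj hD (i := i0)); rewrite ht ho.
have tw : t w = w by apply: (deck_inj hD (i := i0)); rewrite ht hw.
have tx : t x != x by apply: contra_neq hz => tx; rewrite -hx -ht tx.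
have /choice[q hq] : forall i, exists q : R, [/\ 0 < q, q != 1 &
    forall x, x != w -> fpc i o w (t x) = rc q * fpc i o w x].
  by move=> i; exact: (deck_multiplier i At ow to tw tx).
have tinj := realizes_inj i0 At.
have twn y : y != w -> t y != w.
  by move=> yw; rewrite -[X in _ != X]tw (inj_eq tinj).
have hit i n y : y != w ->
    iter n t y != w /\ fpc i o w (iter n t y) = rc (q i ^+ n) * fpc i o w y.
  move=> yw; elim: n => [|n [IHw IH]]; first by rewrite expr0 rmorph1 mul1r.
  split; first exact: twn.
  by have [_ _ htx] := hq i; rewrite iterS htx// IH exprS rmorphM mulrA.
have xw : x != w by apply: contra_neq tx => ->.
have xo : x != o by apply: contra_neq tx => ->.
have cons i j : q i < 1 -> q j < 1.
  move=> qi; have [qi0 _ _] := hq i; have [qj0 qj1 _] := hq j.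
  rewrite lt_neqAle qj1 /= leNgt; apply/negP => qj.
  have cvo : iter n t x @[n --> \oo] --> o.
    apply: (@fpc_cvg0 i _ w) => [n|]; first by have [] := hit i n x xw.
    have -> : (fun n => normc (fpc i o w (iter n t x))) =
        (fun n => q i ^+ n * normc (fpc i o w x)).
      apply/funext => n; have [_ ->] := hit i n x xw.
      by rewrite Normc.normcM normc_real ger0_norm// exprn_ge0// ltW.
    rewrite -[X in _ --> X](mul0r (normc (fpc i o w x))).
    apply: cvgM; last exact: cvg_cst.
    by apply: cvg_expr; rewrite ger0_norm// ltW.
  have := cvg_fpc0 j ow cvo => /cvgrPdist_lt/(_ (normc (fpc j o w x))).
  rewrite normc_gt0 ?fpc_eq0// => /(_ isT)[N _ /(_ N (leqnn N))] /=.
  have [_ ->] := hit j N x xw.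
  rewrite sub0r normrN Normc.normcM normc_real normrM normr_id.
  rewrite [X in _ * X]ger0_norm ?normc_ge0// gtr_pMl ?normc_gt0 ?fpc_eq0//.
  by rewrite ger0_norm ?exprn_ge0 ?ltW// ltNge exprn_ege1// ltW.
have [q01|q01] := ltP (q i0) 1.
  exists A, t, o, w, q; split=> //; split=> // i.
  by have [q0 _ ?] := hq i; rewrite q0 (cons i0).
exists A, t, w, o, (fun i => (q i)^-1); split=> //; split=> //; first by rewrite eq_sym.
move=> i; have [q0 q1 hqi] := hq i.
have qi1 : 1 < q i.
  rewrite lt_neqAle eq_sym q1 /= leNgt; apply/negP => qi1.
  by move: q01; rewrite leNgt (cons i).
split; first by rewrite invr_gt0 q0 invf_lt1.
(* At [y = w] the coordinate [fpc i o w] divides by zero and is 0 by convention; both sides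
   vanish. *)
move=> y yo; rewrite (fpc_swap i o w (t y)) (fpc_swap i o w y); have [->|yw] := eqVneq y w.
  by rewrite tw /fpc /fpcoord subrr !invr0 mulr0 invr0 mulr0.
by rewrite hqi// invfM fmorphV.
Qed.

Lemma lox_inv A t o w q : realizes A t -> I -> loxodromic t o w q ->
  exists A' t', realizes A' t' /\ loxodromic t' w o q.
Proof.
move=> At i0 [ow to tw hq]; have [t' [At' tK t'K]] := realizes_inv At i0.
exists (fun i => su_inv (A i)), t'; split=> //; split.
- by rewrite eq_sym.
- by rewrite -[in LHS]tw tK.
- by rewrite -[in LHS]to tK.
- move=> i; have [q01 hx] := hq i; split=> // x xo.
  have [->|xw] := eqVneq x w.
    have -> : t' w = w by rewrite -{1}tw tK.
    by rewrite /fpc /fpcoord subrr mul0r mulr0.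
  have t'w : t' x != w by apply: contra_neq xw => t'w; rewrite -(t'K x) t'w tw.
  have q0 : rc (q i) != 0.
    by rewrite -(rmorph0 rc) (inj_eq (@complexI R)); have /andP[/lt0r_neq0] := q01.
  have hF : fpc i o w x = rc (q i) * fpc i o w (t' x) by rewrite -hx// t'K.
  by rewrite (fpc_swap i o w (t' x)) (fpc_swap i o w x) hF [in RHS]invfM mulVKf.
Qed.

(** B brings the centre close to a third point z. If s kept both o and w in the pair, their images
    would stay away from z, so the denominator would be small at o and at w. But these two
    denominators differ by [b^* (h o - h w)], with b the second coefficient, which is large. *)
Lemma deck_not_invariant_pair (i0 : I) o w : o != w ->
  exists B s, realizes B s /\ ~ ((s o = o \/ s o = w) /\ (s w = o \/ s w = w)).
Proof.
move=> ow; have [z [z1 zo zw]] := circle_third (h i0 w) (deck_circle hD i0 o).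
set e := Num.min (normc (h i0 o - z)) (normc (h i0 w - z)) / 2.
have e0 : 0 < e.
  by rewrite divr_gt0// lt_min !normc_gt0// subr_eq0 eq_sym.
have d0 : 0 < normc (h i0 o - h i0 w) by rewrite normc_gt0// subr_eq0 h_neq.
set d := normc _ in d0.
(* This bound makes [a / 2 * d * (e * a)] exceed [2 * a], while two small denominators would force
   it to be at most 2. *)
have [B [DB hN hB]] := deck_approx hD i0 (2 + 4 / (e * d)) z1 e0.
have [s hs] := deck_map hD DB; exists B, s; split=> // -[so sw].
have sB := deck_su hD DB i0.
have ed0 : 0 < e * d by rewrite mulr_gt0.
have near p : (s p = o \/ s p = w) -> normc (su_den (B i0) (h i0 p)) * e * normc (B i0).1 <= 1.
  move=> sp; have den0 : 0 < normc (su_den (B i0) (h i0 p)).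
    by rewrite normc_gt0// su_den_circle// deck_circle.
  have a0 : 0 < normc (B i0).1 by rewrite (lt_le_trans ltr01)// su11_ge1.
  have := su_act_centerB sB (_ : normc (h i0 p) <= 1); rewrite deck_circle// => /(_ (lexx _)).
  rewrite div1r => hc.
  rewrite mulrAC -ler_pdivlMl ?mulr_gt0// mulr1 mulrC -[leRHS]mul1r -[1]invr1.
  rewrite invr1 mul1r -hc -hs.
  have : 2 * e <= normc (h i0 (s p) - z).
    rewrite /e mulrC divfK//.
    by case: sp => ->; rewrite ge_min lexx ?orbT.
  have := normc_triangle (h i0 (s p) - (B i0).2 / (B i0).1^*) ((B i0).2 / (B i0).1^* - z).
  by rewrite addrA subrK; lra.
have No := near o so; have Nw := near w sw.
set a := normc (B i0).1 in hN No Nw.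
set b := normc (B i0).2.
have hb : b * d <= normc (su_den (B i0) (h i0 o)) + normc (su_den (B i0) (h i0 w)).
  rewrite -normcNE -[normc (su_den _ (h i0 w))]normcNE normcNE.
  rewrite (le_trans _ (normc_triangle _ _))// /b /d -normcJE -Normc.normcM.
  have -> : (B i0).2^* * (h i0 o - h i0 w) = su_den (B i0) (h i0 o) - su_den (B i0) (h i0 w).
    by rewrite /su_den; ring.
  exact: lexx.
have := sB => /su11_normP; rewrite -/a -/b => ab.
have b0 : 0 <= b by rewrite normc_ge0.
have K : 0 < 4 / (e * d) by rewrite divr_gt0.
have a2 : 2 < a by lra.
have hab : a / 2 <= b by rewrite -(@ler_pXn2r _ 2)// ?nnegrE//; nra.
have hK : 4 / (e * d) < a by lra.
move: hK; rewrite ltr_pdivrMr// => hK.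
have : b * d * (e * a) <= 2.
  apply: le_trans (_ : (normc (su_den (B i0) (h i0 o)) + normc (su_den (B i0) (h i0 w))) * (e * a) <= 2).
    by rewrite ler_wpM2r// mulr_ge0; lra.
  by lra.
have : a / 2 * (d * (e * a)) <= b * (d * (e * a)).
  have da : 0 <= d * (e * a).
    apply: mulr_ge0; first exact: ltW.
    by apply: mulr_ge0; [exact: ltW|lra].
  exact: ler_wpM2r.
nra.
Qed.

(** If s sends o or w to w, it sends neither of them to o, since it is injective and does not
    preserve the pair. Then the inverse of t serves, for which o and w are exchanged. *)
Lemma lox_generic (i0 : I) : exists t o w q B s,
  [/\ loxodromic t o w q, realizes B s, s o != w & s w != w].
Proof.
have [A [t [ o [w [q [At L]]]]]] := lox_exists i0.
have [A' [t' [At' L']]] := lox_inv At i0 L.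
have [ow _ _ _] := L.
have [B [s [Bs hs]]] := deck_not_invariant_pair i0 ow.
have [h1|/negP h1] := boolP ((s o != w) && (s w != w)).
  by move: h1 => /andP[? ?]; exists t, o, w, q, B, s.
exists t', w, o, q, B, s.
have sinj := realizes_inj i0 Bs.
split=> //; apply/eqP => so; apply: h1; apply: contrapT => h2; apply: hs.
- have := ow; rewrite -(inj_eq sinj) so => h3.
  move: h2 => /negP; rewrite negb_and !negbK => /orP[|] /eqP h2.
    by split; [right|left].
  by move: ow; rewrite -h2 so eqxx.
- have := ow; rewrite -(inj_eq sinj) so => h3.
  move: h2 => /negP; rewrite negb_and !negbK => /orP[|] /eqP h2.
    by move: ow; rewrite -h2 so eqxx.
  by split; [left|right].
Qed.

End deck_dynamics.

(** * Coinciding poles of rational identities, and finite closed covers *)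

Section rational_identities.
Context {F : fieldType} {I : finType}.

(* A sum of simple fractions with pairwise distinct poles is not identically 0;
   here the poles are the 1 / s i. *)
Lemma rational_poles (J : {pred I}) (b a s : I -> F) (x : nat -> F) (i0 : I) :
  i0 \in J -> (forall i, i \in J -> a i != 0) -> (forall i, i \in J -> s i != 0) ->
  injective x ->
  (forall m, exists n, [/\ (m <= n)%N, forall i, i \in J -> 1 - s i * x n != 0 &
    \sum_(i in J) (b i + a i * (x n / (1 - s i * x n))) = 0]) ->
  exists i j, [/\ i \in J, j \in J, i != j & s i = s j].
Proof.
move=> i0J a0 s0 xinj hx; apply: contrapT => hne.
have sne i j : i \in J -> j \in J -> i != j -> s i != s j.
  by move=> iJ jJ ij; apply/eqP => sij; apply: hne; exists i, j.
pose P (i : I) : {poly F} := 1 - (s i)%:P * 'X.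
(* The sum of fractions multiplied by its common denominator. *)
pose p : {poly F} := (\sum_(i in J) b i)%:P * \prod_(i in J) P i +
  \sum_(i in J) (a i)%:P * 'X * \prod_(j in J | j != i) P j.
have PE i y : (P i).[y] = 1 - s i * y by rewrite !hornerE.
have rootp n : (forall i, i \in J -> 1 - s i * x n != 0) ->
    \sum_(i in J) (b i + a i * (x n / (1 - s i * x n))) = 0 -> root p (x n).
  move=> hn h0; rewrite /root.
  have -> : p.[x n] = (\prod_(i in J) (1 - s i * x n)) *
      \sum_(i in J) (b i + a i * (x n / (1 - s i * x n))).
    rewrite big_split /= mulrDr hornerD; congr (_ + _).
      rewrite hornerM hornerC mulrC; congr (_ * _).
      by rewrite horner_prod; apply: eq_bigr => i _; rewrite PE.
    rewrite horner_sum mulr_sumr; apply: eq_bigr => i iJ.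
    rewrite !hornerM hornerC hornerX horner_prod (bigD1 i iJ) /=.
    have -> : \prod_(j in J | j != i) (P j).[x n] =
        \prod_(j in J | j != i) (1 - s j * x n).
      by apply: eq_bigr => j _; rewrite PE.
    set Q := \prod_(j in J | _) _.
    by field; exact: hn.
  by rewrite h0 mulr0.
(* At the pole of i0 every term of p but one contains the factor [P i0], which vanishes there; the
   remaining one is a product of nonzero factors because the poles are distinct. *)
have [p0|p0] := eqVneq p 0.
  have : p.[(s i0)^-1] = 0 by rewrite p0 horner0.
  rewrite /p hornerD hornerM horner_prod [X in _ * X + _](bigD1 i0 i0J) /= PE mulfV ?s0// subrr.
  rewrite mul0r mulr0 add0r horner_sum (bigD1 i0 i0J) /= [X in _ + X]big1; last first.
    move=> i /andP[iJ ii0]; rewrite hornerM horner_prod (bigD1 i0); last first.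
      by rewrite i0J eq_sym ii0.
    by rewrite PE mulfV ?s0// subrr /= mul0r mulr0.
  rewrite addr0 !hornerM hornerC hornerX horner_prod => /eqP.
  rewrite !mulf_eq0 (negbTE (a0 _ i0J)) invr_eq0 (negbTE (s0 _ i0J)) /=.
  move=> /prodf_eq0[j /andP[jJ ji0]]; rewrite PE subr_eq0 eq_sym.
  have sj := sne _ _ jJ i0J ji0.
  by rewrite -(inj_eq (mulIf (s0 _ i0J))) divfK ?s0// mul1r (negbTE sj).
(* Otherwise [size p] distinct roots are found among the [x n], one more than the degree allows. *)
have [rs [urs srs /allP hrs]] : exists rs : seq nat,
    [/\ uniq rs, size rs = size p & all (fun n => root p (x n)) rs].
  elim: (size p) => [|k [rs [urs srs hrs]]]; first by exists [::].
  have [n [mn hn h0]] := hx (\max_(i <- rs) i).+1.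
  exists (n :: rs); split=> /=; last by rewrite hrs rootp.
  - rewrite urs andbT; apply/negP => nrs.
    by have := leq_trans mn (@leq_bigmax_seq _ _ xpredT id n nrs isT); rewrite ltnn.
  - by rewrite srs.
have := @max_poly_roots _ p [seq x n | n <- rs] p0.
rewrite size_map srs ltnn => h.
suff: false by [].
apply: h; last by rewrite map_inj_uniq.
by apply/allP => y /mapP[n nrs ->]; exact: hrs.
Qed.

End rational_identities.

(** A finite form of Baire's theorem: if V is not inside the first closed set, removing that set
    leaves a nonempty open set covered by the others. *)
Lemma finite_closed_cover (X : topologicalType) (K : eqType) (l : seq K)
    (V : set X) (E : K -> set X) :
  open V -> V !=set0 -> (forall k, closed (E k)) ->
  (forall x, V x -> exists2 k, k \in l & E k x) ->
  exists k U, [/\ k \in l, open U, U !=set0, U `<=` V & U `<=` E k].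
Proof.
elim: l V => [|k l IH] V oV V0 cE hV.
  by have [x /hV[]] := V0.
have [VE|VE] := pselect (V `<=` E k).
  by exists k, V; split=> //; rewrite mem_head.
have [j [U [jl oU U0 UV UE]]] : exists j U,
    [/\ j \in l, open U, U !=set0, U `<=` V `&` ~` E k & U `<=` E j].
  apply: IH => //.
  - by apply: openI => //; exact: closed_openC.
  - by move/existsNP: VE => [x /not_implyP[Vx nEx]]; exists x.
  - move=> x [Vx nEx]; have [j + Ejx] := hV x Vx.
    by rewrite inE => /orP[/eqP jk|jl]; [rewrite jk in Ejx|exists j].
exists j, U; split=> //; first by rewrite inE jl orbT.
by move=> x /UV[].
Qed.

Section complex_limits.
Context {R : realType} {T : Type} {F : set_system T} {FF : Filter F}.
Local Notation C := R[i].
Local Notation normc := Normc.normc.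

Lemma cvgC_mul (u v : T -> R[i]^o) (l m : C) :
  u @ F --> (l : R[i]^o) -> v @ F --> (m : R[i]^o) ->
  (u t : C) * (v t : C) @[t --> F] --> (l * m : R[i]^o).
Proof.
move=> /cvgC_normc ul /cvgC_normc vm; apply/cvgC_normc.
apply: (@squeeze_cvgr _ _ _ _ (fun=> 0) (fun t => normc (u t - l) * normc (v t - m) +
  normc (u t - l) * normc m + normc l * normc (v t - m))).
- apply: nearW => t; rewrite normc_ge0 /=.
  have -> : (u t : C) * (v t : C) - l * m =
    (u t - l) * (v t - m) + (u t - l) * m + l * (v t - m) by ring.
  rewrite (le_trans (normc_triangle _ _))// !Normc.normcM lerD2r.
  by rewrite (le_trans (normc_triangle _ _))// !Normc.normcM.
- exact: cvg_cst.
- rewrite [X in _ --> X](_ : _ = 0 * 0 + 0 * normc m + normc l * 0); last by ring.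
  apply: cvgD; [apply: cvgD|]; apply: cvgM => //; exact: cvg_cst.
Qed.

Lemma cvgC_sub (u v : T -> R[i]^o) (l m : C) :
  u @ F --> (l : R[i]^o) -> v @ F --> (m : R[i]^o) ->
  (u t : C) - (v t : C) @[t --> F] --> (l - m : R[i]^o).
Proof.
move=> /cvgC_normc ul /cvgC_normc vm; apply/cvgC_normc.
apply: (@squeeze_cvgr _ _ _ _ (fun=> 0) (fun t => normc (u t - l) + normc (v t - m))).
- apply: nearW => t; rewrite normc_ge0 /=.
  have -> : (u t : C) - (v t : C) - (l - m) = (u t - l) - (v t - m) by ring.
  by rewrite (le_trans (normc_triangle _ _))// normcNE.
- exact: cvg_cst.
- by rewrite -[X in _ --> X]addr0; apply: cvgD.
Qed.

Lemma cvgC_unique (u : T -> R[i]^o) (l m : C) : ProperFilter F ->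
  u @ F --> (l : R[i]^o) -> u @ F --> (m : R[i]^o) -> l = m.
Proof.
move=> PF /cvgC_normc/cvgrPdist_lt ul /cvgC_normc/cvgrPdist_lt um.
apply/eqP; rewrite -subr_eq0; apply: contraT => /normc_gt0 d0.
have d2 : 0 < normc (l - m) / 2 by rewrite divr_gt0.
have [t [h1 h2]] := @filter_ex _ _ PF _ (filterI (ul _ d2) (um _ d2)).
move: h1 h2; rewrite !sub0r !normrN !ger0_norm ?normc_ge0// => h1 h2.
have := normc_triangle (l - u t) (u t - m).
by rewrite addrA subrK [normc (l - u t)]normcB; lra.
Qed.

End complex_limits.

(** * Cross ratios and their propagation by deck transformations *)

Section cross_ratios.
Context {R : realType} {I : finType} {X : topologicalType}.
Local Notation C := R[i].
Local Notation normc := Normc.normc.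
Context (h : I -> X -> R[i]^o) (D : set (I -> C * C)).
Hypothesis hD : deck_system h D.

Definition cross_ratio (i : I) (a b c d : X) : C :=
  ((h i a - h i c) * (h i b - h i d)) / ((h i a - h i d) * (h i b - h i c)).

Lemma cross_ratio_fpc i o w a b c d : o != w ->
  a != w -> b != w -> c != w -> d != w ->
  let f := fpc h i o w in
  cross_ratio i a b c d = ((f a - f c) * (f b - f d)) / ((f a - f d) * (f b - f c)).
Proof.
move=> ow aw bw cw dw; have hn := h_neq hD.
rewrite /= /fpc !fpcoordB ?hn// /cross_ratio.
(* If [a = d] or [b = c], both quotients have denominator zero and equal 0. *)
have [->|ad] := eqVneq a d; first by rewrite !subrr !mul0r invr0 !mulr0.
have [->|bc] := eqVneq b c; first by rewrite !subrr !(mul0r, mulr0) invr0 !mulr0.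
by field; rewrite !subr_eq0 !hn.
Qed.

Lemma cross_ratio_deck A t i a b c d : realizes h D A t ->
  cross_ratio i (t a) (t b) (t c) (t d) = cross_ratio i a b c d.
Proof.
move=> [DA ht]; have sA := deck_su hD DA i.
have dn x := su_den_circle sA (deck_circle hD i x).
rewrite /cross_ratio !ht !su_actB//.
have [->|ad] := eqVneq a d; first by rewrite !subrr !mul0r invr0 !mulr0.
have [->|bc] := eqVneq b c; first by rewrite !subrr !(mul0r, mulr0) invr0 !mulr0.
by field; rewrite !subr_eq0 !dn !(h_neq hD).
Qed.

(** The points are obtained by rotating [h i x] through the angles [1 / (n+1)]. They serve to move a
    configuration off a finite set. *)
Lemma approach_point (i : I) (x : X) : exists2 u : nat -> X,
  u n @[n --> \oo] --> x & forall y, \forall n \near \oo, u n != y.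
Proof.
have hz (n : nat) : normc (h i x * cis n.+1%:R^-1) = 1.
  by rewrite Normc.normcM (deck_circle hD) normc_cis mulr1.
have /choice[u hu] : forall n : nat, exists y, h i y = h i x * cis n.+1%:R^-1.
  by move=> n; exact: (deck_surj hD i (hz n)).
have cu : u n @[n --> \oo] --> x.
  apply: (deck_cvg hD (i := i)).
  have -> : (fun n => h i (u n)) = (fun n => h i x * cis (n.+1%:R^-1)).
    by apply/funext => n; rewrite hu.
  rewrite -[X in _ --> X]mulr1 -cis0; apply: cvgC_mul; first exact: cvg_cst.
  apply: (@cvg_comp _ _ _ (fun n : nat => n.+1%:R^-1 : R) (@cis R)); last exact: cis_continuous.
  exact: cvg_harmonic.
exists u => // y; have [->|xy] := eqVneq y x.
  apply: nearW => n; apply/eqP => /(congr1 (h i)); rewrite hu => /eqP.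
  rewrite -subr_eq0 -[X in _ - X]mulr1 -mulrBr mulf_eq0.
  rewrite (negbTE (circle_neq0 (deck_circle hD i x))) /= subr_eq0 => /eqP.
  have n0 : 0 < n.+1%:R^-1 :> R by rewrite invr_gt0.
  have n1 : n.+1%:R^-1 <= 1 :> R by rewrite invf_le1// ler1n.
  move=> /(congr1 (@complex.Im R)) /= s0.
  have : 0 < sin (n.+1%:R^-1 : R); last by rewrite s0 ltxx.
  apply: sin_gt0_pi; rewrite n0 (le_lt_trans n1)//.
  by rewrite (lt_le_trans _ (pi_ge2 R))// ltr1n.
have d0 : 0 < normc (h i x - h i y) by rewrite normc_gt0// subr_eq0 (h_neq hD)// eq_sym.
have : h i (u n) @[n --> \oo] --> h i x.
  by apply: (cvg_comp _ _ cu); exact: (deck_cont hD).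
move=> /cvgC_normc/cvgrPdist_lt/(_ _ d0); apply: filterS => n.
rewrite sub0r normrN ger0_norm ?normc_ge0// => hn.
by apply/eqP => uy; move: hn; rewrite uy normcB ltxx.
Qed.

(** A is taken with a large first coefficient and with the image of the centre near a point of U.
    The points that it does not bring into U have small denominators, hence lie close together; as
    the points of F are at least d apart, at most one of them, x0, is exceptional. *)
Lemma contract_into (i : I) (U : set X) (F : seq X) : open U -> U !=set0 ->
  uniq F ->
  exists A t x0, realizes h D A t /\ forall x, x \in F -> x != x0 -> U (t x).
Proof.
move=> oU [z Uz] uF.
(* As [deck_cvg] concerns sequences, the ball inside U is obtained by contradiction. *)
have [e e0 he] : exists2 e : R, 0 < e &
    forall y, normc (h i y - h i z) < e -> U y.
  apply: contrapT => hne.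
  have /choice[u hu] : forall n : nat, exists y,
      normc (h i y - h i z) < n.+1%:R^-1 /\ ~ U y.
    move=> n; apply: contrapT => hn; apply: hne.
    exists n.+1%:R^-1; first by rewrite invr_gt0.
    by move=> y hy; apply: contrapT => Uy; apply: hn; exists y.
  have : u n @[n --> \oo] --> z.
    apply: (deck_cvg hD (i := i)); apply/cvgC_normc.
    apply: (@squeeze_cvgr _ _ _ _ (fun=> 0) (fun n => n.+1%:R^-1)).
    - by apply: nearW => n; rewrite normc_ge0 /= ltW//; have [] := hu n.
    - exact: cvg_cst.
    - exact: cvg_harmonic.
  move=> /(_ U (open_nbhs_nbhs (conj oU Uz)))[N _ /(_ N (leqnn N))] /=.
  by have [] := hu N.
have e2 : 0 < e / 2 by rewrite divr_gt0.
have [d d0 hd] : exists2 d : R, 0 < d & forall x y, x \in F -> y \in F -> x != y ->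
    d <= normc (h i x - h i y).
  pose G := [seq (x, y) | x <- F, y <- F].
  pose f (p : X * X) := if p.1 == p.2 then 1 else normc (h i p.1 - h i p.2).
  exists (\big[Num.min/1]_(p <- G) f p).
    elim/big_ind : _ => // [x y x0 y0|p _]; first by rewrite lt_min x0.
    by rewrite /f; case: eqP => // /eqP pp; rewrite normc_gt0// subr_eq0 (h_neq hD).
  move=> x y xF yF xy.
  have pG : (x, y) \in G by apply/allpairsP; exists (x, y).
  have -> : normc (h i x - h i y) = f (x, y) by rewrite /f /= (negbTE xy).
  elim: (G) pG => // r G' IH; rewrite inE big_cons ge_min.
  by move=> /orP[/eqP->|/IH->]; rewrite ?lexx ?orbT.
(* Two points of F with small denominators would give [a / 2 * d * (e * a) <= 4], whereas this bound
   makes it exceed [4 * a]. *)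
have [A [DA hN hA]] := deck_approx hD i (2 + 8 / (e * d)) (deck_circle hD i z) e2.
have [t ht] := deck_map hD DA.
have sA := deck_su hD DA i.
set a := normc (A i).1 in hN.
have ed0 : 0 < e * d by rewrite mulr_gt0.
have K : 0 < 8 / (e * d) by rewrite divr_gt0.
have a2 : 2 < a by lra.
have a0 : 0 < a by lra.
have hK : 8 / (e * d) < a by lra.
have := sA => /su11_normP; rewrite -/a; set b := normc (A i).2 => ab.
have b0 : 0 <= b by rewrite normc_ge0.
have hab : a / 2 <= b by rewrite -(@ler_pXn2r _ 2)// ?nnegrE//; nra.
have far x : 2 / (e * a) < normc (su_den (A i) (h i x)) -> U (t x).
  move=> hx; apply: he; rewrite ht.
  have den0 : 0 < normc (su_den (A i) (h i x)).
    by rewrite normc_gt0// su_den_circle// (deck_circle hD).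
  have := su_act_centerB sA (_ : normc (h i x) <= 1); rewrite (deck_circle hD)// => /(_ (lexx _)).
  rewrite div1r -/a => hc.
  have : (a * normc (su_den (A i) (h i x)))^-1 < e / 2.
    rewrite -[e / 2]invrK ltf_pV2 ?posrE ?mulr_gt0 ?invr_gt0//.
    rewrite invf_div; move: hx; rewrite ltr_pdivrMr ?mulr_gt0// ltr_pdivrMr//.
    by lra.
  rewrite -hc => hc'.
  have := normc_triangle (su_act (A i) (h i x) - (A i).2 / (A i).1^*)
    ((A i).2 / (A i).1^* - h i z).
  by rewrite addrA subrK; lra.
have close x y : x \in F -> y \in F -> x != y ->
    normc (su_den (A i) (h i x)) <= 2 / (e * a) ->
    2 / (e * a) < normc (su_den (A i) (h i y)).
  move=> xF yF xy hx; rewrite ltNge; apply/negP => hy.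
  have : b * normc (h i x - h i y) <= 4 / (e * a).
    rewrite /b -normcJE -Normc.normcM.
    have -> : (A i).2^* * (h i x - h i y) = su_den (A i) (h i x) - su_den (A i) (h i y).
      by rewrite /su_den; ring.
    rewrite (le_trans (normc_triangle _ _))// normcNE.
    by have := lerD hx hy; lra.
  have hdxy := hd x y xF yF xy.
  rewrite ler_pdivlMr ?mulr_gt0// => h4.
  have : a / 2 * d <= b * normc (h i x - h i y) by apply: ler_pM => //; lra.
  move=> h5; have : a / 2 * d * (e * a) <= 4.
    by apply: le_trans h4; rewrite ler_wpM2r// mulr_ge0 ?ltW.
  by move: hK; rewrite ltr_pdivrMr//; nra.
have [[x0 x0F hx0]|hno] := pselect (exists2 x0, x0 \in F &
    normc (su_den (A i) (h i x0)) <= 2 / (e * a)).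
  exists A, t, x0; split=> // x xF xx0; apply: far; apply: (close x0) => //.
  by rewrite eq_sym.
exists A, t, z; split=> // x xF _; apply: far; rewrite ltNge; apply/negP => hx.
by apply: hno; exists x.
Qed.

(** The difficulty is the exceptional point of [contract_into]. If the cross ratios differed at [S =
    [:: a; b; c; d]], no contraction could bring all of S into U. So when S is contracted together
    with four points outside it, the exceptional point belongs to S and the four others satisfy the
    identity. Letting them tend to a, b, c, d gives a contradiction. *)
Lemma cross_ratio_spread (i j : I) (U : set X) : open U -> U !=set0 ->
  (forall a b c d, U a -> U b -> U c -> U d ->
    cross_ratio i a b c d = cross_ratio j a b c d) ->
  forall a b c d, a != d -> b != c ->
    cross_ratio i a b c d = cross_ratio j a b c d.
Proof.
move=> oU U0 hU a b c d ad bc; apply: contrapT => hne.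
pose S := [:: a; b; c; d].
have disj a' b' c' d' : a' \notin S -> b' \notin S -> c' \notin S -> d' \notin S ->
    cross_ratio i a' b' c' d' = cross_ratio j a' b' c' d'.
  move=> a'S b'S c'S d'S.
  have [A [t [x0 [At hx]]]] := contract_into i oU U0 (undup_uniq (S ++ [:: a'; b'; c'; d'])).
  have hx' x : x \in S ++ [:: a'; b'; c'; d'] -> x != x0 -> U (t x).
    by move=> xF; apply: hx; rewrite mem_undup.
  have [x0S|x0S] := boolP (x0 \in S).
    rewrite -(cross_ratio_deck i a' b' c' d' At) -(cross_ratio_deck j a' b' c' d' At).
    apply: hU; apply: hx';
      rewrite ?mem_cat ?inE ?eqxx ?orbT//.
    + by apply: contraNneq a'S => ->.
    + by apply: contraNneq b'S => ->.
    + by apply: contraNneq c'S => ->.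
    + by apply: contraNneq d'S => ->.
  exfalso; apply: hne.
  rewrite -(cross_ratio_deck i a b c d At) -(cross_ratio_deck j a b c d At).
  apply: hU; apply: hx';
    rewrite ?mem_cat ?inE ?eqxx ?orbT//; apply: contraNneq x0S => <-;
    by rewrite !inE eqxx ?orbT.
have [ua ca na] := approach_point i a; have [ub cb nb] := approach_point i b.
have [uc cc nc] := approach_point i c; have [ud cd nd] := approach_point i d.
pose P k (x : nat -> X) (y : nat -> X) := fun n => h k (x n) - h k (y n).
have cP k (x y : nat -> X) (p q : X) : x n @[n --> \oo] --> p -> y n @[n --> \oo] --> q ->
    P k x y n @[n --> \oo] --> (h k p - h k q : R[i]^o).
  move=> xp yq; apply: cvgC_sub.
    by apply: (cvg_comp _ _ xp); exact: (deck_cont hD).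
  by apply: (cvg_comp _ _ yq); exact: (deck_cont hD).
pose N k := (h k a - h k c) * (h k b - h k d).
pose M k := (h k a - h k d) * (h k b - h k c).
pose Nn k n : R[i]^o := (P k ua uc n) * (P k ub ud n).
pose Mn k n : R[i]^o := (P k ua ud n) * (P k ub uc n).
have cN k : Nn k n @[n --> \oo] --> (N k : R[i]^o) by apply: cvgC_mul; apply: cP.
have cM k : Mn k n @[n --> \oo] --> (M k : R[i]^o) by apply: cvgC_mul; apply: cP.
have M0 k : M k != 0 by rewrite mulf_neq0// subr_eq0 (h_neq hD).
apply: hne; rewrite /cross_ratio -/(N i) -/(N j) -/(M i) -/(M j).
(* The limit is taken on products, with the denominators cleared; they do not vanish because
   [a != d] and [b != c]. *)
apply/eqP; rewrite eqr_div//; apply/eqP.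
have c1 : (Nn i n : C) * (Mn j n : C) @[n --> \oo] --> (N i * M j : R[i]^o) by exact: (cvgC_mul (cN i) (cM j)).
have c2 : (Nn j n : C) * (Mn i n : C) @[n --> \oo] --> (N j * M i : R[i]^o) by exact: (cvgC_mul (cN j) (cM i)).
apply: (cvgC_unique _ c1); apply: (cvg_trans _ c2).
apply: near_eq_cvg.
have Mnz k : \forall n \near \oo, Mn k n != 0.
  move/cvgC_normc/cvgrPdist_lt : (cM k) => /(_ _ (normc_gt0 (M0 k))).
  apply: filterS => n; rewrite sub0r normrN ger0_norm ?normc_ge0// => hn.
  by apply/eqP => Mn0; move: hn; rewrite Mn0 sub0r normcNE ltxx.
near=> n.
have notS (u : nat -> X) : u n != a -> u n != b -> u n != c -> u n != d -> u n \notin S.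
  by move=> h1 h2 h3 h4; rewrite !inE (negbTE h1) (negbTE h2) (negbTE h3) (negbTE h4).
have := disj (ua n) (ub n) (uc n) (ud n).
rewrite /cross_ratio -/(Nn i n) -/(Nn j n) -/(Mn i n) -/(Mn j n).
have Mi0 : Mn i n != 0 by near: n; exact: Mnz.
have Mj0 : Mn j n != 0 by near: n; exact: Mnz.
move=> /(_ _ _ _ _)/eqP; rewrite eqr_div// => heq; apply/esym/eqP/heq.
- by apply: notS; near: n; exact: na.
- by apply: notS; near: n; exact: nb.
- by apply: notS; near: n; exact: nc.
- by apply: notS; near: n; exact: nd.
Unshelve. all: by end_near.
Qed.

End cross_ratios.

(** * From box relations to equality of cross ratios *)

Section independence.
Context {R : realType} {I : finType} {X : topologicalType}.
Local Notation C := R[i].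
Local Notation normc := Normc.normc.
Local Notation rc := (real_complex R).
Context (h : I -> X -> R[i]^o) (D : set (I -> C * C)).
Hypothesis hD : deck_system h D.

(* The box spanned by the arcs (o, u n) and (p b, w), which lie on the same side of
   {o, w}, has Liouville measure - ln (1 - r i). *)
Definition box_relation (c : I -> R) := forall o w, o != w ->
  exists p : bool -> X, (forall b, p b != o /\ p b != w) /\
  forall u : nat -> X, (forall n, u n != o /\ u n != w) -> u n @[n --> \oo] --> o ->
  exists b, forall m, exists n, (m <= n)%N /\ exists r : I -> R,
    (forall i, 0 < r i < 1 /\ fpc h i o w (u n) = rc (r i) * fpc h i o w (p b)) /\
    \sum_i c i * ln (1 - r i) = 0.

Lemma cvg_sumr (s : seq I) (f : I -> nat -> R) (l : I -> R) :
  (forall i, f i n @[n --> \oo] --> l i) ->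
  \sum_(i <- s) f i n @[n --> \oo] --> \sum_(i <- s) l i.
Proof.
move=> fl; elim: s => [|i s IH].
  have -> : (fun n => \sum_(i <- [::]) f i n) = (fun=> 0).
    by apply/funext => n; rewrite big_nil.
  by rewrite big_nil; exact: cvg_cst.
have -> : (fun n => \sum_(j <- i :: s) f j n) = (fun n => f i n + \sum_(j <- s) f j n).
  by apply/funext => n; rewrite big_cons.
by rewrite big_cons; exact: cvgD.
Qed.

(** With [x = q ^+ n * r], squeezed by [- x / (1 - x) <= ln (1 - x) <= - x]. *)
Lemma ln_asymptotics (q Q r : R) : 0 < q <= Q -> Q < 1 -> 0 < r ->
  ln (1 - q ^+ n * r) / Q ^+ n @[n --> \oo] --> (if q == Q then - r else 0).
Proof.
move=> /andP[q0 qQ] Q1 r0; have Q0 : 0 < Q := lt_le_trans q0 qQ.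
have cqr : q ^+ n * r @[n --> \oo] --> (0 : R).
  rewrite -[X in _ --> X](mul0r r); apply: cvgM; last exact: cvg_cst.
  by apply: cvg_expr; rewrite ger0_norm ?ltW// (le_lt_trans qQ).
have cq : (q / Q) ^+ n * r @[n --> \oo] --> (if q == Q then r else 0).
  have [->|qQ'] := eqVneq q Q.
    rewrite divff ?gt_eqF//; under eq_fun do rewrite expr1n mul1r.
    exact: cvg_cst.
  rewrite -[X in _ --> X](mul0r r); apply: cvgM; last exact: cvg_cst.
  apply: cvg_expr; rewrite ger0_norm ?divr_ge0 ?ltW//.
  by rewrite ltr_pdivrMr// mul1r lt_neqAle qQ' qQ.
have -> : (if q == Q then - r else 0) = - (if q == Q then r else 0).
  by case: ifP; rewrite ?oppr0.
apply: (@squeeze_cvgr _ _ _ _ (fun n => - ((q / Q) ^+ n * r / (1 - q ^+ n * r)))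
  (fun n => - ((q / Q) ^+ n * r))).
- have := cqr => /cvgrPdist_lt/(_ 1 ltr01); apply: filterS => n.
  set x := q ^+ n * r; have x0 : 0 < x by rewrite mulr_gt0// exprn_gt0.
  rewrite sub0r normrN gtr0_norm// => x1.
  have Qn : 0 < Q ^+ n by rewrite exprn_gt0.
  have -> : (q / Q) ^+ n * r = x / Q ^+ n.
    by rewrite /x expr_div_n mulrAC.
  apply/andP; split.
    rewrite mulrAC -mulNr ler_pM2r ?invr_gt0//.
    have := @le_ln1Dx R (x / (1 - x)).
    have -> : 1 + x / (1 - x) = (1 - x)^-1 by field; rewrite gt_eqF// subr_gt0.
    rewrite lnV ?posrE ?subr_gt0// lerNl; apply.
    rewrite (lt_le_trans (ltrN10 R))//; apply: divr_ge0; first exact: ltW.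
    by rewrite subr_ge0 ltW.
  rewrite -[leRHS]mulNr ler_pM2r ?invr_gt0//.
  by apply: le_ln1Dx; rewrite ltrN2.
- apply: cvgN; rewrite -[X in _ --> X]divr1; apply: cvgM => //.
  apply: cvgV; first by rewrite oner_eq0.
  rewrite -[X in _ --> X]subr0; apply: cvgB => //; exact: cvg_cst.
- exact: cvgN.
Qed.

Lemma linear_relation (c : I -> R) t o w q (i0 : I) (p : bool -> X) y :
  loxodromic h t o w q -> (forall b, p b != o /\ p b != w) ->
  (forall u : nat -> X, (forall n, u n != o /\ u n != w) -> u n @[n --> \oo] --> o ->
   exists b, forall m, exists n, (m <= n)%N /\ exists r : I -> R,
    (forall i, 0 < r i < 1 /\ fpc h i o w (u n) = rc (r i) * fpc h i o w (p b)) /\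
    \sum_i c i * ln (1 - r i) = 0) ->
  (forall i, c i != 0 -> q i <= q i0) ->
  y != o -> y != w ->
  exists b, \sum_(i | (c i != 0) && (q i == q i0))
    rc (c i) * (fpc h i o w y / fpc h i o w (p b)) = 0.
Proof.
move=> L hp hu hmax yo yw; have [ow to tw hq] := L.
have itw n : iter n t y != o /\ iter n t y != w.
  elim: n => [//|n [IHo IHw]].
  by split; [exact: (lox_neqo hD i0 L)|exact: (lox_neq hD i0 L)].
have [b hb] := hu (fun n => iter n t y) itw (lox_cvg hD i0 L yw).
exists b; have [pbo pbw] := hp b.
have F0 i : fpc h i o w (p b) != 0 by rewrite (fpc_eq0 hD).
have q0 i : 0 < q i by have [/andP[]] := hq i.
(* The ratio at y itself, recovered from the one at some [t^n y]. It is positive but may exceed 1,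
   since y need not be near o. *)
have /choice[r hr] : forall i, exists r : R, 0 < r /\
    fpc h i o w y = rc r * fpc h i o w (p b).
  move=> i; have [n [_ [r [hr _]]]] := hb 0%N.
  have [/andP[r0 r1] hri] := hr i.
  exists (r i / q i ^+ n); split; first by rewrite divr_gt0// exprn_gt0.
  have [_ hit] := lox_iter hD i n L yw; move: hri; rewrite hit => hri.
  have qn0 : rc (q i ^+ n) != 0.
    by rewrite -(rmorph0 rc) (inj_eq (@complexI R)) gt_eqF// exprn_gt0.
  move: hri; move: (fpc h i o w y) (fpc h i o w (p b)) => u v hri.
  apply: (mulfI qn0); rewrite hri mulrA -(rmorphM rc) mulrCA mulfV ?mulr1//.
  by rewrite gt_eqF// exprn_gt0.
have hzero m : exists n, (m <= n)%N /\ \sum_i c i * ln (1 - q i ^+ n * r i) = 0.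
  have [n [mn [s [hs hsum]]]] := hb m; exists n; split=> //.
  rewrite -[RHS]hsum; apply: eq_bigr => i _; congr (_ * ln (1 - _)).
  have [_ hsi] := hs i; have [_ hit] := lox_iter hD i n L yw.
  move: hsi; rewrite hit; have [_ ->] := hr i.
  by rewrite mulrA => /(mulIf (F0 i)); rewrite -(rmorphM rc) => /complexI.
have cv : \sum_i c i * (ln (1 - q i ^+ n * r i) / q i0 ^+ n) @[n --> \oo] -->
    \sum_i c i * (if q i == q i0 then - r i else 0).
  apply: cvg_sumr => i; have [->|ci] := eqVneq (c i) 0.
    by rewrite mul0r; under eq_fun do rewrite mul0r; exact: cvg_cst.
  apply: cvgM; first exact: cvg_cst.
  have [ri0 _] := hr i; have [/andP[_ q1] _] := hq i0.
  by apply: ln_asymptotics => //; rewrite q0 hmax.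
(* The sequence in [cv] vanishes for arbitrarily large n, so its limit is 0. *)
have lim0 : \sum_i c i * (if q i == q i0 then - r i else 0) = 0.
  apply/eqP; rewrite -normr_eq0 -[_ == 0]negbK -normr_gt0 normr_id; apply/negP => d0.
  move/cvgrPdist_lt : cv => /(_ _ d0)[N _ hN].
  have [n [Nn hn]] := hzero N; have := hN n Nn => /=.
  under [X in _ - X]eq_bigr do rewrite mulrA.
  by rewrite -mulr_suml hn mul0r subr0 ltxx.
rewrite (_ : \sum_(i | _) _ = rc (- \sum_i c i * (if q i == q i0 then - r i else 0))).
  by rewrite lim0 oppr0 rmorph0.
rewrite rmorphN rmorph_sum /= -sumrN [RHS](bigID (fun i => (c i != 0) && (q i == q i0))) /=.
rewrite [X in _ = _ + X]big1 ?addr0; last first.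
  by move=> i; rewrite negb_and negbK => /orP[/eqP->|/negbTE->];
    rewrite ?mul0r ?mulr0 oppr0.
apply: eq_bigr => i /andP[_ ->]; have [_ ->] := hr i.
by rewrite mulfK// mulrN rmorphN opprK rmorphM.
Qed.

(** The coordinate along the orbit is [q i0 ^+ n] times a nonzero constant, so the orbit meets x at
    most once. *)
Lemma eventually_avoid t o w q (i0 : I) y x : loxodromic h t o w q ->
  y != o -> y != w -> exists M, forall n, (M <= n)%N -> iter n t y != x.
Proof.
move=> L yo yw; have [[n0 hn0]|hn] := pselect (exists n, iter n t y = x); last first.
  by exists 0%N => n _; apply/eqP => hx; apply: hn; exists n.
exists n0.+1 => n n0n; apply/eqP => hx.
have [_ h1] := lox_iter hD i0 n0 L yw; have [_ h2] := lox_iter hD i0 n L yw.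
have [ow to tw /(_ i0)[/andP[q0 q1] _]] := L.
move: h1 h2; rewrite hn0 hx => -> /mulIf; rewrite (fpc_eq0 hD)// => /(_ yo)/complexI.
move/eqP; rewrite eq_le => /andP[+ _].
by rewrite leNgt ltr_iXn2l// n0n.
Qed.

Lemma deck_independence (c : I -> R) (i0 : I) : box_relation c -> c i0 != 0 ->
  exists i j, i != j /\ forall a b x y, a != y -> b != x ->
    cross_ratio h i a b x y = cross_ratio h j a b x y.
Proof.
move=> hbox ci0.
have [t [ o [w [q [B [s [L [DB hs] so sw]]]]]]] := lox_generic hD i0.
have [ow to tw hq] := L; have [p [hp hu]] := hbox o w ow.
have [i1 ci1 hmax] : exists2 i1, c i1 != 0 & forall i, c i != 0 -> q i <= q i1.
  by case: (@arg_maxP _ _ _ i0 (fun i => c i != 0) q ci0) => i1; exists i1.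
have Bs : realizes h D B s by [].
have [s' [_ sK s'K]] := realizes_inv hD Bs i0.
(* The point n is the pole of s in every coordinate; by the choice of s it is neither the zero o nor
   the pole w of the coordinates. *)
pose n := s' w; have sn : s n = w by rewrite /n s'K.
have no : n != o by apply: contra_neq so => <-.
have nw : n != w by apply: contra_neq sw => nw; rewrite -[in LHS]nw.
pose J := [pred i | (c i != 0) && (q i == q i1)].
have i1J : i1 \in J by rewrite inE ci1 eqxx.
have sB i := deck_su hD DB i.
have F0 i x : x != o -> x != w -> fpc h i o w x != 0.
  by move=> xo xw; rewrite (fpc_eq0 hD).
have q0 i : 0 < q i by have [/andP[]] := hq i.
have qlt1 i : q i < 1 by have [/andP[]] := hq i.
have rcX0 (x : R) : x != 0 -> rc x != 0.
  by move=> x0; rewrite -(rmorph0 rc) (inj_eq (@complexI R)).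
have pair y : y != o -> y != w -> exists i j, [/\ i != j &
    fpc h i o w y / fpc h i o w n = fpc h j o w y / fpc h j o w n].
  move=> yo yw.
  (* Discarding finitely many iterates keeps [s (x k)] away from o and w, as [linear_relation]
     requires. *)
  have [M1 hM1] := eventually_avoid i0 n L yo yw.
  have [M2 hM2] := eventually_avoid i0 (s' o) L yo yw.
  pose M := maxn M1 M2; pose x k := iter k t y.
  have xn k : (M <= k)%N -> x k != n.
    by move=> Mk; apply: hM1; rewrite (leq_trans _ Mk)// leq_maxl.
  have sxo k : (M <= k)%N -> s (x k) != o.
    move=> Mk; have := hM2 k (leq_trans (leq_maxr _ _) Mk).
    by apply: contra_neq => so'; rewrite -so' sK.
  have sxw k : (M <= k)%N -> s (x k) != w.
    by move=> Mk; have := xn k Mk; apply: contra_neq => sw'; rewrite /n -sw' sK.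
  have rel k : (M <= k)%N -> exists b, \sum_(i in J)
      rc (c i) * (fpc h i o w (s (x k)) / fpc h i o w (p b)) = 0.
    move=> Mk; apply: (linear_relation L hp hu hmax); [exact: sxo|exact: sxw].
  (* The side b depends on k; one of its two values occurs for arbitrarily large k. *)
  have [b hb] : exists b, forall m, exists k, [/\ (m <= k)%N, (M <= k)%N &
      \sum_(i in J) rc (c i) * (fpc h i o w (s (x k)) / fpc h i o w (p b)) = 0].
    apply: contrapT => hne.
    have hb b : exists m, forall k, (m <= k)%N -> (M <= k)%N ->
        \sum_(i in J) rc (c i) * (fpc h i o w (s (x k)) / fpc h i o w (p b)) <> 0.
      apply: contrapT => hm; apply: hne; exists b => m; apply: contrapT => hk.
      apply: hm; exists m => k mk Mk h0; apply: hk; exists k; split=> //.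
    have [m1 h1] := hb true; have [m2 h2] := hb false.
    pose k := maxn M (maxn m1 m2).
    have Mk : (M <= k)%N by rewrite leq_maxl.
    have m1k : (m1 <= k)%N by rewrite (leq_trans _ (leq_maxr _ _))// leq_maxl.
    have m2k : (m2 <= k)%N by rewrite (leq_trans _ (leq_maxr _ _))// leq_maxr.
    have [[] hk] := rel k Mk; [exact: (h1 k m1k Mk)|exact: (h2 k m2k Mk)].
  have [pbo pbw] := hp b.
  pose K i := su_den (B i) (h i n) ^+ 2 * (h i o - h i w) ^+ 2 / (h i o - h i n) ^+ 2.
  have K0 i : K i != 0.
    have d0 := su_den_circle (sB i) (deck_circle hD i n).
    have on : o != n by rewrite eq_sym.
    by rewrite /K !mulf_neq0 ?invr_eq0 ?expf_neq0 ?subr_eq0 ?(h_neq hD).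
  have Fs i k : (M <= k)%N -> fpc h i o w (s (x k)) = fpc h i o w (s o) +
      K i * (rc (q i ^+ k) * fpc h i o w y /
             (1 - rc (q i ^+ k) * fpc h i o w y / fpc h i o w n)).
    move=> Mk; have [xkw hx] := lox_iter hD i k L yw.
    have := @fpcoord_pole _ (B i) (h i o) (h i w) (h i n) (h i (x k)) (sB i).
    rewrite !(deck_circle hD) -!hs sn !(h_neq hD)// ?xn//.
    move=> /(_ erefl erefl erefl erefl isT isT isT erefl isT isT).
    by rewrite -/(fpc h i o w _) => E; rewrite -/(fpc h i o w (s (x k))) in E *;
      rewrite E -/(fpc h i o w _) -/(fpc h i o w n) -/(fpc h i o w (x k)) hx.
  pose S i := fpc h i o w y / fpc h i o w n.
  have hXS i k : (M <= k)%N -> 1 - S i * rc (q i ^+ k) != 0.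
    move=> Mk; have [xkw hx] := lox_iter hD i k L yw.
    have Fxn : fpc h i o w (x k) != fpc h i o w n.
      by have := xn k Mk; apply: contra_neq => /(fpc_inj hD ow xkw nw).
    rewrite subr_eq0; apply: contra_neq Fxn => /(congr1 ( *%R^~ (fpc h i o w n))).
    by rewrite mul1r /S mulrAC divfK ?F0// hx mulrC.
  have [||||i [j [iJ jJ ij sij]]] := @rational_poles C I J
    (fun i => rc (c i) * fpc h i o w (s o) / fpc h i o w (p b))
    (fun i => rc (c i) * K i * fpc h i o w y / fpc h i o w (p b))
    S (fun k => rc (q i1 ^+ k)) i1 i1J.
  - move=> i; rewrite inE => /andP[ci _].
    apply: mulf_neq0; last by rewrite invr_eq0 F0.
    apply: mulf_neq0; last exact: F0.
    by apply: mulf_neq0; [exact: rcX0|exact: K0].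
  - by move=> i _; apply: mulf_neq0; rewrite ?invr_eq0 F0.
  - move=> k l /complexI; apply: ieexprIn; first exact: q0.
    by rewrite lt_eqF.
  - move=> m; have [k [mk Mk hk]] := hb m; exists k; split=> //.
      by move=> i; rewrite inE => /andP[_ /eqP <-]; exact: hXS.
    rewrite -[RHS]hk; apply: eq_bigr => i; rewrite inE => /andP[_ /eqP <-].
    rewrite Fs//.
    have -> : rc (q i ^+ k) * fpc h i o w y / fpc h i o w n = S i * rc (q i ^+ k).
      rewrite /S; move: (fpc h i o w y) (fpc h i o w n)^-1 (rc _) => u v r.
      by ring.
    move: (rc (q i ^+ k)) (1 - _) (fpc h i o w (p b)) (fpc h i o w y) (K i) (rc (c i)) => u v z y' K' c'.
    by move: (v^-1) (z^-1) => v' z'; ring.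
  by exists i, j.
have cont (i : I) (z : X) : continuous (fun y => normc (h i y - h i z)).
  move=> y; apply: (@cvg_comp _ _ _ (fun y => h i y - h i z) (@Normc.normc R) _ _ _ _
    (@normc_continuous R _)).
  by apply: cvgC_subr; exact: (deck_cont hD).
have closed_pt z : closed [set x : X | x = z].
  have -> : [set x : X | x = z] = [set y | normc (h i0 y - h i0 z) <= 0].
    apply/seteqP; split=> x /=; first by move=> ->; rewrite subrr Normc.normc0.
    move=> hx; apply: (deck_inj hD (i := i0)); apply/eqP; rewrite -subr_eq0.
    by apply: contraT => /normc_gt0; rewrite ltNge hx.
  exact: (@preimage_closed _ _ _ [set y : R | y <= 0] (fun x _ => cont i0 z x) (@closed_le _ 0)).
pose V : set X := ~` [set x | x = o] `&` ~` [set x | x = w] `&` ~` [set x | x = n].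
have oV : open V by do ?apply: openI; exact: closed_openC.
have V0 : V !=set0.
  have [u _ hu'] := approach_point hD i0 o.
  have [k [[h1 h2] h3]] := @filter_ex _ _ _ _ (filterI (filterI (hu' o) (hu' w)) (hu' n)).
  by exists (u k); split; [split|] => /= /eqP; apply/negP.
(* The equation of [pair] with its denominators cleared, hence continuous on all of X. *)
pose G i j y : R[i]^o := ((h i y - h i o) * (h j y - h j w)) * fpc h j o w n -
  ((h j y - h j o) * (h i y - h i w)) * fpc h i o w n.
have cG i j : continuous (G i j).
  have cs (k : I) (z : X) : continuous (fun y => (h k y - h k z : R[i]^o)).
    by move=> y; apply: cvgC_subr; exact: (deck_cont hD).
  move=> y; apply: cvgC_sub; apply: cvgC_mul; try exact: cvg_cst.
    by apply: cvgC_mul; exact: cs.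
  by apply: cvgC_mul; exact: cs.
(* The diagonal receives the empty set, so that the pair found for an open set has distinct
   indices. *)
pose E (k : I * I) := if k.1 == k.2 then set0 else [set y | normc (G k.1 k.2 y) <= 0].
have GE i j y : y != o -> y != w -> G i j y = 0 <->
    fpc h i o w y / fpc h i o w n = fpc h j o w y / fpc h j o w n.
  move=> yo yw; have Fi := F0 i n no nw; have Fj := F0 j n no nw.
  have Hi : h i y - h i w != 0 by rewrite subr_eq0 (h_neq hD).
  have Hj : h j y - h j w != 0 by rewrite subr_eq0 (h_neq hD).
  have GF : G i j y = (fpc h i o w y / fpc h i o w n - fpc h j o w y / fpc h j o w n) *
      ((h i y - h i w) * (h j y - h j w) * (fpc h i o w n * fpc h j o w n)).
    rewrite /G; move: (fpc h i o w n) (fpc h j o w n) Fi Fj => u v u0 v0.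
    rewrite /fpc /fpcoord; move: (h i y - h i w) (h j y - h j w) Hi Hj => a b a0 b0.
    by field; rewrite a0 b0 u0 v0.
  rewrite GF; split=> [/eqP|->]; last by rewrite subrr mul0r.
  rewrite mulf_eq0 subr_eq0 => /orP[/eqP//|].
  by rewrite !(mulf_eq0 _ (_ * _)) mulf_eq0 (negbTE Hi) (negbTE Hj) (negbTE Fi) (negbTE Fj).
have [k [U [kl oU U0 UV UE]]] := @finite_closed_cover X _ (enum {: I * I}) V E oV V0
  (fun k => ltac:(rewrite /E; case: ifP => _; [exact: closed0|
    exact: (@preimage_closed _ _ _ [set y : R | y <= 0]
      (fun x _ => cvg_comp _ _ (cG k.1 k.2 x) (@normc_continuous R _)) (@closed_le _ 0))]))
  (fun y Vy => ltac:(
    move: Vy => [[/eqP yo /eqP yw] /eqP yn]; have [i [j [ij hij]]] := pair y yo yw;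
    exists (i, j); [by rewrite mem_enum|
    rewrite /E /= (negbTE ij) /=; move/(GE i j y yo yw) : hij => ->; rewrite Normc.normc0 //])).
have [z Uz] := U0; have := UE z Uz; rewrite /E; case: eqP => // /eqP kk _.
exists k.1, k.2; split=> //.
apply: (cross_ratio_spread hD oU U0) => a b c' d Ua Ub Uc Ud.
(* On U the coordinates of the two structures are proportional, and a cross ratio does not see the
   factor. *)
have lin y : U y -> fpc h k.2 o w y =
    fpc h k.2 o w n / fpc h k.1 o w n * fpc h k.1 o w y /\ y != w.
  move=> Uy; have [[/eqP yo /eqP yw] /eqP yn] := UV y Uy; split=> //.
  have := UE y Uy; rewrite /E (negbTE kk) /= => hG.
  have /(GE _ _ _ yo yw) G0 : G k.1 k.2 y = 0.
    by apply/eqP; apply: contraT => /normc_gt0; rewrite ltNge hG.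
  rewrite -[LHS](divfK (F0 k.2 n no nw)) -G0.
  move: (fpc h k.1 o w y) (fpc h k.1 o w n)^-1 (fpc h k.2 o w n) => u v r.
  by ring.
have [la aw] := lin a Ua; have [lb bw] := lin b Ub.
have [lc cw] := lin c' Uc; have [ld dw] := lin d Ud.
rewrite (cross_ratio_fpc hD k.1 ow)// (cross_ratio_fpc hD k.2 ow)// la lb lc ld.
have K0 : fpc h k.2 o w n / fpc h k.1 o w n != 0.
  by apply: mulf_neq0; rewrite ?invr_eq0 F0.
move: (fpc h k.2 o w n / _) K0 => K' K0.
rewrite -!mulrBr [X in _ = X / _]mulrACA [X in _ = _ / X]mulrACA -[RHS]mulf_div.
by rewrite divff ?mul1r// mulf_neq0.
Qed.

End independence.

(** * Lifting of paths through a covering *)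

Section path_lifting.
Context {R : realType}.

(** The times of [[0, 1]] where P holds form a subset both open and closed in that interval, which
    is connected. *)
Lemma interval_locally_constant (P : R -> Prop) : P 0 ->
  (forall t : R, 0 <= t <= 1 -> \forall s \near t, 0 <= s <= 1 -> (P s <-> P t)) ->
  forall t : R, 0 <= t <= 1 -> P t.
Proof.
move=> P0 hP; have cI : connected (`[0, 1]%classic : set R) by exact: segment_connected.
have := cI [set t | 0 <= t <= 1 /\ P t] => h.
have {}h : [set t | 0 <= t <= 1 /\ P t] = `[0, 1]%classic.
  apply: h.
  - by exists 0; rewrite /= lexx ler01.
  - exists (interior [set t : R | 0 <= t <= 1 -> P t]); first exact: open_interior.
    apply/seteqP; split=> t /=; rewrite in_itv /=.
      move=> [t01 Pt]; split=> //.
      by apply: filterS (hP t t01) => s hs s01; apply/hs.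
    by move=> [t01 /nbhs_singleton]; split=> //; auto.
  - exists (~` interior [set t : R | 0 <= t <= 1 -> ~ P t]).
      exact/open_closedC/open_interior.
    apply/seteqP; split=> t /=; rewrite in_itv /=.
      by move=> [t01 Pt]; split=> // /nbhs_singleton /(_ t01).
    move=> [t01 ht]; split=> //; apply: contrapT => nPt; apply: ht.
    by apply: filterS (hP t t01) => s hs s01 /(hs s01).
move=> t t01.
have : [set t | 0 <= t <= 1 /\ P t] t by rewrite h /= in_itv.
by case.
Qed.

Context {St S : topologicalType} (p : St -> S).
Hypothesis cov : covering p.

Lemma covering_open (O : set St) : open O -> open (p @` O).
Proof.
have [cp _ ev] := cov; move=> oO; rewrite openE => _ [x Ox <-].
have [U [oU Ux] [V [_ hV hW]]] := ev (p x).
have : (p @^-1` U) x by [].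
rewrite -hV => -[W VW Wx]; have [[oW _ _ hop] pW] := hW W VW.
have oWO : open (p @` (W `&` O)).
  by apply: hop; [exact: openI|exact: subIsetl].
apply: (@filterS _ _ _ (p @` (W `&` O))).
  by apply: image_subset; exact: subIsetr.
by apply: open_nbhs_nbhs; split=> //; exists x.
Qed.

Lemma local_section (y : S) : exists2 U, open_nbhs y U &
  forall x, U (p x) -> exists s : S -> St, [/\ s (p x) = x,
    forall z, U z -> p (s z) = z & forall z, U z -> {for z, continuous s}].
Proof.
have [cp _ ev] := cov.
have [U [oU Uy] [V [_ hV hW]]] := ev y; exists U => // x Ux.
have : (p @^-1` U) x by [].
rewrite -hV => -[W VW Wx]; have [[oW injW _ hop] pW] := hW W VW.
(* Outside U the value of the section is arbitrary. *)
have /choice[s hs] : forall z, exists w, U z -> W w /\ p w = z.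
  move=> z; have [Uz|] := pselect (U z); last by exists x.
  by move: (Uz); rewrite -pW => -[w Ww <-]; exists w.
exists s; split.
- have [Ws ps] := hs _ Ux.
  by apply: injW ps; apply/mem_set.
- by move=> z /hs[].
move=> z Uz N /nbhs_interior Nsz; have [Wsz psz] := hs z Uz.
apply: (@filterS _ _ _ (p @` (W `&` interior N))).
  move=> _ [w [Ww Nw] <-]; rewrite /=.
  have Upw : U (p w) by rewrite -pW; exists w.
  have [Ws ps] := hs _ Upw.
  have -> : s (p w) = w by apply: injW ps; apply/mem_set.
  exact: interior_subset.
apply: open_nbhs_nbhs; split.
  by apply: hop; [apply: openI => //; exact: open_interior|exact: subIsetl].
by exists (s z) => //; split=> //; exact: nbhs_singleton.
Qed.

Lemma path_lift (a : R -> S) (x : St) : continuous a -> p x = a 0 ->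
  exists c : R -> St, [/\ continuous c, c 0 = x &
    forall t, 0 <= t <= 1 -> p (c t) = a t].
Proof.
move=> ca xa.
pose P t := exists c : R -> St, [/\ continuous c, c 0 = x &
    forall s, 0 <= s <= t -> p (c s) = a s].
suff : P 1 by [].
apply: interval_locally_constant; last by rewrite ler01 lexx.
  exists (cst x); split=> // [|s s0]; first by move=> ?; exact: cvg_cst.
  by have -> : s = 0 by apply/eqP; rewrite eq_le andbC.
move=> t t01; have [U [oU Uat] hU] := local_section (a t).
have /nbhs_ballP[e /= e0 he] : nbhs t (a @^-1` U).
  by apply: ca; exact: open_nbhs_nbhs.
(* A lift up to s1 yields one up to s2 whenever both times lie in a ball that a maps into U;
   exchanging s1 and s2 gives the equivalence near t. *)
suff key s1 s2 : ball t e s1 -> ball t e s2 -> 0 <= s1 -> P s1 -> P s2.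
  exists e => //= s hs s01; split; apply: key => //.
  - exact: ballxx.
  - by move/andP: s01 => [].
  - exact: ballxx.
  - by move/andP: t01 => [].
move=> b1 b2 s10 [c [cc c0 hc]].
have [s21|s12] := leP s2 s1.
  exists c; split=> // s /andP[s0 ss2]; apply: hc.
  by rewrite s0 (le_trans ss2).
have Uc : U (p (c s1)) by rewrite hc ?s10 ?lexx//; exact: he.
have [g [gc pg cg]] := hU _ Uc.
(* Clamping the time to [[s1, s2]] keeps the values of a inside U, where the section g is
   continuous. *)
pose k u := Num.max s1 (Num.min u s2).
have ck : continuous k.
  move=> u; apply: (@continuous_max _ _ (fun=> s1) (fun u : R => Num.min u s2)).
    exact: cvg_cst.
  by apply: (@continuous_min _ _ id (fun=> s2)); [exact: cvg_id|exact: cvg_cst].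
have Uk u : U (a (k u)).
  have /andP[k1 k2] : s1 <= k u <= s2.
    by rewrite /k le_max lexx ge_max (ltW s12) ge_min lexx orbT.
  by apply: he; move: b1 b2; rewrite /ball /= !ltr_distl; lra.
exists (fun u => if u <= s1 then c u else g (a (k u))); split.
- apply: (@continuous_paste _ _ _ id s1 c (g \o a \o k)) => //.
  + by move=> ?; exact: cvg_id.
  + move=> u; apply: continuous_comp; first exact: ck.
    by apply: continuous_comp; [exact: ca|exact: cg].
  + move=> u ->; rewrite /= /k min_l ?ltW// max_r// -hc ?s10 ?lexx//.
- by rewrite s10.
- move=> s /andP[s0 ss2]; case: leP => ss1; first by rewrite hc// s0.
  by rewrite pg// /k min_l// max_r// ltW.
Qed.

End path_lifting.

Lemma su_act_le1 (R : realType) (A : R[i] * R[i]) z : su11 A ->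
  Normc.normc z <= 1 -> Normc.normc (su_act A z) <= 1.
Proof.
move=> sA z1; have d0 := su_den_neq0 sA z1.
have := su_act_norm sA d0.
have : 0 <= (1 - Normc.normc z ^+ 2) / Normc.normc (su_den A z) ^+ 2.
  by rewrite divr_ge0 ?sqr_ge0// subr_ge0 expr_le1// normc_ge0.
move=> + h; rewrite -h subr_ge0 => h2.
by rewrite -(@expr_le1 _ 2)// normc_ge0.
Qed.

(** * Germs of deck transformations and consequences of compactness *)

Section germs.
Context {R : realType} {I : finType} {St S : topologicalType} (p : St -> S).
Local Notation C := R[i].
Local Notation normc := Normc.normc.
Local Notation rc := (real_complex R).
Context (phi : I -> St -> R[i]^o).
Implicit Types (A B : C * C).

(** [dev_local] is the equivariance of the developing maps in local form: near two points of one
    fibre they differ by an isometry of the disc. *)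
Record developing : Prop := Developing {
  dev_covering : covering p;
  dev_connected : path_connected R St;
  dev_compact : compact [set: S];
  dev_embedding : forall i, open_embedding setT (phi i);
  dev_range : forall i, range (phi i) = unit_disc R;
  dev_local : forall i (y y' : St), p y = p y' -> exists A, su11 A /\
    \forall z \near y & z' \near y', p z = p z' -> phi i z' = su_act A (phi i z) }.

Hypothesis dev : developing.

(** A is the matrix of the deck transformation taking y to y', which is present only through its
    effect near these points, read off by p. No map of St is constructed; germs are moved along
    lifted paths. *)
Definition germ i A (y y' : St) :=
  \forall z \near y & z' \near y', p z = p z' -> phi i z' = su_act A (phi i z).

Lemma germE i A y y' : p y = p y' -> germ i A y y' -> phi i y' = su_act A (phi i y).
Proof. move=> pyy' [[N N'] /= [/nbhs_singleton Ny /nbhs_singleton N'y] h].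
exact: (h (y, y')). Qed.

Lemma germ_near i A y y' : germ i A y y' ->
  exists N N', [/\ open_nbhs y N, open_nbhs y' N' &
    forall z z', N z -> N' z' -> germ i A z z'].
Proof.
move=> [[N N'] /= [+ +] hNN'].
rewrite !nbhsE => -[G [Go Gy] GN] [G' [G'o G'y] G'N].
exists G, G'; split=> // z z' Gz G'z'.
exists (G, G') => /=; first by split; apply: open_nbhs_nbhs.
by move=> [u u'] [/= /GN ? /G'N ?]; exact: (hNN' (u, u')).
Qed.

Lemma phi_disc i y : normc (phi i y) < 1.
Proof.
have : unit_disc R (phi i y) by rewrite -(dev_range dev i); exists y.
by rewrite /unit_disc /= normE -[1](rmorph1 rc) ltcR.
Qed.

Lemma open_normc (O : set R[i]^o) (w : C) : open O -> O w ->
  exists2 e : R, 0 < e & forall u : C, normc (u - w) < e -> O u.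
Proof.
move=> oO Ow.
have /nbhs_ballP[[e e'] /=] : nbhs (w : R[i]^o) O by apply: open_nbhs_nbhs.
rewrite ltcE /= => /andP[/eqP -> e0] he; exists e => // u hu; apply: he.
by rewrite /ball /= normE ltcR normcB.
Qed.

(** [M = B^-1 A] fixes an open set pointwise. By [su_actB] the denominators of M at two distinct
    fixed points have product 1, so those at three fixed points are equal; this kills the second
    coefficient and leaves the identity. *)
Lemma su_act_eq_open A B (O : set R[i]^o) (w : C) : su11 A -> su11 B ->
  open O -> O w -> O `<=` unit_disc R ->
  (forall u, O u -> su_act A u = su_act B u) ->
  forall z, normc z <= 1 -> su_act A z = su_act B z.
Proof.
move=> sA sB oO Ow Od hAB z z1.
have [e e0 he] := open_normc oO Ow.
pose M := su_mul (su_inv B) A.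
have sM : su11 M by apply: su11_mul => //; exact: su11_inv.
have d1 u : O u -> normc u <= 1.
  by move=> /Od; rewrite /unit_disc /= normE -[1](rmorph1 rc) ltcR => /ltW.
have ME u : normc u <= 1 -> su_act M u = su_act (su_inv B) (su_act A u).
  by move=> u1; rewrite su_act_mul// su_den_neq0.
have fixM u : O u -> su_act M u = u.
  by move=> Ou; rewrite ME ?d1// hAB// su_actK// d1.
have denM u v : O u -> O v -> u != v -> su_den M u * su_den M v = 1.
  move=> Ou Ov uv.
  have dd : su_den M u * su_den M v != 0 by rewrite mulf_neq0// su_den_neq0// d1.
  have := su_actB sM (su_den_neq0 sM (d1 u Ou)) (su_den_neq0 sM (d1 v Ov)).
  rewrite !fixM// => /(congr1 ( *%R^~ (su_den M u * su_den M v))).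
  have uv0 : u - v != 0 by rewrite subr_eq0.
  by rewrite divfK// -[RHS]mulr1 => /(mulfI uv0).
pose w1 := w + rc (e / 2); pose w2 := w + rc (e / 3).
have O1 : O w1 by apply: he; rewrite addrC addKr normc_real ger0_norm ?divr_ge0 ?ltW// ltr_pdivrMr//; lra.
have O2 : O w2 by apply: he; rewrite addrC addKr normc_real ger0_norm ?divr_ge0 ?ltW// ltr_pdivrMr//; lra.
have neq (a b : R) : a != b -> w + rc a != w + rc b.
  by move=> ab; rewrite (inj_eq (addrI w)) (inj_eq (@complexI R)).
have w01 : w != w1 by rewrite -[w]addr0 -(rmorph0 rc) neq// lt_eqF// divr_gt0.
have w02 : w != w2 by rewrite -[w]addr0 -(rmorph0 rc) neq// lt_eqF// divr_gt0.
have w12 : w1 != w2 by rewrite neq//; apply/eqP; lra.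
have d01 := denM _ _ Ow O1 w01; have d02 := denM _ _ Ow O2 w02.
have d12 := denM _ _ O1 O2 w12.
have d2 := su_den_neq0 sM (d1 _ O2).
have : su_den M w = su_den M w1 by apply: (mulIf d2); rewrite d02 d12.
rewrite /su_den => /addIr/eqP; rewrite -subr_eq0 -mulrBr mulf_eq0 subr_eq0 (negbTE w01) orbF.
rewrite conjC_eq0 => /eqP b0.
have dM u : su_den M u = M.1^* by rewrite /su_den b0 conjc0E mul0r add0r.
have fM : su_act M z = z.
  have a0 : M.1^* != 0 by rewrite -(dM w1) su_den_neq0// d1.
  have aa : M.1^* = M.1.
    move: d01; rewrite !dM => h; apply: (mulIf a0); rewrite h.
    by have := sM; rewrite /su11 b0 mul0r subr0 => ->.
  by rewrite su_actE dM b0 addr0 mulrAC aa divff ?mul1r// -aa.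
have Az1 : normc (su_act A z) <= 1 by exact: su_act_le1.
have := su_actK (su11_inv sB) Az1; rewrite su_invK -ME// fM.
by move=> ->.
Qed.

Lemma germ_unique i A B y y' : p y = p y' -> su11 A -> su11 B ->
  germ i A y y' -> germ i B y y' ->
  forall z, normc z <= 1 -> su_act A z = su_act B z.
Proof.
move=> pyy' sA sB gA gB; have [_ _ _ pho] := dev_embedding dev i.
have [[N N'] /= [+ +] hN] := filterI gA gB.
rewrite !nbhsE => -[G [Go Gy] GN] [G' [G'o G'y] G'N].
(* A point of W has a partner near y' over the same point of S, so both germs apply to it. *)
pose W := G `&` p @^-1` (p @` G').
have [cp _ _] := dev_covering dev.
have oW : open W.
  apply: openI => //; apply: open_comp; last exact: (covering_open (dev_covering dev)).
  by move=> ? _; exact: cp.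
have Wy : W y by split=> //; exists y'.
apply: (@su_act_eq_open A B (phi i @` W) (phi i y)) => //.
- exact: pho.
- by move=> _ [x _ <-]; rewrite -(dev_range dev i); exists x.
- move=> _ [x [Gx [x' G'x' px]] <-].
  have [/= h1 h2] := hN (x, x') (conj (GN _ Gx) (G'N _ G'x')).
  by rewrite -h1// -h2.
Qed.

(** A germ extends to nearby times. Conversely, [dev_local] provides some germ B at t, which extends
    too; if A is a germ at a nearby time, uniqueness identifies it there with B as a map, so A is a
    germ at t. *)
Lemma germ_transport i A (c c' : R -> St) : continuous c -> continuous c' ->
  (forall t, 0 <= t <= 1 -> p (c t) = p (c' t)) -> su11 A ->
  germ i A (c 0) (c' 0) -> forall t, 0 <= t <= 1 -> germ i A (c t) (c' t).
Proof.
move=> cc cc' cp sA g0; apply: interval_locally_constant => // t t01.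
have [B [sB gB]] := dev_local dev i (cp t t01).
have nearc D : germ i D (c t) (c' t) -> \forall s \near t, germ i D (c s) (c' s).
  move=> /germ_near[N [N' [oN oN' hN]]].
  have h1 : \forall s \near t, N (c s) by apply: cc; exact: open_nbhs_nbhs.
  have h2 : \forall s \near t, N' (c' s) by apply: cc'; exact: open_nbhs_nbhs.
  by near=> s; apply: hN; near: s.
have [gA|ngA] := pselect (germ i A (c t) (c' t)).
  have hA := nearc A gA.
  by near=> s => s01; split=> // _; near: s.
have hB := nearc B gB.
near=> s => s01; split=> // gA; exfalso; apply: ngA.
have gBs : germ i B (c s) (c' s) by near: s.
have AB := germ_unique (cp s s01) sA sB gA gBs.
apply: filterS gB => -[z z'] /= h pz; rewrite AB ?h//.
exact/ltW/phi_disc.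
Unshelve. all: by end_near.
Qed.

(** One family stands for one deck transformation seen in all structures; each of its matrices is
    determined up to sign. *)
Definition deck : set (I -> C * C) := [set A | exists y y',
  p y = p y' /\ forall i, su11 (A i) /\ germ i (A i) y y'].

Lemma deck_along (A : I -> C * C) (c : R -> St) y' : continuous c -> p (c 0) = p y' ->
  (forall i, su11 (A i) /\ germ i (A i) (c 0) y') ->
  exists c' : R -> St, [/\ continuous c', c' 0 = y',
    forall t, 0 <= t <= 1 -> p (c' t) = p (c t) &
    forall i t, 0 <= t <= 1 -> germ i (A i) (c t) (c' t)].
Proof.
move=> cc py' hA; have [cp _ _] := dev_covering dev.
have cpc : continuous (p \o c) by move=> t; apply: continuous_comp; [exact: cc|exact: cp].
have [c' [cc' c'0 hc']] := path_lift (dev_covering dev) cpc (esym py').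
exists c'; split=> // i; have [sA gA] := hA i.
by apply: germ_transport => //; [move=> t /hc' ->|rewrite c'0].
Qed.

(** Germs are carried along a path from y to x, so a deck transformation can be based at any
    point. *)
Lemma deck_move (A : I -> C * C) x : deck A -> exists x',
  p x = p x' /\ forall i, su11 (A i) /\ germ i (A i) x x'.
Proof.
move=> [y [y' [pyy' hA]]].
have [c [cc c0 c1]] := dev_connected dev y x.
have hA' i : su11 (A i) /\ germ i (A i) (c 0) y' by rewrite c0.
have [c' [cc' c'0 pc' gc']] := deck_along cc (etrans (congr1 p c0) pyy') hA'.
exists (c' 1); rewrite -c1 pc' ?ler01 ?lexx//; split=> // i.
by split; [have [] := hA i|apply: gc'; rewrite ler01 lexx].
Qed.

Lemma deck_comp (A B : I -> C * C) : deck A -> deck B -> deck (fun i => su_mul (A i) (B i)).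
Proof.
move=> dA [y [y' [pyy' hB]]].
have [y'' [py'' hA]] := deck_move y' dA.
exists y, y''; split; first by rewrite pyy'.
move=> i; have [sA [[M M'] /= [My M'y] hM]] := hA i.
have [sB [[N N'] /= [Ny N'y] hN]] := hB i.
split; first exact: su11_mul.
have [cp _ _] := dev_covering dev.
move: Ny N'y My M'y.
rewrite !nbhsE => -[G [Go Gy] GN] [G' [G'o G'y] G'N] [Q [Qo Qy] QM] [Q' [Q'o Q'y] Q'M].
pose W := G `&` p @^-1` (p @` (G' `&` Q)).
have oW : open W.
  apply: openI => //; apply: open_comp; first by move=> ? _; exact: cp.
  by apply: (covering_open (dev_covering dev)); exact: openI.
exists (W, Q') => /=.
  split; apply: open_nbhs_nbhs; split=> //.
  by split=> //; exists y'.
move=> [z z''] [/= [Gz [z' [G'z' Qz'] pz]] Q'z''] pzz''.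
have h1 := hN (z, z') (conj (GN _ Gz) (G'N _ G'z')) (esym pz).
have h2 := hM (z', z'') (conj (QM _ Qz') (Q'M _ Q'z'')) (etrans pz pzz'').
rewrite h2 h1 su_act_mul//; apply: su_den_neq0 => //.
exact/ltW/phi_disc.
Qed.

Lemma deck_invert (A : I -> C * C) : deck A -> deck (fun i => su_inv (A i)).
Proof.
move=> [y [y' [pyy' hA]]]; exists y', y; split=> // i.
have [sA [[N N'] /= [hN hN'] h]] := hA i; split; first exact: su11_inv.
exists (N', N) => //= -[z z'] [/= Nz Nz'] pz.
rewrite (h (z', z) (conj Nz' Nz) (esym pz)) su_actK//.
exact/ltW/phi_disc.
Qed.

(** The parts of S reached from the discs of radius [1 - 1 / (n+2)] form an increasing open cover of
    a compact space. *)
Lemma deck_cocompact i : exists2 r : R, 0 < r < 1 &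
  forall y, exists2 y', p y' = p y & normc (phi i y') <= r.
Proof.
have [_ _ cphi _] := dev_embedding dev i.
have [cp sp _] := dev_covering dev.
pose f (n : nat) := p @` [set y | normc (phi i y) < 1 - n.+2%:R^-1].
have cph : continuous (phi i) by apply/continuous_subspace_setT.
have fop n : open (f n).
  apply: (covering_open (dev_covering dev)).
  have -> : [set y | normc (phi i y) < 1 - n.+2%:R^-1] =
    (fun y => normc (phi i y)) @^-1` [set x | x < 1 - n.+2%:R^-1] by [].
  apply: open_comp; last exact: open_lt.
  by move=> y _; apply: (cvg_comp _ _ (cph y)); exact: normc_continuous.
have /compact_near_coveringP hcov := dev_compact dev.
have [] := hcov nat \oo (fun n x => f n x) _ _.
  move=> x _; have [y _ <-] : range p x by rewrite sp.
  have d0 : 0 < 1 - normc (phi i y) by rewrite subr_gt0 phi_disc.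
  have : (fun n : nat => n.+1%:R^-1 : R) @ \oo --> 0 by exact: cvg_harmonic.
  move=> /cvgrPdist_lt/(_ _ d0)[N _ /(_ N.+1 (leqnSn N))] /=.
  rewrite sub0r normrN ger0_norm ?invr_ge0// => hN.
  exists (f N, [set n | (N <= n)%N]) => /=.
    split; last by exists N.
    by apply: open_nbhs_nbhs; split=> //; exists y => //=; rewrite ltrBrDl -ltrBrDr.
  move=> [_ n] [/= [z hz <-] Nn]; exists z => //=; apply: lt_le_trans hz _.
  by rewrite lerD2l lerN2 lef_pV2 ?posrE// ler_nat !ltnS.
move=> N _ /(_ N (leqnn N)) hN; exists (1 - N.+2%:R^-1).
  have M1 : N.+2%:R^-1 < 1 :> R by rewrite invf_lt1// ltr1n.
  have M0 : 0 < N.+2%:R^-1 :> R by rewrite invr_gt0.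
  by rewrite subr_gt0 M1 gtrBl.
move=> y; have [y' /= hy' py'] := hN (p y) Logic.I.
by exists y' => //; apply: ltW.
Qed.

(** Take w on the radius of z, at distance d from the circle, and A carrying to w a point u of the
    disc of radius r. By [su_act_norm] the denominator at u is large, hence so is the first
    coefficient, and [su_act_centerB] puts w near the image of the centre. *)
Lemma deck_approximates i z (e N : R) : normc z = 1 -> 0 < e ->
  exists A : I -> C * C, [/\ deck A, N < normc (A i).1 & normc ((A i).2 / (A i).1^* - z) < e].
Proof.
move=> z1 e0; have [r /andP[r0 r1] hr] := deck_cocompact i.
have r1' : 0 < 1 - r by rewrite subr_gt0.
(* M will bound the square of [normc (A i).1] from below: the term [N ^+ 2] makes this coefficient
   exceed N, the last one puts w within [e / 2] of the image of the centre. *)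
pose M := N ^+ 2 + 1 + 2 / (e * (1 - r)).
have K0 : 0 < 2 / (e * (1 - r)) by rewrite divr_gt0// mulr_gt0.
have M0 : 0 < M by rewrite /M; have := sqr_ge0 N; lra.
have rr : 0 < 1 - r ^+ 2 by nra.
(* The first bound keeps w within [e / 4] of z and the second keeps [1 - d] positive; the third,
   with [1 - r^2 <= 8 * d * a^2], gives [M <= a^2]. *)
pose d := Num.min (e / 4) (Num.min (2^-1) ((1 - r ^+ 2) / (8 * M))).
have d0 : 0 < d.
  by rewrite !lt_min; apply/and3P; split; rewrite ?invr_gt0 ?divr_gt0 ?mulr_gt0.
have de : d <= e / 4 by rewrite ge_min lexx.
have d2 : d <= 2^-1 by rewrite !ge_min lexx orbT.
have dM : d <= (1 - r ^+ 2) / (8 * M) by rewrite !ge_min lexx !orbT.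
pose w := rc (1 - d) * z.
have nw : normc w = 1 - d by rewrite Normc.normcM z1 mulr1 normc_real ger0_norm//; lra.
have [y _ hy] : range (phi i) w.
  by rewrite (dev_range dev i) /unit_disc /= normE -[1](rmorph1 rc) ltcR nw; lra.
have [y' py hy'] := hr y.
have hloc : forall j, exists A, su11 A /\ germ j A y' y by move=> j; exact: (dev_local dev j py).
have /choice[A hA] := hloc.
have dA : deck A by exists y', y.
have [sA gA] := hA i; have := germE py gA; rewrite hy => wA.
set u := phi i y' in hy' wA; have u1 : normc u <= 1 by lra.
have den0 := su_den_neq0 sA u1.
have := su_act_norm sA den0; rewrite -wA nw => hn.
have := su_act_centerB sA u1; rewrite -wA => hc.
have hlo := le_normc_den u sA.
have hup : normc (su_den (A i) u) <= normc (A i).1 + normc (A i).2 * normc u.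
  by rewrite /su_den addrC (le_trans (normc_triangle _ _))// Normc.normcM !normcJE.
have ba := su11_lt sA; have a1 := su11_ge1 sA; have b0 := normc_ge0 (A i).2.
have u0 := normc_ge0 u; have dgt0 := normc_gt0 den0.
move: hn hc hlo hup ba a1 b0 dgt0; set a := normc (A i).1; set b := normc (A i).2.
set q := normc (su_den _ _); set c := normc (w - _).
move: u0 hy' u1; set v := normc u.
move=> v0 vr v1 hn hc hlo hup ba a1 b0 q0.
have a0 : 0 < a by lra.
have q2 : q <= 2 * a by nra.
have qlo : a * (1 - r) <= q by nra.
have hq : (1 - (1 - d) ^+ 2) * q ^+ 2 = 1 - v ^+ 2 by rewrite hn divfK// gt_eqF// exprn_gt0.
have hM : d * (8 * M) <= 1 - r ^+ 2 by rewrite -ler_pdivlMr// mulr_gt0.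
have qq : q ^+ 2 <= 4 * a ^+ 2 by nra.
have dd : 1 - (1 - d) ^+ 2 <= 2 * d by nra.
have vv : 1 - r ^+ 2 <= 1 - v ^+ 2 by nra.
have h8 : 1 - r ^+ 2 <= 2 * d * (4 * a ^+ 2).
  by rewrite (le_trans vv)// -hq; apply: ler_pM; rewrite ?sqr_ge0//; nra.
have Ma : M <= a ^+ 2.
  by rewrite -(ler_pM2l (_ : 0 < 8 * d)) ?mulr_gt0//; lra.
exists A; split=> //.
  rewrite -/a ltNge; apply/negP => aN.
  have : a ^+ 2 <= N ^+ 2 by nra.
  by move: Ma; rewrite /M; lra.
have := normc_triangle ((A i).2 / (A i).1^* - w) (w - z); rewrite addrA subrK => ht.
apply: (le_lt_trans ht); rewrite normcB -/c.
have -> : normc (w - z) = d.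
  have -> : w - z = rc (- d) * z.
    have -> : rc (- d) = - rc d by exact: rmorphN.
    have hd : rc (1 - d) = 1 - rc d by rewrite rmorphB rmorph1.
    by rewrite /w hd; ring.
  by rewrite Normc.normcM z1 mulr1 normc_real normrN gtr0_norm.
suff : c < e / 2 by lra.
rewrite hc ltr_pdivrMr ?mulr_gt0//.
have h1 : a * (a * (1 - r)) <= a * q by rewrite ler_pM2l.
have h2 : M * (1 - r) <= a ^+ 2 * (1 - r) by rewrite ler_pM2r.
have h3 : 2 < M * (1 - r) * e.
  have -> : 2 = 2 / (e * (1 - r)) * (1 - r) * e by field; rewrite !gt_eqF.
  by rewrite ltr_pM2r// ltr_pM2r// /M ltrDr; have := sqr_ge0 N; lra.
nra.
Qed.

End germs.

Lemma circle_val (R : realType) (z : circle (R := R)) : Normc.normc (val z) = 1.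
Proof.
have /set_mem := valP z; rewrite /circle /= normE => h.
by apply: complexI; rewrite h rmorph1.
Qed.

(** * The Gromov boundary as a deck system *)

Section boundary_action.
Context {R : realType} {I : finType} (S : oriented_surface R) (St : topologicalType).
Context (p : St -> S) (y0 : St) (E : seq (pi1 R (p y0))).
Local Notation C := R[i].
Local Notation normc := Normc.normc.
Context (phi : I -> St -> R[i]^o) (bphi : I -> gromov_boundary E -> circle (R := R)).
Hypothesis dev : developing p phi.
Hypothesis bphi_homeo : forall i, homeomorphism (bphi i).
Hypothesis bphi_ext : forall i, boundary_extension (phi i) (bphi i).

Lemma orbit_point_exists (g : pi1 R (p y0)) : exists y, orbit_point g y.
Proof.
have [c [cc c0 hc]] := path_lift (dev_covering dev) (loop_continuous (l := repr g))
  (esym (loop0 (repr g))).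
by exists (c 1), (repr g); [rewrite reprK|exists c].
Qed.

Lemma su_act_cvg (A : C * C) (z : nat -> R[i]^o) (w : C) : su11 A ->
  (forall n, normc (z n) <= 1) -> normc w <= 1 ->
  z n @[n --> \oo] --> (w : R[i]^o) ->
  (su_act A (z n) : R[i]^o) @[n --> \oo] --> (su_act A w : R[i]^o).
Proof.
move=> sA z1 w1 /cvgC_normc zw; apply/cvgC_normc.
pose k := normc A.1 - normc A.2.
have k0 : 0 < k by rewrite subr_gt0 su11_lt.
have kd u : normc u <= 1 -> k <= normc (su_den A u).
  move=> u1; apply: le_trans (le_normc_den u sA).
  by rewrite lerD2l lerN2 ler_piMr ?normc_ge0.
apply: (@squeeze_cvgr _ _ _ _ (fun=> 0) (fun n => normc (z n - w) * (k * k)^-1)).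
- apply: nearW => n; rewrite normc_ge0 /= su_actB// ?su_den_neq0//.
  rewrite Normc.normcM Normc.normcV Normc.normcM ler_wpM2l ?normc_ge0//.
  rewrite lef_pV2 ?posrE ?mulr_gt0 ?normc_gt0 ?su_den_neq0//.
  by rewrite ler_pM ?kd// ltW.
- exact: cvg_cst.
- by rewrite -[X in _ --> X](mul0r (k * k)^-1); apply: cvgM => //; exact: cvg_cst.
Qed.

(** Let g be the class of the projection of a path from y0 to its image y0'. The deck transformation
    takes the orbit point of k to that of [g k], and the relation between their images under [phi i]
    passes to the limit along a geodesic ray. *)
Lemma deck_boundary_map A : deck p phi A -> exists t : gromov_boundary E -> gromov_boundary E,
  forall i x, val (bphi i (t x)) = su_act (A i) (val (bphi i x)).
Proof.
move=> dA; have [y0' [py hA]] := deck_move dev y0 dA.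
have [c [cc c0 c1]] := dev_connected dev y0 y0'.
have [cp _ _] := dev_covering dev.
have cpc : continuous (p \o c) by move=> t; apply: continuous_comp; [exact: cc|exact: cp].
have pc0 : (p \o c) 0 = p y0 by rewrite /= c0.
have pc1 : (p \o c) 1 = p y0 by rewrite /= c1 -py.
pose a := Loop cpc pc0 pc1.
pose g : pi1 R (p y0) := \pi_(pi1 R (p y0)) a.
exists (boundary_act g) => i x; pose nu := repr x.
have /choice[y hy] : forall n, exists y, orbit_point (val nu n) y.
  by move=> n; exact: orbit_point_exists.
have /choice[y' hy'] : forall n, exists y', orbit_point (val (translate_ray g nu) n) y' /\
    phi i y' = su_act (A i) (phi i (y n)).
  move=> n; have [b bg [d [cd d0 d1 pd]]] := hy n.
  have hA0 j : su11 (A j) /\ germ p phi j (A j) (d 0) y0' by rewrite d0; exact: hA.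
  have [d' [cd' d'0 pd' gd']] := deck_along dev cd (etrans (congr1 p d0) py) hA0.
  have h01 : 0 <= (1 : R) <= 1 by rewrite ler01 lexx.
  exists (d' 1); split; last first.
    by rewrite -d1; exact: (germE (esym (pd' 1 h01)) (gd' i 1 h01)).
  exists (loop_cat a b).
    by rewrite -pi1_mulE bg.
  (* The path c followed by the transported lift [d'] lifts the concatenated loop. *)
  exists (path_cat c d'); split.
  - by apply: path_cat_continuous => //; rewrite c1 d'0.
  - by rewrite path_cat0.
  - by rewrite path_cat1.
  - move=> t /andP[t0 t1]; rewrite /= /path_cat; case: ifPn => // ht.
    by rewrite pd' ?pd//; move: ht; rewrite -ltNge; lra.
have e1 := @bphi_ext i _ _ hy.
have e2 := @bphi_ext i _ _ (fun n => (hy' n).1).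
have hx : x = \pi_(gromov_boundary E) nu by rewrite reprK.
have sA : su11 (A i) by have [] := hA i.
have := su_act_cvg sA (fun n => ltW (phi_disc dev i (y n))) _ e1.
rewrite -hx circle_val => /(_ (lexx _)) e3.
have {}e2 : (su_act (A i) (phi i (y n)) : R[i]^o) @[n --> \oo] --> val (bphi i (boundary_act g x)).
  have <- : (fun n => phi i (y' n)) = (fun n => su_act (A i) (phi i (y n)) : R[i]^o).
    by apply/funext => n; exact: (hy' n).2.
  exact: e2.
exact: (cvgC_unique _ e2 e3).
Qed.

Lemma boundary_deck_system :
  deck_system (fun i x => val (bphi i x) : R[i]^o) (deck p phi).
Proof.
split.
- by move=> i x; exact: circle_val.
- by move=> i x y /val_inj; have [/bij_inj inj _ _] := bphi_homeo i; exact: inj.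
- move=> i z z1; have [[f fK Kf] _ _] := bphi_homeo i.
  have zc : z \in circle (R := R).
    by apply/mem_set; rewrite /circle /= normE z1.
  by exists (f (exist _ z zc)); rewrite Kf.
- move=> i x; have [_ cb _] := bphi_homeo i.
  apply: (@continuous_comp _ _ _ (bphi i) val); first exact: cb.
  exact: initial_continuous.
- move=> i x u hu; have [/bij_inj inj _ ob] := bphi_homeo i.
  move=> N /nbhs_interior Nx.
  have /ob [B oB hB] := @open_interior _ N.
  have Bx : B (val (bphi i x)).
    have : (bphi i @` interior N) (bphi i x) by exists x => //; exact: nbhs_singleton.
    by rewrite -hB.
  have [M _ hM] := hu B (open_nbhs_nbhs (conj oB Bx)).
  exists M => // n Mn /=; have Bn := hM n Mn.
  have : (bphi i @` interior N) (bphi i (u n)) by rewrite -hB.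
  by move=> [z Nz /inj <-]; exact: interior_subset.
- by move=> A [y [y' [_ hA]]] i; have [] := hA i.
- exact: (deck_comp dev).
- exact: (deck_invert dev).
- exact: deck_boundary_map.
- exact: (deck_approximates dev).
Qed.

End boundary_action.

(** * Primitives of the Liouville density *)

Section box_integral.
Context {R : realType}.
Local Notation normc := Normc.normc.

Lemma sqr_normc_cisB (s t : R) : normc (cis s - cis t) ^+ 2 = 2 - 2 * cos (s - t).
Proof.
rewrite cosB /cis /= sqr_sqrtr ?addr_ge0 ?sqr_ge0//.
have := cos2Dsin2 s; have := cos2Dsin2 t; nra.
Qed.

Lemma half_angle (u : R) : 2 - 2 * cos u = 4 * sin (u / 2) ^+ 2.
Proof.
rewrite -[in LHS](_ : u / 2 + u / 2 = u); last by lra.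
rewrite cosD; have := cos2Dsin2 (u / 2); nra.
Qed.

(** The density is [1 / (4 sin^2 ((y - x) / 2))], so its primitive is half a cotangent up to
    sign. *)
Lemma is_derive_half_cot (x y : R) : sin ((y - x) / 2) != 0 ->
  is_derive y 1 (fun y => - (cos ((y - x) / 2) / sin ((y - x) / 2)) / 2)
    ((2 - 2 * cos (x - y))^-1).
Proof.
move=> s0.
have d1 : is_derive y 1 (fun y => (y - x) / 2) (2^-1).
  by apply: is_derive_eq; rewrite /GRing.scale /=; lra.
have ds : is_derive y 1 (fun y => sin ((y - x) / 2)) (2^-1 * cos ((y - x) / 2)).
  by apply: is_derive_eq; rewrite mulrC.
have dc : is_derive y 1 (fun y => cos ((y - x) / 2)) (- (2^-1 * sin ((y - x) / 2))).
  by apply: is_derive_eq; rewrite mulNr mulrC.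
have di := is_deriveV s0 ds.
have dm := is_deriveM dc di.
have dz := is_deriveZ (- 2^-1) dm.
have -> : (fun y => - (cos ((y - x) / 2) / sin ((y - x) / 2)) / 2) =
  (- 2^-1 : R) \*: ((fun y => cos ((y - x) / 2)) * (fun y => (sin ((y - x) / 2))^-1)).
  apply/funext => z.
  rewrite -[RHS]/(- 2^-1 * (cos ((z - x) / 2) * (sin ((z - x) / 2))^-1)).
  by lra.
apply: is_derive_eq dz _.
rewrite /GRing.scale /= -[cos (x - y)]cosN opprB half_angle.
have := cos2Dsin2 ((y - x) / 2).
move: (cos _) (sin _) s0 => c s s0 hcs.
have -> : (4 * s ^+ 2)^-1 = (c ^+ 2 + s ^+ 2) / (4 * s ^+ 2) by rewrite hcs div1r.
by field.
Qed.

Lemma is_derive_ln_half_sin (x b : R) : 0 < sin ((b - x) / 2) ->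
  is_derive x 1 (fun x => ln (sin ((b - x) / 2)))
    (- (cos ((b - x) / 2) / sin ((b - x) / 2)) / 2).
Proof.
move=> s0.
have d1 : is_derive x 1 (fun x => (b - x) / 2) (- 2^-1).
  by apply: is_derive_eq; rewrite /GRing.scale /=; lra.
have ds : is_derive x 1 (fun x => sin ((b - x) / 2)) (- 2^-1 * cos ((b - x) / 2)).
  by apply: is_derive_eq; rewrite mulrC.
have dl := is_derive1_ln s0.
apply: is_derive_eq (@is_derive1_comp _ (@ln R) (fun x => sin ((b - x) / 2)) _ _ _ dl ds) _.
by field; rewrite gt_eqF.
Qed.

Lemma sin_half_gt0 (a b : R) : a < b -> b - a < 2 * pi -> 0 < sin ((b - a) / 2).
Proof. by move=> ab ba; apply: sin_gt0_pi; apply/andP; split; lra. Qed.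

Lemma derivable_LRcontinuous (F f : R -> R) (a b : R) : a < b ->
  (forall x, a <= x <= b -> is_derive x 1 F (f x)) ->
  derivable_oo_LRcontinuous F a b /\ {in `]a, b[, derive1 F =1 f}.
Proof.
move=> ab h; have cF x : a <= x <= b -> {for x, continuous F}.
  move=> hx; have [dF _] := h x hx.
  exact/differentiable_continuous/derivable1_diffP.
split; last first.
  by move=> x; rewrite in_itv /= => /andP[ax xb]; rewrite derive1E; have [_ ->] := h x (ltac:(lra)).
split.
- by move=> x; rewrite in_itv /= => /andP[ax xb]; have [] := h x (ltac:(lra)).
- by apply: cvg_at_right_filter; apply: cF; lra.
- by apply: cvg_at_left_filter; apply: cF; lra.
Qed.

Lemma integral_oo_FTC2 (F f : R -> R) (a b : R) : a < b ->
  (forall x, a <= x <= b -> is_derive x 1 F (f x)) ->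
  (forall x, a <= x <= b -> {for x, continuous f}) ->
  (\int[lebesgue_measure]_(x in `]a, b[) (f x)%:E = (F b - F a)%:E)%E.
Proof.
move=> ab hF cf.
have cw : {within `[a, b], continuous f}.
  apply: continuous_in_subspaceT => x /set_mem; rewrite /= in_itv /=.
  exact: cf.
have [dF F'] := derivable_LRcontinuous ab hF.
rewrite -(@integral_itv_bndoo _ _ _ _ true false).
  by rewrite (continuous_FTC2 ab cw dF F') EFinB.
apply/measurable_EFinP.
apply: measurable_funS (subspace_continuous_measurable_fun _ cw) => //.
by apply: subset_itvW; rewrite ?bnd_simp.
Qed.

Lemma inner_integral (x c d : R) : x < c -> c < d -> d - x < 2 * pi ->
  (\int[lebesgue_measure]_(y in `]c, d[) ((2 - 2 * cos (x - y))^-1)%:E =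
   ((cos ((c - x) / 2) / sin ((c - x) / 2) - cos ((d - x) / 2) / sin ((d - x) / 2)) / 2)%:E)%E.
Proof.
move=> xc cd dx.
apply: etrans (@integral_oo_FTC2 (fun y => - (cos ((y - x) / 2) / sin ((y - x) / 2)) / 2)
  (fun y => (2 - 2 * cos (x - y))^-1) _ _ cd _ _) _.
- move=> y /andP[cy yd]; apply: is_derive_half_cot; rewrite gt_eqF//.
  by apply: sin_half_gt0; lra.
- move=> y /andP[cy yd]; apply: continuousV.
    rewrite -[cos _]cosN opprB half_angle mulf_neq0// expf_neq0// gt_eqF//.
    by apply: sin_half_gt0; lra.
  apply: continuousB; first exact: cvg_cst.
  apply: continuousM; first exact: cvg_cst.
  apply: (@continuous_comp _ _ _ (fun y => x - y) (@cos R)).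
    by apply: continuousB; [exact: cvg_cst|exact: cvg_id].
  exact: continuous_cos.
- by congr EFin; lra.
Qed.

Lemma outer_integral (a b c d : R) : a < b -> b < c -> c < d -> d - a < 2 * pi ->
  (\int[lebesgue_measure]_(x in `]a, b[)
    ((cos ((c - x) / 2) / sin ((c - x) / 2) - cos ((d - x) / 2) / sin ((d - x) / 2)) / 2)%:E =
   (ln (sin ((c - a) / 2)) + ln (sin ((d - b) / 2)) -
    (ln (sin ((d - a) / 2)) + ln (sin ((c - b) / 2))))%:E)%E.
Proof.
move=> ab bc cd da.
apply: etrans (@integral_oo_FTC2 (fun x => ln (sin ((d - x) / 2)) - ln (sin ((c - x) / 2)))
  (fun x => (cos ((c - x) / 2) / sin ((c - x) / 2) - cos ((d - x) / 2) / sin ((d - x) / 2)) / 2)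
  _ _ ab _ _) _.
- move=> x /andP[ax xb].
  have s1 : 0 < sin ((d - x) / 2) by apply: sin_half_gt0; lra.
  have s2 : 0 < sin ((c - x) / 2) by apply: sin_half_gt0; lra.
  have h1 := is_derive_ln_half_sin s1; have h2 := is_derive_ln_half_sin s2.
  apply: is_derive_eq (is_deriveB h1 h2) _.
  by lra.
- move=> x /andP[ax xb].
  have cc (e : R) : sin ((e - x) / 2) != 0 ->
      {for x, continuous (fun x => cos ((e - x) / 2) / sin ((e - x) / 2))}.
    move=> s0; have ch : {for x, continuous (fun x => (e - x) / 2)}.
      apply: continuousM; last exact: cvg_cst.
      by apply: continuousB; [exact: cvg_cst|exact: cvg_id].
    apply: continuousM.
      by apply: (@continuous_comp _ _ _ (fun x => (e - x) / 2) (@cos R)) => //; exact: continuous_cos.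
    apply: continuousV => //.
    by apply: (@continuous_comp _ _ _ (fun x => (e - x) / 2) (@sin R)) => //; exact: continuous_sin.
  apply: continuousM; last exact: cvg_cst.
  by apply: continuousB; apply: cc; rewrite gt_eqF//; apply: sin_half_gt0; lra.
- by congr EFin; lra.
Qed.

End box_integral.

(** * Angles and arcs of the circle *)

Section arcs.
Context {R : realType}.
Local Notation C := R[i].
Local Notation normc := Normc.normc.

(* The argument in ]0, 2 pi[ of a point of the circle other than 1. *)
Definition angle (z : C) : R := pi - 2 * atan (complex.Im z / (1 - complex.Re z)).

Lemma angle_gt0 z : 0 < angle z.
Proof. by have := atan_ltpi2 (complex.Im z / (1 - complex.Re z)); rewrite /angle; lra. Qed.

Lemma angle_lt2pi z : angle z < 2 * pi.
Proof. by have := atan_gtNpi2 (complex.Im z / (1 - complex.Re z)); rewrite /angle; lra. Qed.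

Lemma circle_Re_lt1 (z : C) : normc z = 1 -> z != 1 -> complex.Re z < 1.
Proof.
case: z => x y /= h zn; have hxy : x ^+ 2 + y ^+ 2 = 1.
  by rewrite -[LHS]sqr_sqrtr ?h ?expr1n// addr_ge0 ?sqr_ge0.
rewrite lt_neqAle; apply/andP; split.
  apply: contra_neq zn => x1; have y0 : y = 0 by move: hxy; rewrite x1; nra.
  by rewrite x1 y0.
by nra.
Qed.

(** For [z = cis theta] with theta in []0, 2 pi[], the quotient [Im z / (1 - Re z)] is
    [cot (theta / 2)], whose arctangent is [pi / 2 - theta / 2]. *)
Lemma angleK z : normc z = 1 -> z != 1 -> cis (angle z) = z.
Proof.
move=> z1 zn; have := circle_Re_lt1 z1 zn.
move: z1; rewrite /angle; case: z {zn} => x y /= h x1.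
have hxy : x ^+ 2 + y ^+ 2 = 1.
  by rewrite -[LHS]sqr_sqrtr ?h ?expr1n// addr_ge0 ?sqr_ge0.
set T := y / (1 - x); set t := atan T.
have c0 : 0 < cos t.
  by rewrite /t cos_atan invr_gt0 sqrtr_gt0 ltr_wpDr ?sqr_ge0.
have c2 : cos t ^+ 2 * (1 + T ^+ 2) = 1.
  rewrite /t cos_atan exprVn sqr_sqrtr ?mulVf// ?gt_eqF ?ltr_wpDr ?sqr_ge0//.
  by rewrite addr_ge0 ?sqr_ge0.
have s : sin t = T * cos t.
  have : tan t = T by rewrite /t atanK.
  by rewrite /tan => <-; rewrite divfK// gt_eqF.
have hT : T * (1 - x) = y by rewrite /T divfK// subr_eq0 gt_eqF.
have hc : cos t ^+ 2 * 2 = 1 - x.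
  have x0 : 1 - x != 0 by rewrite subr_eq0 gt_eqF.
  apply: (mulIf x0); transitivity (cos t ^+ 2 * ((1 - x) ^+ 2 + y ^+ 2)).
    have -> : y ^+ 2 = 1 - x ^+ 2 by lra.
    by ring.
  rewrite -hT; transitivity (cos t ^+ 2 * (1 + T ^+ 2) * (1 - x) ^+ 2); first by ring.
  by rewrite c2 mul1r expr2.
rewrite /cis cosB sinB cospi sinpi mulr_natl mulr2n cosD sinD s.
apply/eqP; rewrite eq_complex /=; apply/andP; split; apply/eqP.
  transitivity (cos t ^+ 2 * T ^+ 2 - cos t ^+ 2); first by ring.
  by move: c2 hc; rewrite mulrDr mulr1; lra.
have -> : 0 * (cos t * cos t - T * cos t * (T * cos t)) - -1 *
   (T * cos t * cos t + cos t * (T * cos t)) = T * (cos t ^+ 2 * 2) by ring.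
by rewrite hc.
Qed.

Lemma angle_continuous (z : R[i]^o) : normc z = 1 -> z != 1 :> C ->
  {for z, continuous (angle : R[i]^o -> R)}.
Proof.
move=> z1 zn; have x1 := circle_Re_lt1 z1 zn.
apply: (@continuousB _ _ _ (fun=> pi) (fun z : R[i]^o => 2 * atan (complex.Im z / (1 - complex.Re z)))).
  exact: cst_continuous.
apply: (@continuousM _ _ (fun=> 2) (fun z : R[i]^o => atan (complex.Im z / (1 - complex.Re z)))).
  exact: cst_continuous.
apply: (@continuous_comp _ _ _ (fun z : R[i]^o => complex.Im z / (1 - complex.Re z)) (@atan R)); last exact: continuous_atan.
apply: (@continuousM _ _ (fun z : R[i]^o => complex.Im z) (fun z : R[i]^o => (1 - complex.Re z)^-1)).
  exact: Im_continuous.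
apply: continuousV; first by rewrite subr_eq0 gt_eqF.
apply: (@continuous_comp _ _ _ (@complex.Re R : R[i]^o -> R) (fun r : R => 1 - r)).
  exact: Re_continuous.
by apply: continuousB; [exact: cvg_cst|exact: cvg_id].
Qed.

Lemma cis_inj (s t : R) : `|s - t| < 2 * pi -> cis s = cis t -> s = t.
Proof.
move=> st h; have := normc_cisB s t; rewrite h subrr Normc.normc0 => /esym/eqP.
rewrite mulf_eq0 pnatr_eq0 /= normr_eq0 => /eqP s0.
apply/eqP; rewrite -subr_eq0; apply: contraT => st0.
have : 0 < sin (`|s - t| / 2).
  apply: sin_gt0_pi; rewrite divr_gt0 ?normr_gt0//=.
  by rewrite ltr_pdivrMr// mulrC.
have [_|_] := ger0P (s - t); first by rewrite s0 ltxx.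
by rewrite mulNr sinN s0 oppr0 ltxx.
Qed.

(** The bounds a and b are the infimum and supremum of the image, reached only as limits: [angle] is
    discontinuous at 1, and an end of the arc may be sent there. *)
Lemma increasing_image (f : R -> R) (s t : R) : s < t ->
  (forall x, s < x < t -> {for x, continuous f}) ->
  {in `]s, t[ &, {mono f : x y / x <= y}} ->
  (forall x, 0 < f x < 2 * pi) ->
  exists a b, [/\ 0 <= a, a < b, b <= 2 * pi, f @` `]s, t[ = `]a, b[%classic &
     f x @[x --> s^'+] --> a /\ f x @[x --> t^'-] --> b].
Proof.
move=> st cf mf bf.
have lt x y : s < x < t -> s < y < t -> x < y -> f x < f y.
  move=> hx hy xy; rewrite lt_neqAle mf ?in_itv//= ltW// andbT.
  apply/eqP => fxy; have : f y <= f x by rewrite fxy.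
  by rewrite mf ?in_itv//= leNgt xy.
pose F := f @` `]s, t[%classic.
have Fx x : s < x < t -> F (f x) by move=> hx; exists x => //=; rewrite in_itv.
pose m := (s + t) / 2; have hm : s < m < t by rewrite /m; apply/andP; split; lra.
have sF : has_sup F.
  split; first by exists (f m); exact: Fx.
  by exists (2 * pi) => _ [x _ <-]; have /andP[_ /ltW] := bf x.
have iF : has_inf F.
  split; first by exists (f m); exact: Fx.
  by exists 0 => _ [x _ <-]; have /andP[/ltW] := bf x.
pose a := inf F; pose b := sup F.
have af x : s < x < t -> a < f x.
  move=> hx; have h' : s < (s + x) / 2 < t by move/andP: hx => [? ?]; apply/andP; split; lra.
  apply: (@le_lt_trans _ _ (f ((s + x) / 2))); first by apply: ge_inf; [exact: (iF.2)|exact: Fx].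
  by apply: lt => //; move/andP: hx => [? ?]; lra.
have fb x : s < x < t -> f x < b.
  move=> hx; have h' : s < (x + t) / 2 < t by move/andP: hx => [? ?]; apply/andP; split; lra.
  apply: (@lt_le_trans _ _ (f ((x + t) / 2))); last by apply: ub_le_sup; [exact: (sF.2)|exact: Fx].
  by apply: lt => //; move/andP: hx => [? ?]; lra.
have adhb e : 0 < e -> exists2 x, s < x < t & b - e < f x.
  by move=> e0; have [_ [x /= hx <-] hb] := sup_adherent e0 sF; exists x => //; rewrite in_itv in hx.
have adha e : 0 < e -> exists2 x, s < x < t & f x < a + e.
  by move=> e0; have [_ [x /= hx <-] hb] := inf_adherent e0 iF; exists x => //; rewrite in_itv in hx.
exists a, b; split.
- by apply: lb_le_inf; [exact: (iF.1)|move=> _ [x _ <-]; have /andP[/ltW] := bf x].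
- exact: lt_trans (af m hm) (fb m hm).
- by apply: ge_sup; [exact: (sF.1)|move=> _ [x _ <-]; have /andP[_ /ltW] := bf x].
- apply/seteqP; split=> [_ [x /= hx <-]|y /=]; rewrite !in_itv/=.
    by rewrite in_itv in hx; rewrite af// fb.
  move=> /andP[ay yb].
  have [x1 hx1 fx1] := adha (y - a) (ltac:(by rewrite subr_gt0)).
  have [x2 hx2 fx2] := adhb (b - y) (ltac:(by rewrite subr_gt0)).
  have y1 : f x1 < y by lra.
  have y2 : y < f x2 by lra.
  have x12 : x1 < x2.
    by rewrite ltNge; apply/negP; rewrite -mf ?in_itv//= leNgt (lt_trans y1).
  have cw : {within `[x1, x2], continuous f}.
    apply: continuous_in_subspaceT => x /set_mem; rewrite /= in_itv /= => /andP[? ?].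
    by apply: cf; move: hx1 hx2 => /andP[? ?] /andP[? ?]; apply/andP; split; lra.
  have hv : Num.min (f x1) (f x2) <= y <= Num.max (f x1) (f x2).
    by rewrite ge_min (ltW y1) le_max (ltW y2) orbT.
  have [c] := IVT (ltW x12) cw hv.
  rewrite in_itv /= => /andP[c1 c2] fc; exists c => //=; rewrite in_itv/=.
  by move: hx1 hx2 => /andP[? ?] /andP[? ?]; apply/andP; split; lra.
split; apply/cvgrPdist_lt => e e0.
- have [x0 /andP[sx0 x0t] hx0] := adha e e0.
  near=> x; have hx : s < x < t.
    have sx : s < x by near: x; exact: nbhs_right_gt.
    have xx : x < x0 by near: x; exact: nbhs_right_lt.
    by rewrite sx (lt_trans xx).
  have fx : f x <= f x0.
    rewrite mf ?in_itv//= ?sx0//; apply: ltW; near: x; exact: nbhs_right_lt.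
  by have h := af x hx; rewrite ltr_distl; apply/andP; split; lra.
- have [x0 /andP[sx0 x0t] hx0] := adhb e e0.
  near=> x; have hx : s < x < t.
    have xt : x < t by near: x; exact: nbhs_left_lt.
    have xx : x0 < x by near: x; exact: nbhs_left_gt.
    by rewrite xt (lt_trans _ xx).
  have fx : f x0 <= f x.
    rewrite mf ?in_itv//= ?sx0//; apply: ltW; near: x; exact: nbhs_left_gt.
  by have h := fb x hx; rewrite ltr_distl; apply/andP; split; lra.
Unshelve. all: by end_near.
Qed.

Lemma arc_image_increasing (u : R -> R[i]^o) (s t : R) : s < t -> continuous u ->
  (forall x, normc (u x) = 1) -> (forall x, s < x < t -> u x != 1 :> C) ->
  {in `]s, t[ &, {mono (angle \o u) : x y / x <= y}} ->
  exists a b, [/\ 0 <= a, a < b, b <= 2 * pi, u @` `]s, t[ = @cis R @` `]a, b[ &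
    cis a = u s /\ cis b = u t].
Proof.
move=> st cu u1 un mono.
have [a [b [a0 ab b2 im [la lb]]]] := @increasing_image (angle \o u) s t st
  (fun x hx => continuous_comp (cu x) (angle_continuous (u1 x) (un x hx))) mono
  (fun x => introT andP (conj (angle_gt0 (u x)) (angle_lt2pi (u x)))).
exists a, b; split=> //.
  rewrite -im; apply/seteqP; split=> z.
    move=> [x hx <-]; exists (angle (u x)); first by exists x.
    by rewrite angleK//; apply: un; move: hx; rewrite /= in_itv.
  move=> [_ [x hx <-] <-]; exists x => //.
  by rewrite /= angleK//; apply: un; move: hx; rewrite /= in_itv.
split.
- apply: (@cvgC_unique _ _ (s^'+) _ u _ _ _); last first.
    by apply: cvg_at_right_filter; exact: cu.
  have : cis (angle (u x)) @[x --> s^'+] --> cis a.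
    by apply: (cvg_comp _ _ la); exact: cis_continuous.
  apply: cvg_trans; apply: near_eq_cvg; near=> x; rewrite angleK//; apply: un.
  by apply/andP; split; near: x; [exact: nbhs_right_gt|exact: nbhs_right_lt].
- apply: (@cvgC_unique _ _ (t^'-) _ u _ _ _); last first.
    by apply: cvg_at_left_filter; exact: cu.
  have : cis (angle (u x)) @[x --> t^'-] --> cis b.
    by apply: (cvg_comp _ _ lb); exact: cis_continuous.
  apply: cvg_trans; apply: near_eq_cvg; near=> x; rewrite angleK//; apply: un.
  by apply/andP; split; near: x; [exact: nbhs_left_gt|exact: nbhs_left_lt].
Unshelve. all: by end_near.
Qed.

(** A continuous injective function on an interval is monotone; the reflection r reduces the
    decreasing case to the increasing one and exchanges the ends. *)
Lemma arc_image (u : R -> R[i]^o) (s t : R) : s < t -> continuous u ->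
  (forall x, normc (u x) = 1) -> (forall x, s < x < t -> u x != 1 :> C) ->
  {in `]s, t[ &, injective u} ->
  exists a b, [/\ 0 <= a, a < b, b <= 2 * pi, u @` `]s, t[ = @cis R @` `]a, b[ &
    (cis a = u s /\ cis b = u t) \/ (cis a = u t /\ cis b = u s)].
Proof.
move=> st cu u1 un inj.
have cw : {within `]s, t[, continuous (angle \o u)}.
  apply: continuous_in_subspaceT => x /set_mem; rewrite /= in_itv /= => hx.
  exact: (continuous_comp (cu x) (angle_continuous (u1 x) (un x hx))).
have iw : {in `]s, t[ &, injective (angle \o u)}.
  move=> x y hx hy /= h; apply: inj => //.
  by rewrite -[LHS]angleK ?h ?angleK// un//; rewrite in_itv in hx hy.
have [hex|hno] := pselect (exists x y, [/\ x \in `]s, t[, y \in `]s, t[, x < y &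
    (angle \o u) x <= (angle \o u) y]).
  have [a [b [a0 ab b2 im ends]]] := arc_image_increasing st cu u1 un (itv_continuous_inj_le hex cw iw).
  by exists a, b; split=> //; left.
pose r x := s + t - x; pose u' := u \o r.
have rI x : (r x \in `]s, t[) = (x \in `]s, t[).
  by rewrite !in_itv /r /=; apply/andP/andP => -[? ?]; split; lra.
have cr : continuous r by move=> x; apply: cvgB; [exact: cvg_cst|exact: cvg_id].
have cu' : continuous u' by move=> x; apply: continuous_comp; [exact: cr|exact: cu].
have un' x : s < x < t -> u' x != 1 :> C.
  by move=> hx; apply: un; have := rI x; rewrite !in_itv /= hx.
have mono' : {in `]s, t[ &, {mono (angle \o u') : x y / x <= y}}.
  apply: itv_continuous_inj_le.
  - pose x := s + (t - s) / 3; pose y := s + (t - s) / 2.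
    have hx : x \in `]s, t[ by rewrite in_itv /= /x; apply/andP; split; lra.
    have hy : y \in `]s, t[ by rewrite in_itv /= /y; apply/andP; split; lra.
    exists x, y; split=> //; first by rewrite /x /y; lra.
    rewrite leNgt; apply/negP => h; apply: hno; exists (r y), (r x).
    by split; rewrite ?rI//; [rewrite /r /x /y; lra|exact: ltW].
  - apply: continuous_in_subspaceT => x /set_mem; rewrite /= in_itv /= => hx.
    exact: (continuous_comp (cu' x) (angle_continuous (u1 (r x)) (un' x hx))).
  - move=> x y hx hy /iw; rewrite !rI => /(_ hx hy); rewrite /r; lra.
have [a [b [a0 ab b2 im [ea eb]]]] := arc_image_increasing st cu' (fun x => u1 (r x)) un' mono'.
exists a, b; split=> //; last first.
  right; rewrite ea eb /u' /r /=; split; congr u; lra.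
rewrite -im; apply/seteqP; split=> _ [x hx <-]; exists (r x).
- by have := rI x; rewrite /= => ->.
- by rewrite /u' /= /r; congr u; lra.
- by have := rI x; rewrite /= => ->.
- by [].
Qed.

End arcs.

(** * The measure of a rectangle of angles *)

Section rectangle.
Context {R : realType}.
Local Notation normc := Normc.normc.
Local Notation mu := (@lebesgue_measure R).
Local Notation RR := (measurableTypeR R * measurableTypeR R)%type.

(** The inverse is written as a real power, which is measurable on the whole line; the two agree
    because [2 - 2 * cos] is nonnegative. *)
Lemma measurable_chord_density : measurable_fun [set: RR]
  (fun t : RR => (2 - 2 * cos (t.1 - t.2)) `^ (-1)).
Proof.
apply: (measurableT_comp (measurable_powR (-1))).
apply: measurable_funB => //.
apply: measurable_funM => //.
apply: (measurableT_comp (continuous_measurable_fun (@continuous_cos R))).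
by apply: measurable_funB.
Qed.

Definition open_rect (a b c d : R) : set RR :=
  [set t : RR | (a < t.1 < b) /\ (c < t.2 < d)].

(** Tonelli's theorem gives a combination of logarithms of sines. Each sine is half a chord, and the
    factors 2 cancel in the cross ratio. *)
Lemma rect_integral (a b c d : R) : a < b -> b < c -> c < d -> d - a < 2 * pi ->
  (\int[(mu \x mu)%E]_(t in open_rect a b c d)
     ((normc (cis t.1 - cis t.2) ^+ 2)^-1)%:E =
   (ln (normc (cis a - cis c) * normc (cis b - cis d) /
       (normc (cis a - cis d) * normc (cis b - cis c))))%:E)%E.
Proof.
move=> ab bc cd da.
set D := open_rect a b c d.
have DE : D = (`]a, b[%classic `*` `]c, d[%classic).
  by apply/seteqP; split=> -[x y]; rewrite /D /open_rect /= !in_itv.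
have mD : measurable D by rewrite DE; exact: measurableX.
have h0 (x y : R) : 0 <= 2 - 2 * cos (x - y) by rewrite -sqr_normc_cisB sqr_ge0.
pose g (t : RR) : \bar R := ((2 - 2 * cos (t.1 - t.2)) `^ (-1))%:E.
rewrite (eq_integral g); last first.
  by move=> t _; rewrite /g powR_inv1 ?h0// sqr_normc_cisB.
rewrite integral_mkcond fubini_tonelli1; last 2 first.
- apply/(measurable_restrictT _ mD).
  by apply/measurable_EFinP; apply: measurable_funS measurable_chord_density.
- move=> t; rewrite patchE; case: ifP => // _.
  by rewrite lee_fin powR_ge0.
pose k (x : R) : \bar R := ((cos ((c - x) / 2) / sin ((c - x) / 2) -
    cos ((d - x) / 2) / sin ((d - x) / 2)) / 2)%:E.
apply: (@etrans _ _ (\int[mu]_x (k \_ `]a, b[%classic) x)%E).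
  apply: eq_integral.
  move=> x _; rewrite /fubini_F patchE; case: ifPn => hx.
    move: hx; rewrite inE /= in_itv /= => /andP[ax xb].
    apply: (@etrans _ _ _ _ _ (@inner_integral _ x c d _ cd _)); [|lra|lra].
    rewrite [RHS]integral_mkcond; apply: eq_integral => y _.
    rewrite !patchE.
    have -> : ((x, y) \in D) = (y \in `]c, d[%classic).
      by apply/idP/idP; rewrite !inE /D /open_rect /= in_itv /= ax xb => // -[].
    by case: ifPn => // _; rewrite /g powR_inv1 ?h0.
  rewrite integral0_eq// => y _; rewrite patchE ifN//.
  apply: contra hx; rewrite !inE /D /open_rect /= in_itv /=.
  by move=> [].
rewrite -integral_mkcond outer_integral//.
congr EFin.
have hs (x y : R) : x < y -> y - x < 2 * pi ->
    normc (cis x - cis y) = 2 * sin ((y - x) / 2) /\ 0 < sin ((y - x) / 2).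
  move=> xy yx; have h := sin_half_gt0 xy yx; split=> //.
  rewrite normc_cisB (_ : (x - y) / 2 = - ((y - x) / 2)); last by lra.
  by rewrite sinN normrN gtr0_norm.
have [-> h1] := hs a c (ltac:(lra)) (ltac:(lra)).
have [-> h2] := hs b d (ltac:(lra)) (ltac:(lra)).
have [-> h3] := hs a d (ltac:(lra)) (ltac:(lra)).
have [-> h4] := hs b c (ltac:(lra)) (ltac:(lra)).
move: h1 h2 h3 h4; do 4!move: (sin _) => ?; move=> h1 h2 h3 h4.
rewrite ln_div ?posrE ?mulr_gt0// !lnM ?posrE ?mulr_gt0//.
by ring.
Qed.

End rectangle.

(** * Boxes of unordered pairs *)

Section unordered_pair_boxes.
Context (T : topologicalType).
Implicit Types (p q : upair T) (x y : T).

Lemma set2_inj (x y z t : T) : [set x; y] = [set z; t] ->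
  (x = z /\ y = t) \/ (x = t /\ y = z).
Proof.
move=> h.
have hx : [set z; t] x by rewrite -h; left.
have hy : [set z; t] y by rewrite -h; right.
have hz : [set x; y] z by rewrite h; left.
have ht : [set x; y] t by rewrite h; right.
move: hx hy hz ht => /= [|] -> [|] -> [|] ? [|] ?; subst; by [left|right].
Qed.

Lemma ends_pi (z : @off_diagonal T) :
  ends (\pi_(upair T) z : upair T) = [set (val z).1; (val z).2].
Proof.
have : \pi_(upair T) (repr (\pi_(upair T) z)) = \pi_(upair T) z by rewrite reprK.
move=> /eqmodP; rewrite /= /upair_rel /ends => /orP[/eqP ->//|/eqP ->].
by rewrite setUC.
Qed.

Lemma upair_exists x y : x <> y -> exists q : upair T, ends q = [set x; y].
Proof.
move=> xy.
exists (\pi_(upair T) (exist _ (x, y) (mem_set (xy : off_diagonal (x, y))) : @off_diagonal T)).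
by rewrite ends_pi.
Qed.

Lemma ends_inj : injective (@ends T).
Proof.
move=> p q; rewrite /ends => /set2_inj h.
rewrite -[p]reprK -[q]reprK; apply/eqmodP; rewrite /= /upair_rel.
move: h; case: (val (repr p)) (val (repr q)) => a b [c d] /=.
by move=> [[-> ->]|[-> ->]]; rewrite eqxx ?orbT.
Qed.

Lemma ends_neq q x y : ends q = [set x; y] -> x <> y.
Proof.
have qn := set_mem (valP (repr q)).
by move=> /set2_inj h xy; apply: qn; move: h => [[-> ->]|[-> ->]].
Qed.

Definition box (C1 C2 : set T) : set (upair T) :=
  [set q | exists x y, [/\ C1 x, C2 y & ends q = [set x; y]]].

Lemma boxC (C1 C2 : set T) : box C1 C2 = box C2 C1.
Proof.
by apply/seteqP; split=> q [x [y [h1 h2 h]]]; exists y, x; split=> //; rewrite h setUC.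
Qed.

Lemma pi_box (C1 C2 : set T) : (fun z : @off_diagonal T => \pi_(upair T) z : upair T) @^-1` box C1 C2 =
  (fun z => val z) @^-1` ((C1 `*` C2) `|` (C2 `*` C1)).
Proof.
apply/seteqP; split=> z.
  move=> [x [y [h1 h2]]]; rewrite ends_pi => /set2_inj[[e1 e2]|[e1 e2]].
    by left; split; rewrite ?e1 ?e2.
  by right; split; rewrite ?e1 ?e2.
move=> /= [[h1 h2]|[h1 h2]].
  by exists (val z).1, (val z).2; rewrite ends_pi.
by exists (val z).2, (val z).1; rewrite ends_pi setUC.
Qed.

Lemma open_box (C1 C2 : set T) : open C1 -> open C2 -> open (box C1 C2).
Proof.
move=> o1 o2; have : open ((fun z : @off_diagonal T => \pi_(upair T) z : upair T) @^-1` box C1 C2).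
  rewrite pi_box; exists ((C1 `*` C2) `|` (C2 `*` C1)) => //.
  have oX (A B : set T) : open A -> open B -> open (A `*` B).
    move=> oA oB; have -> : A `*` B = fst @^-1` A `&` snd @^-1` B by [].
    by apply: openI; apply: open_comp => // x _; [exact: cvg_fst|exact: cvg_snd].
  by apply: openU; exact: oX.
by [].
Qed.

(** Since K1 and K2 are disjoint, their product misses the diagonal and remains compact in
    [off_diagonal]; the box is its image in the quotient. *)
Lemma compact_box (K1 K2 : set T) : compact K1 -> compact K2 -> K1 `&` K2 = set0 ->
  compact (box K1 K2).
Proof.
move=> c1 c2 K12.
pose Z : set (@off_diagonal T) := (fun z => val z) @^-1` (K1 `*` K2).
have -> : box K1 K2 = (fun z : @off_diagonal T => \pi_(upair T) z : upair T) @` Z.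
  apply/seteqP; split=> q.
    move=> [x [y [h1 h2 h]]].
    have xy := ends_neq h.
    exists (exist _ (x, y) (mem_set (xy : off_diagonal (x, y))) : @off_diagonal T) => //.
    by apply: ends_inj; rewrite ends_pi h.
  move=> [z [h1 h2] <-]; exists (val z).1, (val z).2; split=> //.
  by rewrite ends_pi.
apply: continuous_compact.
  apply: continuous_subspaceT; exact: pi_continuous.
move=> F FF FZ.
have [|w [[w1 w2] clw]] := compact_setX c1 c2 (F := (fun z : @off_diagonal T => val z) @ F) _.
  by [].
have wn : w.1 <> w.2.
  move=> h; suff : (K1 `&` K2) w.1 by rewrite K12.
  by split=> //; rewrite h.
exists (exist _ w (mem_set (wn : off_diagonal w)) : @off_diagonal T); split=> //.
move=> A B FA; rewrite nbhsE => -[V [[W oW <-]] /= Ww VB].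
have FA' : ((fun z : @off_diagonal T => val z) @ F) ((fun z : @off_diagonal T => val z) @` A).
  rewrite /nbhs /=; apply: filterS FA; exact: preimage_image.
have [_ [[z Az <-] Wz]] := clw _ W FA' (open_nbhs_nbhs (conj oW Ww)).
by exists z; split=> //; exact: VB.
Qed.

End unordered_pair_boxes.

(** * The Liouville measure of boxes *)

Section liouville_boxes.
Context {R : realType}.
Local Notation normc := Normc.normc.
Local Notation circle := (circle (R := R)).

Lemma mem_upair_image_box (X : topologicalType) (h : X -> circle) (C1 C2 : set X)
    (z w : R[i]^o) : injective h ->
  (exists2 q, upair_image h (box C1 C2) q & val @` ends q = [set z; w]) <->
  exists x y, [/\ C1 x, C2 y, x <> y & [set val (h x); val (h y)] = [set z; w]].
Proof.
move=> inj; split.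
  move=> [q [q' [x [y [h1 h2 h3]] h4]] <-]; exists x, y; split=> //.
    exact: ends_neq h3.
  by rewrite h4 h3 !image_setU !image_set1.
move=> [x [y [h1 h2 xy h3]]].
have [q hq] := @upair_exists _ (h x) (h y) (fun e => xy (inj _ _ e)).
have [q' hq'] := upair_exists xy.
exists q; last by rewrite hq image_setU !image_set1.
exists q'; first by exists x, y.
by rewrite hq hq' image_setU !image_set1.
Qed.

(** As [b < c], the smaller angle of a pair in the box is the one in []a, b[], so the domain of
    integration is exactly a rectangle. *)
Lemma liouville_box (X : topologicalType) (h : X -> circle) (C1 C2 : set X)
    (a b c d : R) : injective h ->
  0 <= a -> a < b -> b < c -> c < d -> d <= 2 * pi -> d - a < 2 * pi ->
  (fun x => val (h x)) @` C1 = @cis R @` `]a, b[ ->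
  (fun x => val (h x)) @` C2 = @cis R @` `]c, d[ ->
  liouville (upair_image h (box C1 C2)) =
  (ln (normc (cis a - cis c) * normc (cis b - cis d) /
       (normc (cis a - cis d) * normc (cis b - cis c))))%:E.
Proof.
move=> inj a0 ab bc cd d2 da h1 h2.
rewrite -rect_integral// /liouville; congr (integral _ _ _).
apply/seteqP; split=> -[s t] /=; rewrite /open_rect /=.
  move=> [s0 st t2 /(mem_upair_image_box _ _ _ _ inj)[x [y [C1x C2y xy]]]].
  have : ((fun x => val (h x)) @` C1) (val (h x)) by exists x.
  have : ((fun x => val (h x)) @` C2) (val (h y)) by exists y.
  rewrite h1 h2 => -[y']; rewrite /= in_itv /= => /andP[y1 y2] <-.
  move=> -[x']; rewrite /= in_itv /= => /andP[x1 x2] <-.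
  move=> /set2_inj[[e1 e2]|[e1 e2]].
    have e3 : x' = s by apply: cis_inj e1; rewrite ltr_norml; lra.
    have e4 : y' = t by apply: cis_inj e2; rewrite ltr_norml; lra.
    by rewrite -e3 -e4; split; lra.
  have e3 : x' = t by apply: cis_inj e1; rewrite ltr_norml; lra.
  have e4 : y' = s by apply: cis_inj e2; rewrite ltr_norml; lra.
  by exfalso; lra.
move=> [/andP[s1 s2] /andP[t1 t2]]; split; [lra|lra|lra|].
apply/(mem_upair_image_box _ _ _ _ inj).
have : (@cis R @` `]a, b[) (cis s) by exists s => //=; rewrite in_itv /= s1.
have : (@cis R @` `]c, d[) (cis t) by exists t => //=; rewrite in_itv /= t1.
rewrite -h1 -h2 => -[y C2y ey] [x C1x ex].
exists x, y; split=> //; last by rewrite ex ey.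
move=> xy; have : s = t by apply: cis_inj; [rewrite ltr_norml; lra|rewrite -ex -ey xy].
by lra.
Qed.

Lemma liouville_ge0 (B : set (upair circle)) : (0 <= liouville B)%E.
Proof. by apply: integral_ge0 => t _; rewrite lee_fin invr_ge0 sqr_ge0. Qed.

Lemma interval_meet (a b c d : R) : a < b -> c < d -> a < d -> c < b ->
  exists2 r, a < r < b & c < r < d.
Proof.
move=> ab cd ad cb; exists ((Num.max a c + Num.min b d) / 2);
  by have [] := leP a c; have [] := leP b d; lra.
Qed.

Lemma ln_norm_eq (x y : R) : 0 < x -> 0 < y -> 0 <= ln x -> y = x \/ y = x^-1 ->
  ln x = `|ln y|.
Proof.
move=> x0 y0 lx [->|->]; first by rewrite ger0_norm.
by rewrite lnV ?posrE// normrN ger0_norm.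
Qed.

(** Each arc may be traversed in either direction, and either may come first in angle. Reversing one
    of them inverts the cross ratio; the absolute value settles the sign because the measure is
    nonnegative. *)
Lemma liouville_arcs (X : topologicalType) (h : X -> circle) (chi : R -> X)
    (s t s' t' : R) : injective h -> s < t -> t < s' -> s' < t' ->
  continuous (fun x => val (h (chi x)) : R[i]^o) ->
  {in `[s, t'] &, injective (fun x => val (h (chi x)))} ->
  (forall x, (s < x < t) || (s' < x < t') -> val (h (chi x)) != 1 :> R[i]) ->
  let u x := val (h (chi x)) : R[i] in
  liouville (upair_image h (box (chi @` `]s, t[) (chi @` `]s', t'[))) =
  (`|ln (normc (u s - u s') * normc (u t - u t') /
       (normc (u s - u t') * normc (u t - u s')))|)%:E.
Proof.
move=> inj st ts st' cu iu un u.
have u1 x : normc (u x) = 1 by exact: circle_val.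
have uI x y : s <= x <= t' -> s <= y <= t' -> u x = u y -> x = y.
  by move=> hx hy; apply: iu; rewrite in_itv.
have [a [b [a0 ab b2 im1 e1]]] := @arc_image _ u s t st cu u1
   (fun x hx => un x (introT orP (or_introl hx)))
   (fun x y hx hy => uI x y (ltac:(move: hx; rewrite in_itv /=; lra))
                            (ltac:(move: hy; rewrite in_itv /=; lra))).
have [c [d [c0 cd d2 im2 e2]]] := @arc_image _ u s' t' st' cu u1
   (fun x hx => un x (introT orP (or_intror hx)))
   (fun x y hx hy => uI x y (ltac:(move: hx; rewrite in_itv /=; lra))
                            (ltac:(move: hy; rewrite in_itv /=; lra))).
have disj r : a < r < b -> c < r < d -> False.
  move=> h1 h2.
  have : (u @` `]s, t[) (cis r) by rewrite im1; exists r => //; rewrite /= in_itv.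
  have : (u @` `]s', t'[) (cis r) by rewrite im2; exists r => //; rewrite /= in_itv.
  move=> [y hy <-] [x hx /uI xy]; move: hx hy; rewrite /= !in_itv /= => hx hy.
  by have := xy (ltac:(lra)) (ltac:(lra)); lra.
have n1 : u s <> u s' by move=> /uI; lra.
have n2 : u s <> u t' by move=> /uI; lra.
have n3 : u t <> u s' by move=> /uI; lra.
have n4 : u t <> u t' by move=> /uI; lra.
have im1' : (fun x => val (h x)) @` (chi @` `]s, t[) = @cis R @` `]a, b[.
  by rewrite -im1 image_comp.
have im2' : (fun x => val (h x)) @` (chi @` `]s', t'[) = @cis R @` `]c, d[.
  by rewrite -im2 image_comp.
have Nac : cis a <> cis c by case: e1 e2 => [[-> _]|[-> _]] [[-> _]|[-> _]].
have Nad : cis a <> cis d by case: e1 e2 => [[-> _]|[-> _]] [[_ ->]|[_ ->]].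
have Nbc : cis b <> cis c by case: e1 e2 => [[_ ->]|[_ ->]] [[-> _]|[-> _]].
have Nbd : cis b <> cis d by case: e1 e2 => [[_ ->]|[_ ->]] [[_ ->]|[_ ->]].
have pos (x y : R[i]) : x <> y -> 0 < normc (x - y).
  by move=> /eqP xy; rewrite normc_gt0// subr_eq0.
have [bc|bc] := ltP b c.
  (* Otherwise [a = 0] and [d = 2 * pi], and the two arcs would have a common end at the point 1. *)
  have da : d - a < 2 * pi.
    rewrite ltNge; apply/negP => da; apply: Nad.
    have -> : a = 0 by lra.
    have -> : d = 2 * pi by lra.
    by rewrite cis0 cis_2pi.
  have := liouville_ge0 (upair_image h (box (chi @` `]s, t[) (chi @` `]s', t'[))).
  rewrite (liouville_box inj a0 ab bc cd d2 da im1' im2') lee_fin => l0.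
  congr EFin; apply: ln_norm_eq l0 _; rewrite ?mulr_gt0 ?invr_gt0 ?mulr_gt0 ?pos//.
  case: e1 e2 => [[-> ->]|[-> ->]] [[-> ->]|[-> ->]]; [left|right|right|left];
    rewrite ?invf_div; congr (_ / _); by [|exact: mulrC].
have bc' : b <> c by move=> bc'; apply: Nbc; rewrite bc'.
have da : d < a.
  rewrite ltNge; apply/negP => ad.
  have ad' : a <> d by move=> ad'; apply: Nad; rewrite ad'.
  have ad2 : a < d by rewrite lt_neqAle ad andbT; apply/eqP.
  have cb : c < b by rewrite lt_neqAle bc andbT eq_sym; apply/eqP.
  by have [r] := interval_meet ab cd ad2 cb; exact: disj.
have bc2 : b - c < 2 * pi.
  rewrite ltNge; apply/negP => da'; apply: Nbc.
  have -> : c = 0 by lra.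
  have -> : b = 2 * pi by lra.
  by rewrite cis0 cis_2pi.
have := liouville_ge0 (upair_image h (box (chi @` `]s, t[) (chi @` `]s', t'[))).
rewrite boxC (liouville_box inj c0 cd da ab b2 bc2 im2' im1') lee_fin => l0.
congr EFin; apply: ln_norm_eq l0 _; rewrite ?mulr_gt0 ?invr_gt0 ?mulr_gt0 ?pos//; try exact: nesym.
rewrite ![normc (cis c - _)]normcB ![normc (cis d - _)]normcB.
case: e1 e2 => [[-> ->]|[-> ->]] [[-> ->]|[-> ->]]; [left|right|right|left];
  rewrite ?invf_div; congr (_ / _); by [|exact: mulrC].
Qed.

End liouville_boxes.

(** * Parametrizing the boundary by angles *)

Section circle_parametrization.
Context {R : realType}.
Local Notation normc := Normc.normc.
Local Notation C := R[i].
Local Notation circle := (circle (R := R)).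

Definition circle_param (X : topologicalType) (chi : R -> X) :=
  [/\ continuous chi, forall s t, `|s - t| < 2 * pi -> chi s = chi t -> s = t,
      forall s, chi (s + 2 * pi) = chi s &
      forall a x, exists2 t, a <= t < a + 2 * pi & chi t = x].

Lemma circle_point (z : C) : normc z = 1 -> circle z.
Proof. by move=> z1; rewrite /circle /= normE z1. Qed.

Lemma circle_param_exists (X : topologicalType) (h : X -> circle) (w : X) :
  homeomorphism h -> exists2 chi : R -> X, circle_param chi & chi 0 = w.
Proof.
move=> [[g hg gh] ch oh].
have cg : continuous g.
  apply/continuousP => U oU; have -> : g @^-1` U = h @` U by
    apply/seteqP; split=> z /=; [exists (g z)|move=> [x Ux <-]; rewrite hg].
  exact: oh.
have n1 t : normc ((val (h w) : C) * cis t) = 1.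
  by rewrite Normc.normcM circle_val normc_cis mulr1.
pose e (t : R) : circle := exist _ ((val (h w) : C) * cis t) (mem_set (circle_point (n1 t))).
have ce : continuous e.
  apply/continuousP => U [V oV <-].
  rewrite -comp_preimage; move: V oV; apply/continuousP => t.
  apply: cvgC_mul; [exact: cst_continuous|exact: cis_continuous].
have hw0 : val (h w) != 0 :> C.
  by apply/eqP => h0; have := circle_val (h w); rewrite h0 Normc.normc0 => /eqP; rewrite eq_sym oner_eq0.
exists (g \o e) => /=; last first.
  rewrite -[RHS]hg; congr g; apply: val_inj => /=; rewrite -[X in _ = X](mulr1 (val (h w) : C)).
  by congr (_ * _); exact: cis0.
split.
- by move=> t; apply: continuous_comp; [exact: ce|exact: cg].
- move=> s t st /= /(can_inj gh) /(congr1 val) /= /(mulfI hw0).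
  exact: cis_inj.
- move=> s /=; congr g; apply: val_inj => /=; congr (_ * _).
  by rewrite cisD cis_2pi mulr1.
- move=> a x.
  pose z : C := val (h x) / (val (h w) * cis a).
  have z1 : normc z = 1.
    by rewrite /z Normc.normcM Normc.normcV n1 invr1 mulr1 circle_val.
  have nz : (val (h w) : C) * cis a != 0.
    by apply/eqP => h0; have := n1 a; rewrite h0 Normc.normc0 => /eqP; rewrite eq_sym oner_eq0.
  have [t t0 tz] : exists2 t, 0 <= t < 2 * pi & cis t = z.
    have [->|zn] := eqVneq z 1.
      by exists 0; [rewrite lexx /= mulr_gt0// pi_gt0|rewrite cis0].
    exists (angle z); last exact: angleK.
    by rewrite ltW ?angle_gt0//= angle_lt2pi.
  exists (a + t); first lra.
  rewrite -[RHS]hg /=; congr g; apply: val_inj => /=.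
  by rewrite cisD tz mulrA mulrC /z divfK.
Qed.

(** Reversal exchanges the two sides of a point, so that one-sided statements are proved once. *)
Lemma circle_param_rev (X : topologicalType) (chi : R -> X) :
  circle_param chi -> circle_param (fun t => chi (2 * pi - t)).
Proof.
move=> [cc inj per surj]; split.
- move=> t; apply: (@continuous_comp _ _ _ (fun t : R => 2 * pi - t) chi); last exact: cc.
  by apply: cvgB; [exact: cvg_cst|exact: cvg_id].
- move=> s t st /inj e.
  have : 2 * pi - s = 2 * pi - t by apply: e; move: st; rewrite !ltr_norml; lra.
  by lra.
- by move=> s; rewrite -[LHS]per; congr chi; lra.
- move=> a x; have [t ta <-] := surj (- a) x.
  have [ta0|tn] := eqVneq t (- a).
    exists a; first by have := pi_gt0 R; lra.
    by rewrite ta0 -[RHS]per; congr chi; lra.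
  exists (2 * pi - t); last by congr chi; lra.
  have : - a < t by rewrite lt_neqAle eq_sym tn; case/andP: ta.
  by lra.
Qed.

(** The complement is the preimage of a compact arc of the circle. *)
Lemma open_arc (X : topologicalType) (h : X -> circle) (chi : R -> X) (s t : R) :
  continuous h -> injective h -> circle_param chi -> s < t -> t <= s + 2 * pi ->
  open (chi @` `]s, t[).
Proof.
move=> ch ih [cc inj per surj] st ts.
have cu : continuous (fun t => val (h (chi t)) : R[i]^o).
  move=> x; apply: continuous_comp (@initial_continuous _ _ _ _).
  by apply: continuous_comp; [exact: cc|exact: ch].
have -> : chi @` `]s, t[ = ~` ((fun x => val (h x) : R[i]^o) @^-1`
    ((fun t => val (h (chi t)) : R[i]^o) @` `[t, s + 2 * pi])).
  apply/seteqP; split=> x /=.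
    move=> [y]; rewrite in_itv /= => hy <- [z]; rewrite in_itv /= => hz /val_inj/ih e.
    by have := inj z y (ltac:(rewrite ltr_norml; lra)) e; lra.
  move=> hx; have [y hy yx] := surj s x.
  exists y => //; rewrite in_itv /=.
  have [yt|ty] := ltP y t; last first.
    by exfalso; apply: hx; exists y; rewrite ?yx// in_itv /= ty; lra.
  rewrite andbT lt_neqAle; case/andP: hy => -> _; rewrite andbT.
  apply/eqP => sy; apply: hx; exists (s + 2 * pi); last by rewrite per sy yx.
  by rewrite in_itv /= ts lexx.
rewrite openC; apply: closed_comp.
  move=> x _; apply: continuous_comp (@initial_continuous _ _ _ _).
  exact: ch.
apply: compact_closed; first exact: norm_hausdorff.
apply: continuous_compact; first exact: continuous_subspaceT.
exact: segment_compact.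
Qed.

End circle_parametrization.

Lemma cvgC_inv (R : realType) (T : Type) (F : set_system T) (FF : Filter F)
    (u : T -> R[i]^o) (l : R[i]) : l != 0 ->
  u @ F --> (l : R[i]^o) -> (fun t => (u t : R[i])^-1 : R[i]^o) @ F --> (l^-1 : R[i]^o).
Proof.
move=> l0 ul; apply/cvgC_normc.
have nl : Normc.normc l != 0 by rewrite gt_eqF// normc_gt0.
have nul : Normc.normc (u t) @[t --> F] --> Normc.normc l.
  apply: (@cvg_comp _ _ _ u (@Normc.normc R : R[i]^o -> R) F (nbhs (l : R[i]^o)) _ ul).
  exact: normc_continuous.
have -> : (0 : R) = 0 * (Normc.normc l)^-1 * (Normc.normc l)^-1 by rewrite !mul0r.
apply: cvg_trans; last first.
  apply: (@cvgM _ _ F _ (fun t => Normc.normc (u t - l) * (Normc.normc (u t))^-1) (fun=> (Normc.normc l)^-1)).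
    apply: (@cvgM _ _ F _ (fun t => Normc.normc (u t - l)) (fun t => (Normc.normc (u t))^-1)).
      exact/cvgC_normc.
    exact: cvgV.
  exact: cvg_cst.
apply: near_eq_cvg.
have : \forall t \near F, 0 < Normc.normc (u t).
  by apply: (cvgr_gt _ nul); rewrite normc_gt0.
apply: filterS => t ut; have u0 : (u t : R[i]) != 0.
  by apply/eqP => u0; move: ut; rewrite u0 Normc.normc0 ltxx.
rewrite -[LHS]/(_ * _ * _) -!Normc.normcV -!Normc.normcM -[RHS]normcNE; congr Normc.normc.
by field; rewrite u0 l0.
Qed.

(** * The box relation of a vanishing combination *)

Section null_combination.
Context {R : realType} {I : finType} {X : topologicalType}.
Local Notation normc := Normc.normc.
Local Notation C := R[i].
Local Notation rc := (real_complex R).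
Local Notation circle := (circle (R := R)).
Variables (h : I -> X -> circle) (c : I -> R) (i0 : I).
Hypothesis hh : forall i, homeomorphism (h i).
Hypothesis null : forall A : set (upair X), open A ->
  (exists2 K : set (upair X), compact K & A `<=` K) ->
  \sum_i c i * fine (liouville (upair_image (h i) A)) = 0.

Let H i x : R[i]^o := val (h i x).

Let hinj i : injective (h i). Proof. by have [/bij_inj] := hh i. Qed.
Let Hinj i : injective (H i). Proof. by move=> x y /val_inj/hinj. Qed.
Let H1 i x : normc (H i x) = 1. Proof. exact: circle_val. Qed.
Let Hcont i : continuous (H i).
Proof.
move=> x; apply: continuous_comp (@initial_continuous _ _ _ _).
by have [_ ch _] := hh i; exact: ch.
Qed.

(** Meant for the parameters b of the points sent to 1: being finitely many, they leave room for an
    arc starting at a. *)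
Lemma right_gap (b : I -> R) (a e : R) : a < e ->
  exists2 t, a < t < e & forall i, ~ (a < b i < t).
Proof.
move=> ae.
have : \forall t \near a^'+, (a < t < e) /\ forall i, ~ (a < b i < t).
  near=> t; split.
    by apply/andP; split; near: t; [exact: nbhs_right_gt|exact: nbhs_right_lt].
  near: t; apply: filter_forall => i.
  have [ab|ba] := ltP a (b i).
    near=> t; have : t < b i by near: t; exact: nbhs_right_lt.
    by move=> tb /andP[_]; rewrite ltNge ltW.
  by apply: filterE => t /andP[].
move=> /filter_ex[t [ht h']]; by exists t.
Unshelve. all: by end_near. Qed.

Lemma left_gap (b : I -> R) (a e : R) : e < a ->
  exists2 t, e < t < a & forall i, ~ (t < b i < a).
Proof.
move=> ae.
have [|t ht hb] := @right_gap (fun i => - b i) (- a) (- e); first lra.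
exists (- t); first lra.
by move=> i hi; apply: (hb i); lra.
Qed.

(** Along the arc the ratio rho is real, continuous and injective, equal to 0 at s and to 1 at t; by
    the intermediate value theorem it stays strictly between them inside. *)
Lemma arc_ratio (chi : R -> X) (s t u : R) i w : circle_param chi -> s < u -> u < t -> t < s + 2 * pi ->
  (forall x, s <= x <= t -> chi x != w) ->
  exists r : R, 0 < r < 1 /\ fpc H i (chi s) w (chi u) = rc r * fpc H i (chi s) w (chi t).
Proof.
move=> [cc inj per surj] su ut ts nw.
have Hn x y : x != y -> H i x != H i y by apply: contra_neq => /Hinj.
have nts : chi t != chi s.
  by apply/eqP => /inj e; have := e (ltac:(rewrite ltr_norml; lra)); lra.
have nx x : s <= x <= t -> H i (chi x) != H i w by move=> hx; apply/Hn/nw.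
have rx x : s <= x <= t -> exists r : R, fpc H i (chi s) w (chi x) = rc r * fpc H i (chi s) w (chi t).
  move=> hx; apply: fpcoord_ratio_real; rewrite ?H1//; [exact: nx|apply: nx; lra|exact: Hn].
have F0 : fpc H i (chi s) w (chi t) != 0.
  by rewrite fpcoord_eq0; [exact: Hn|apply: nx; lra].
pose rho x : R := complex.Re (fpc H i (chi s) w (chi x) / fpc H i (chi s) w (chi t)).
have rhoE x : s <= x <= t -> fpc H i (chi s) w (chi x) = rc (rho x) * fpc H i (chi s) w (chi t).
  by move=> hx; rewrite /rho; have [r ->] := rx x hx; rewrite mulfK.
have rs : rho s = 0 by rewrite /rho /fpc /fpcoord subrr !mul0r.
have rt : rho t = 1 by rewrite /rho divff.
have rinj x y : s <= x <= t -> s <= y <= t -> rho x = rho y -> x = y.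
  move=> hx hy rxy; have e : fpc H i (chi s) w (chi x) = fpc H i (chi s) w (chi y).
    by rewrite (rhoE x hx) (rhoE y hy) rxy.
  have /Hinj/inj e' : H i (chi x) = H i (chi y).
    by apply: fpcoord_inj e; apply: nx; rewrite //; lra.
  by apply: e'; rewrite ltr_norml; lra.
have crho x : s <= x <= t -> {for x, continuous rho}.
  move=> hx.
  apply: (@continuous_comp _ _ _ (fun x => (fpc H i (chi s) w (chi x) / fpc H i (chi s) w (chi t)) : R[i]^o) (@complex.Re R)); last exact: Re_continuous.
  have cu : (H i (chi y) @[y --> x] --> H i (chi x)).
    by apply: continuous_comp; [exact: cc|exact: Hcont].
  have hd : (H i (chi x) : C) - H i w != 0 by rewrite subr_eq0; exact: nx.
  apply: cvgC_mul; last exact: cst_continuous.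
  apply: cvgC_mul; first exact: cvgC_subr.
  by apply: cvgC_inv hd _; exact: cvgC_subr.
have cw a b : s <= a -> a <= b -> b <= t -> {within `[a, b], continuous rho}.
  move=> sa ab bt; apply: continuous_in_subspaceT => x /set_mem; rewrite /= in_itv /= => hx.
  by apply: crho; lra.
exists (rho u); split; last by apply: rhoE; lra.
have n0 : rho u <> 0 by rewrite -rs => /rinj; lra.
have n1 : rho u <> 1 by rewrite -rt => /rinj; lra.
apply/andP; split; rewrite ltNge; apply/negP => hu.
  have [|x] := @IVT _ rho u t 0 (ltW ut) (cw u t (ltac:(lra)) (ltac:(lra)) (ltac:(lra))).
    rewrite rt ge_min le_max; lra.
  by rewrite in_itv /= -rs => hx /rinj; lra.
have [|x] := @IVT _ rho s u 1 (ltW su) (cw s u (ltac:(lra)) (ltac:(lra)) (ltac:(lra))).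
  rewrite rs ge_min le_max; lra.
by rewrite in_itv /= -rt => hx /rinj; lra.
Qed.

Lemma side_relation (chi : R -> X) (o : R) : circle_param chi -> 0 < o < 2 * pi ->
  exists t e, [/\ o < e, e < t, t < 2 * pi & forall u, o < u < e -> exists r : I -> R,
    (forall i, 0 < r i < 1 /\
       fpc H i (chi o) (chi 0) (chi u) = rc (r i) * fpc H i (chi o) (chi 0) (chi t)) /\
    \sum_i c i * ln (1 - r i) = 0].
Proof.
move=> pchi ho; have [cc inj per surj] := pchi.
(* [b i] is the parameter at which the circle is cut for the index i; e and t are then chosen so
   that []o, e[] and []t, 2 * pi[] contain none of these. *)
have /choice[b hb] : forall i, exists b, 0 <= b < 2 * pi /\ H i (chi b) = 1 :> C.
  move=> i.
  have [[g hg gh] _ _] := hh i.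
  have [t ht ht'] := surj 0 (g (exist _ 1 (mem_set (circle_point (Normc.normc1 R))))).
  by exists t; split; [lra|rewrite /H ht' gh].
have b1 i x : 0 <= x < 2 * pi -> H i (chi x) = 1 :> C -> x = b i.
  move=> hx; have [hbi <-] := hb i => /Hinj/inj; apply.
  by rewrite ltr_norml; lra.
have [|t ht bt] := left_gap b (a := 2 * pi) (e := o); first lra.
have [|e he be] := right_gap b (a := o) (e := t); first lra.
exists t, e; split; [lra|lra|lra|] => u hu.
have /choice[r hr] : forall i, exists r : R, 0 < r < 1 /\
    fpc H i (chi o) (chi 0) (chi u) = rc r * fpc H i (chi o) (chi 0) (chi t).
  move=> i; apply: arc_ratio; [exact: pchi|lra|lra|lra|].
  move=> x hx; apply/eqP => /inj e0.
  by have := e0 (ltac:(rewrite ltr_norml; lra)); lra.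
exists r; split=> //.
have H0 : chi (2 * pi) = chi 0 by rewrite -[RHS]per add0r.
have iI i : {in `[o, 2 * pi] &, injective (fun x => val (h i (chi x)))}.
  move=> x y; rewrite !in_itv /= => hx hy /Hinj/inj; apply; rewrite ltr_norml; lra.
have n1 i x : (o < x < u) || (t < x < 2 * pi) -> val (h i (chi x)) != 1 :> C.
  move=> hx; apply/eqP => /b1 e1.
  have {}e1 := e1 (ltac:(lra)).
  by move: hx => /orP[] hx; [apply: (be i)|apply: (bt i)]; rewrite -e1; lra.
pose A := box (chi @` `]o, u[) (chi @` `]t, (2 * pi)[).
have vA i : liouville (upair_image (h i) A) = (- ln (1 - r i))%:E.
  have cu : continuous (fun x => val (h i (chi x)) : R[i]^o).
    by move=> x; exact: (continuous_comp (cc x) (@Hcont i (chi x))).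
  apply: etrans (@liouville_arcs R X (h i) chi o u t (2 * pi) (@hinj i) _ _ _ cu (iI i) (n1 i)) _;
    [lra|lra|lra|].
  congr EFin; rewrite H0 -!/(H i _).
  have [r01 rE] := hr i.
  have Hn x y : `|x - y| < 2 * pi -> x <> y -> H i (chi x) != H i (chi y).
    by move=> xy nxy; apply/eqP => /Hinj/inj e1; apply/nxy/e1.
  have d1 : H i (chi u) != H i (chi 0) by apply: Hn; [rewrite ltr_norml|]; lra.
  have d2 : H i (chi t) != H i (chi 0) by apply: Hn; [rewrite ltr_norml|]; lra.
  have d3 : H i (chi t) != H i (chi o) by apply: Hn; [rewrite ltr_norml|]; lra.
  have F0 : fpc H i (chi o) (chi 0) (chi t) != 0 by rewrite fpcoord_eq0.
  have e0 : rc (1 - r i) = (((H i (chi u) : C) - H i (chi t)) * ((H i (chi 0) : C) - H i (chi o))) /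
      (((H i (chi u) : C) - H i (chi 0)) * ((H i (chi t) : C) - H i (chi o))).
    apply: etrans (fpcoord_ratioB d1 d2 d3).
    rewrite -[fpcoord _ _ (H i (chi u))]/(fpc H i (chi o) (chi 0) (chi u)) rE.
    by rewrite mulfK// rmorphB rmorph1.
  have := congr1 (fun z : C => normc z) e0.
  rewrite normc_real gtr0_norm ?subr_gt0; last by case/andP: r01.
  rewrite Normc.normcM Normc.normcV !Normc.normcM => e1.
  have r1 : 0 < 1 - r i by lra.
  suff -> : normc (H i (chi o) - H i (chi t)) * normc (H i (chi u) - H i (chi 0)) /
      (normc (H i (chi o) - H i (chi 0)) * normc (H i (chi u) - H i (chi t))) = (1 - r i)^-1.
    rewrite lnV ?posrE// normrN ler0_norm// ln_le0//; lra.
  rewrite e1 invf_div [normc (H i (chi o) - H i (chi t))]normcB.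
  by rewrite [normc (H i (chi o) - H i (chi 0))]normcB; congr (_ / _); exact: mulrC.
have := null (A := A) _ _.
under eq_bigr => i _ do rewrite vA /= mulrN.
rewrite sumrN => hA; apply/eqP; rewrite -oppr_eq0; apply/eqP; apply: hA.
  have [_ ch0 _] := hh i0.
  apply: open_box; apply: (open_arc ch0 (@hinj i0) pchi); lra.
(* The closed arcs are disjoint, so their box is compact. *)
exists (box (chi @` `[o, u]) (chi @` `[t, (2 * pi)])).
  apply: compact_box.
  - apply: continuous_compact; [exact: continuous_subspaceT|exact: segment_compact].
  - apply: continuous_compact; [exact: continuous_subspaceT|exact: segment_compact].
  apply/seteqP; split=> // x [[y]]; rewrite /= in_itv /= => hy <- [z]; rewrite in_itv /= => hz /inj e1.
  by have := e1 (ltac:(rewrite ltr_norml; lra)); lra.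
move=> q [x [y [[x' hx' <-] [y' hy' <-] hq]]]; exists (chi x'), (chi y'); split=> //.
  by exists x' => //; move: hx'; rewrite /= !in_itv /=; lra.
by exists y' => //; move: hy'; rewrite /= !in_itv /=; lra.
Qed.

Lemma null_box_relation : box_relation H c.
Proof.
move=> o w ow.
have [chi pchi chi0] := circle_param_exists w (hh i0).
have [cc inj per surj] := pchi.
have [t0 ht0 e0] := surj 0 o.
have {}ht0 : 0 < t0 < 2 * pi.
  rewrite add0r in ht0; case/andP: ht0 => ht0 ->; rewrite andbT lt_neqAle ht0 andbT.
  by apply: contra_neq ow => t00; rewrite -e0 -t00.
have pchi' := circle_param_rev pchi.
have [t [e [he et t2 hr]]] := side_relation pchi ht0.
have [|t' [e' [he' et' t2' hr']]] := @side_relation _ (2 * pi - t0) pchi'; first lra.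
have chi0' : chi (2 * pi - 0) = w by rewrite subr0 -chi0 -[RHS]per add0r.
have e0' : chi (2 * pi - (2 * pi - t0)) = o by rewrite -e0; congr chi; lra.
rewrite /= e0' chi0' in hr'; rewrite e0 chi0 in hr.
have neq x y : `|x - y| < 2 * pi -> x <> y -> chi x != chi y.
  by move=> xy nxy; apply/eqP => /inj e1; apply/nxy/e1.
exists (fun b : bool => if b then chi t else chi (2 * pi - t')); split.
  move=> [|].
    by split; [rewrite -e0|rewrite -chi0]; apply: neq; rewrite ?ltr_norml; lra.
  by split; [rewrite -e0|rewrite -chi0]; apply: neq; rewrite ?ltr_norml; lra.
move=> u un uo.
have /choice[s hs] : forall n, exists s, [/\ 0 < s < 2 * pi, s <> t0 & chi s = u n].
  move=> n; have [s hs es] := surj 0 (u n); have [uno unw] := un n.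
  exists s; split=> //.
    rewrite add0r in hs; case/andP: hs => hs ->; rewrite andbT lt_neqAle hs andbT.
    by apply: contra_neq unw => s0; rewrite -es -s0.
  by move=> st0; move: uno; rewrite -es st0 e0 eqxx.
(* Within d of t0 a parameter stays inside [[0, 2 * pi]] and, if different from t0, in the range of
   [hr] or of [hr']. *)
pose d := Num.min (Num.min t0 (2 * pi - t0)) (Num.min (e - t0) (e' - (2 * pi - t0))).
have d0 : 0 < d by rewrite !lt_min; lra.
have [d1 d2 d3 d4] : [/\ d <= t0, d <= 2 * pi - t0, d <= e - t0 & d <= e' - (2 * pi - t0)].
  by rewrite !ge_min !lexx !orbT.
have [_ ch0 _] := hh i0.
have oA : open (chi @` `](t0 - d), (t0 + d)[).
  by apply: (open_arc ch0 (@hinj i0) pchi); lra.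
have [N _ hN] : \forall n \near \oo, `|s n - t0| < d.
  have : \forall n \near \oo, (chi @` `](t0 - d), (t0 + d)[) (u n).
    apply: uo; apply: open_nbhs_nbhs; split=> //; exists t0 => //.
    by rewrite /= in_itv /=; lra.
  apply: filterS => n [x]; rewrite /= in_itv /= => hx; have [h1 h2 <-] := hs n.
  by move=> /inj <-; rewrite ltr_norml; lra.
(* Either infinitely many [u n] lie on the increasing side of o, or all but finitely many lie on the
   other, which the reversed parametrization treats. *)
have [fr|nfr] := pselect (forall m, exists n, (m <= n)%N /\ t0 < s n).
  exists true => m; have [n [mn tn]] := fr (maxn m N).
  exists n; split; first by rewrite (leq_trans _ mn)// leq_maxl.
  have := hN n; rewrite /= ltr_norml => /(_ (leq_trans (leq_maxr _ _) mn)) sn.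
  have [h1 h2 <-] := hs n; apply: hr; lra.
exists false => m.
have [m0 hm0] : exists m0, forall n, (m0 <= n)%N -> s n <= t0.
  apply: contrapT => hne; apply: nfr => k; apply: contrapT => hk; apply: hne.
  exists k => n kn; rewrite leNgt; apply/negP => tn; apply: hk; by exists n.
exists (maxn m (maxn m0 N)); split; first by rewrite leq_maxl.
set n := maxn _ _.
have := hN n; rewrite /= ltr_norml => /(_ (leq_trans (leq_maxr _ _) (leq_maxr _ _))) sn.
have := hm0 n (leq_trans (leq_maxl _ _) (leq_maxr _ _)) => sn'.
have [h1 h2 <-] := hs n.
have sn2 : s n < t0 by rewrite lt_neqAle sn' andbT; exact/eqP.
have := hr' (2 * pi - s n) (ltac:(lra)).
by rewrite (_ : 2 * pi - (2 * pi - s n) = s n); last lra.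
Qed.

End null_combination.

(** * Pairs with a prescribed end are negligible *)

Section lines.
Context {R : realType}.
Local Notation circle := (circle (R := R)).
Local Notation mu := (@lebesgue_measure R).
Local Notation RR := (measurableTypeR R * measurableTypeR R)%type.

Lemma null_line_integral (D : set RR) :
  measurable D -> (mu \x mu)%E D = 0%E ->
  (\int[(mu \x mu)%E]_(t in D)
     ((Normc.normc (cis t.1 - cis t.2) ^+ 2)^-1)%:E = 0)%E.
Proof.
move=> mD D0; apply: null_set_integral => //.
apply/measurable_EFinP.
have -> : (fun t : RR => (Normc.normc (cis t.1 - cis t.2) ^+ 2)^-1) =
    (fun t : RR => (2 - 2 * cos (t.1 - t.2)) `^ (-1)).
  apply/funext => t; rewrite powR_inv1 -sqr_normc_cisB//.
  by rewrite sqr_ge0.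
by apply: measurable_funS measurable_chord_density.
Qed.

(** In angles, the pairs with end c form a vertical and a horizontal segment of the triangle of
    integration. *)
Lemma liouville_pencil (X : topologicalType) (h : X -> circle) (b : X) :
  bijective h -> liouville (upair_image h (box [set b] setT)) = 0%E.
Proof.
move=> [g hg gh]; have inj := can_inj hg.
have [c hc cb] : exists2 c : R, 0 <= c < 2 * pi & cis c = val (h b).
  have [->|zn] := eqVneq (val (h b) : R[i]) 1.
    by exists 0; [rewrite lexx /= mulr_gt0// pi_gt0|rewrite cis0].
  exists (angle (val (h b))); last by rewrite angleK// circle_val.
  by rewrite ltW ?angle_gt0//= angle_lt2pi.
rewrite /liouville.
rewrite (_ : [set t | _] = ([set c] `*` `]c, (2 * pi)[%classic) `|` (`[0, c[%classic `*` [set c])).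
  apply: null_line_integral.
    by apply: measurableU; apply: measurableX.
  have e1 : (mu \x mu)%E ([set c] `*` `]c, (2 * pi)[%classic) = 0%E.
    by rewrite product_measure1E// [X in (X * _)%E](_ : _ = 0%E) ?mul0e//; exact: lebesgue_measure_set1.
  have e2 : (mu \x mu)%E (`[0, c[%classic `*` [set c]) = 0%E.
    by rewrite product_measure1E// [X in (_ * X)%E](_ : _ = 0%E) ?mule0//; exact: lebesgue_measure_set1.
  have m1 : measurable ([set c] `*` `]c, (2 * pi)[%classic : set RR) by exact: measurableX.
  have m2 : measurable (`[0, c[%classic `*` [set c] : set RR) by exact: measurableX.
  exact: (etrans (@measureU0 _ _ _ (mu \x mu)%E _ _ m1 m2 e2) e1).
have gx (z : R) : exists x, val (h x) = cis z.
  exists (g (exist _ (cis z) (mem_set (circle_point (normc_cis z))))).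
  by rewrite gh.
apply/seteqP; split=> -[s t] /=; rewrite !in_itv /=.
  move=> [s0 st t2 /(mem_upair_image_box _ _ _ _ inj)[x [y [-> _ xy]]]].
  rewrite -cb => /set2_inj[[e1 e2]|[e1 e2]].
    have e3 : c = s by apply: cis_inj e1; rewrite ltr_norml; lra.
    by left; split=> //; lra.
  have e3 : c = t by apply: cis_inj e1; rewrite ltr_norml; lra.
  by right; split=> //; lra.
move=> [[-> /andP[ct t2]]|[/andP[s0 sc] ->]].
  split; [lra|lra|lra|apply/(mem_upair_image_box _ _ _ _ inj)].
  have [y hy] := gx t; exists b, y; split=> //; last by rewrite hy cb.
  move=> xy; have : c = t by apply: cis_inj; [rewrite ltr_norml; lra|rewrite cb xy hy].
  by lra.
split; [lra|lra|lra|apply/(mem_upair_image_box _ _ _ _ inj)].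
have [y hy] := gx s; exists b, y; split=> //; last by rewrite hy cb setUC.
move=> xy; have : c = s by apply: cis_inj; [rewrite ltr_norml; lra|rewrite cb xy hy].
by lra.
Qed.

End lines.

Section sigma_closure.
Context {T : Type} {G : set (set T)}.

Lemma sigma_setC A : <<s G>> A -> <<s G>> (~` A).
Proof.
have [_ h _] := @smallest_sigma_algebra T setT G.
by move=> /h; rewrite setTD.
Qed.

Lemma sigma_bigcup (F : nat -> set T) : (forall n, <<s G>> (F n)) -> <<s G>> (\bigcup_n F n).
Proof. by have [_ _ h] := @smallest_sigma_algebra T setT G; exact: h. Qed.

Lemma sigma_set0 : <<s G>> set0.
Proof. by have [] := @smallest_sigma_algebra T setT G. Qed.

Lemma sigma_setU A B : <<s G>> A -> <<s G>> B -> <<s G>> (A `|` B).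
Proof.
by move=> mA mB; rewrite -bigcup2E; apply: sigma_bigcup => -[|[|n]] //=; exact: sigma_set0.
Qed.

Lemma sigma_setI A B : <<s G>> A -> <<s G>> B -> <<s G>> (A `&` B).
Proof.
move=> mA mB; rewrite -[_ `&` _]setCK setCI.
by apply: sigma_setC; apply: sigma_setU; exact: sigma_setC.
Qed.

End sigma_closure.

(** * A pi-system of boxes generating the Borel sets *)

Section pi_system.
Context {R : realType} {X : topologicalType}.
Local Notation circle := (circle (R := R)).
Variables (chi : R -> X) (beta : R).
Hypothesis pchi : circle_param chi.
Hypothesis beta_ge0 : 0 <= beta < 2 * pi.
Hypothesis open_arcs : forall s t, s < t -> t <= s + 2 * pi -> open (chi @` `]s, t[).

(** The parameters 0 and [beta] are meant to be those where two structures meet the cut point 1.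
    When the arcs avoid both, [liouville_arcs] gives the measure of the box for either structure. *)
Definition arcs_ok (v : R * R * (R * R)) := [&& 0 < v.1.1 < v.1.2, v.1.2 < v.2.1 < v.2.2,
  v.2.2 < 2 * pi, ~~ (v.1.1 < beta < v.1.2) & ~~ (v.2.1 < beta < v.2.2)].

Definition arc_box (v : R * R * (R * R)) : set (upair X) :=
  [set q | arcs_ok v /\ box (chi @` `]v.1.1, v.1.2[) (chi @` `]v.2.1, v.2.2[) q].

Definition pencils : set (upair X) :=
  box [set chi 0] setT `|` box [set chi beta] setT.

(** Boxes avoiding the cut points generate the open sets only modulo [pencils], which will be null;
    working modulo [pencils] admits all its Borel subsets. *)
Definition box_system : set (set (upair X)) :=
  [set A | <<s open>> A /\ ((exists v, A `\` pencils = arc_box v) \/ A `\` pencils = set0)].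

Lemma open_arc_box v : open (arc_box v).
Proof.
have [P|nP] := boolP (arcs_ok v).
  rewrite (_ : arc_box v = box (chi @` `]v.1.1, v.1.2[) (chi @` `]v.2.1, v.2.2[)).
    case/and5P: P => p1 p2 p3 _ _.
    by apply: open_box; apply: open_arcs; lra.
  by apply/seteqP; split=> q // [].
rewrite (_ : arc_box v = set0); first exact: open0.
by apply/seteqP; split=> q // -[]; rewrite (negbTE nP).
Qed.

Definition generic x y := [&& 0 < x, x < y, y < 2 * pi, x != beta & y != beta].

Lemma arc_boxP v q : arc_box v q <-> arcs_ok v /\ exists x y,
  [/\ generic x y, v.1.1 < x < v.1.2, v.2.1 < y < v.2.2 & ends q = [set chi x; chi y]].
Proof.
split=> [[ok [_ [_ [[x hx <-] [y hy <-] hq]]]]|[ok [x [y [_ hx hy hq]]]]].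
  split=> //; case/and5P: ok => h1 h2 h3 h4 h5.
  move: hx hy; rewrite /= !in_itv /= => hx hy; exists x, y; split=> //.
  apply/and5P; split; [lra|lra|lra| |].
    by apply: contraNneq h4 => <-.
  by apply: contraNneq h5 => <-.
by split=> //; exists (chi x), (chi y); split.
Qed.

Lemma chi_inj x y : 0 <= x < 2 * pi -> 0 <= y < 2 * pi -> chi x = chi y -> x = y.
Proof. by have [_ inj _ _] := pchi; move=> hx hy /inj; apply; rewrite ltr_norml; lra. Qed.

Lemma generic_inj x y x' y' : generic x y -> generic x' y' ->
  [set chi x; chi y] = [set chi x'; chi y'] -> x = x' /\ y = y'.
Proof.
move=> /and5P[? ? ? _ _] /and5P[? ? ? _ _] /set2_inj[[/chi_inj e1 /chi_inj e2]|[/chi_inj e1 /chi_inj e2]].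
  by split; [apply: e1|apply: e2]; lra.
have := e1 (ltac:(lra)) (ltac:(lra)); have := e2 (ltac:(lra)) (ltac:(lra)); lra.
Qed.

(** A pair in a box has a single increasing pair of parameters, so boxes intersect coordinatewise,
    like rectangles. The empty intersection is set apart because [arcs_ok] requires nonempty
    arcs. *)
Lemma arc_box_setI v v' : (exists w, arc_box v `&` arc_box v' = arc_box w) \/
  arc_box v `&` arc_box v' = set0.
Proof.
have [->|/set0P[q0 [q1 q2]]] := eqVneq (arc_box v `&` arc_box v') set0; first by right.
left; exists (Num.max v.1.1 v'.1.1, Num.min v.1.2 v'.1.2, (Num.max v.2.1 v'.2.1, Num.min v.2.2 v'.2.2)).
have [ok _] := q1; have [ok' _] := q2.
apply/seteqP; split=> q.
  move=> [/arc_boxP[_ [x [y [g hx hy e]]]] /arc_boxP[_ [x' [y' [g' hx' hy' e']]]]].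
  have [ex ey] := generic_inj g g' (etrans (esym e) e').
  rewrite -ex in hx'; rewrite -ey in hy'.
  apply/arc_boxP; split; last first.
    by exists x, y; split=> //=; rewrite gt_max lt_min; lra.
  case/and5P: ok => o1 o2 o3 o4 o5; case/and5P: ok' => o1' o2' o3' o4' o5'.
  apply/and5P; rewrite /= !gt_max !lt_min !gt_min !lt_max; split; [lra|lra|lra| |].
    by apply: contra o4; lra.
  by apply: contra o5; lra.
move=> /arc_boxP[_ [x [y [g /= hx hy e]]]].
rewrite !gt_max !lt_min in hx hy.
by split; apply/arc_boxP; split=> //; exists x, y; split=> //; lra.
Qed.

Lemma setI_closed_box_system : setI_closed box_system.
Proof.
move=> A B [mA hA] [mB hB]; split; first exact: sigma_setI.
rewrite (_ : (A `&` B) `\` pencils = (A `\` pencils) `&` (B `\` pencils)).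
  case: hA hB => [[v ->]|->] [[w ->]|->]; rewrite ?set0I ?setI0; try by right.
  exact: arc_box_setI.
by apply/seteqP; split=> q /=; tauto.
Qed.

Lemma pencils_compl q : ~ pencils q -> exists x y, generic x y /\ ends q = [set chi x; chi y].
Proof.
have [_ _ per surj] := pchi.
move=> nq; pose a := (val (repr q)).1; pose b := (val (repr q)).2.
have hq : ends q = [set a; b] by [].
have [x hx xa] := surj 0 a; have [y hy yb] := surj 0 b.
rewrite add0r in hx hy.
have nx z : [set a; b] (chi z) -> z <> 0 /\ z <> beta.
  move=> hz; split=> ez; apply: nq; [left|right]; rewrite -ez.
    move: hz => /= [->|->]; [exists a, b|exists b, a] => //.
    by rewrite hq setUC.
  move: hz => /= [->|->]; [exists a, b|exists b, a] => //.
  by rewrite hq setUC.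
have [x0 xb] : x <> 0 /\ x <> beta by apply: nx; left.
have [y0 yb'] : y <> 0 /\ y <> beta by apply: nx; right.
have xy : x <> y by move=> xy; apply: (ends_neq hq); rewrite -xa -yb xy.
have xp : 0 < x by rewrite lt_neqAle; case/andP: hx => -> _; rewrite andbT eq_sym; apply/eqP.
have yp : 0 < y by rewrite lt_neqAle; case/andP: hy => -> _; rewrite andbT eq_sym; apply/eqP.
have [lxy|lyx] := ltP x y.
  exists x, y; split; last by rewrite hq xa yb.
  by apply/and5P; split=> //; [lra|exact/eqP|exact/eqP].
exists y, x; split; last by rewrite hq xa yb setUC.
apply/and5P; split=> //; [|lra|exact/eqP|exact/eqP].
by rewrite lt_neqAle lyx andbT eq_sym; apply/eqP.
Qed.

Lemma arc_boxD v : arc_box v `\` pencils = arc_box v.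
Proof.
apply/seteqP; split=> q; first by case.
move=> hq; split=> //.
have [_ [x [y [/and5P[x0 xy y2 xb yb] _ _ e]]]] := iffLR (arc_boxP _ _) hq.
have h b : 0 <= b < 2 * pi -> x != b -> y != b -> ~ box [set chi b] setT q.
  move=> hb nx ny [_ [z [-> _]]]; rewrite e => /set2_inj[[+ _]|[_ +]] => /chi_inj e1.
    by move: nx; rewrite (e1 (ltac:(lra)) hb) eqxx.
  by move: ny; rewrite (e1 (ltac:(lra)) hb) eqxx.
move=> []; apply: h => //; [lra| |]; by apply/eqP => e1; lra.
Qed.

Lemma generic_neighborhood (U : set (upair X)) q x y : open U -> U q -> generic x y ->
  ends q = [set chi x; chi y] -> exists2 e, 0 < e &
  forall s t, `|s - x| < e -> `|t - y| < e -> forall q', ends q' = [set chi s; chi t] -> U q'.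
Proof.
have [cc _ _ _] := pchi.
move=> oU Uq g e.
have : open ((fun z : @off_diagonal X => \pi_(upair X) z : upair X) @^-1` U) by [].
move=> [W oW UW].
have piU (z : @off_diagonal X) : U (\pi_(upair X) z) = W (val z) by rewrite -[LHS]/(((fun z : @off_diagonal X => \pi_(upair X) z : upair X) @^-1` U) z) -UW.
have UP s t q' : ends q' = [set chi s; chi t] -> U q' <-> W (chi s, chi t).
  move=> hq; have st := ends_neq hq.
  pose z : @off_diagonal X := exist _ (chi s, chi t) (mem_set (st : off_diagonal (chi s, chi t))).
  have -> : q' = \pi_(upair X) z by apply: ends_inj; rewrite hq ends_pi.
  by rewrite piU.
have : \forall u \near (x, y), W (chi u.1, chi u.2).
  have cp : {for (x, y), continuous (fun u : R * R => (chi u.1, chi u.2))}.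
    apply: continuous_pair.
      by apply: continuous_comp; [exact: cvg_fst|exact: cc].
    by apply: continuous_comp; [exact: cvg_snd|exact: cc].
  by apply: cp; apply: open_nbhs_nbhs; split=> //; exact: (UP x y q e).1 Uq.
move=> [[A B] /= [/nbhs_ballP[e1 e10 hA] /nbhs_ballP[e2 e20 hB]] hAB].
exists (Num.min e1 e2); first by rewrite lt_min e10 e20.
move=> s t hs ht q' hq; apply/(UP _ _ _ hq); rewrite !lt_min in hs ht.
apply: (hAB (s, t)); split; [apply: hA|apply: hB].
  by rewrite /ball /= distrC; case/andP: hs.
by rewrite /ball /= distrC; case/andP: ht.
Qed.

Definition rational_box (n : nat) : set (upair X) :=
  if (unpickle n : option (rat * rat * (rat * rat))) is Some w
  then arc_box (ratr w.1.1, ratr w.1.2, (ratr w.2.1, ratr w.2.2)) else set0.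

Lemma open_arc_boxes (U : set (upair X)) : open U ->
  U `\` pencils = \bigcup_n (if `[< rational_box n `<=` U >] then rational_box n else set0).
Proof.
move=> oU; apply/seteqP; split=> q.
  move=> [Uq /pencils_compl[x [y [g e]]]].
  have [r r0 hr] := generic_neighborhood oU Uq g e.
  have [x0 xy y2 xb yb] := and5P g.
  (* This keeps the rational box inside U and its arcs apart from each other and clear of 0,
     [2 * pi] and [beta]. *)
  pose d := Num.min (Num.min (Num.min r x) (Num.min ((y - x) / 2) (2 * pi - y)))
    (Num.min `|x - beta| `|y - beta|).
  have d0 : 0 < d by rewrite !lt_min !normr_gt0 !subr_eq0 xb yb r0; lra.
  have dle : [&& d <= r, d <= x, d <= (y - x) / 2, d <= 2 * pi - y & (d <= `|x - beta|) && (d <= `|y - beta|)].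
    by rewrite /d !ge_min !lexx !orbT.
  have [dr dx dxy dy /andP[dxb dyb]] := and5P dle.
  have [s1] : exists s : rat, ratr s \in `](x - d), x[ by apply: rat_in_itvoo; lra.
  rewrite in_itv /= => hs1.
  have [t1] : exists s : rat, ratr s \in `]x, (x + d)[ by apply: rat_in_itvoo; lra.
  rewrite in_itv /= => ht1.
  have [s2] : exists s : rat, ratr s \in `](y - d), y[ by apply: rat_in_itvoo; lra.
  rewrite in_itv /= => hs2.
  have [t2] : exists s : rat, ratr s \in `]y, (y + d)[ by apply: rat_in_itvoo; lra.
  rewrite in_itv /= => ht2.
  exists (pickle (s1, t1, (s2, t2))) => //=; rewrite /rational_box pickleK /=.
  have far z : d <= `|z - beta| -> ~~ (z - d < beta < z + d).
    move=> hz; apply/negP => hb; move: hz; rewrite leNgt => /negP; apply.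
    by rewrite ltr_norml; lra.
  rewrite ifT; last first.
    apply/asboolP => q' /arc_boxP[_ [x' [y' [_ /= hx hy]]]].
    by apply: hr; rewrite ltr_norml; lra.
  apply/arc_boxP; split; last by exists x, y; split=> //=; lra.
  apply/and5P; split=> /=; [lra|lra|lra| |].
    by apply: contra (far x dxb); lra.
  by apply: contra (far y dyb); lra.
move=> [n _] /=; case: asboolP => // hU hq; split; first exact: hU.
by move: hq; rewrite /rational_box; case: (unpickle n) => //= w; rewrite -arc_boxD => -[].
Qed.

Lemma closed_pencil b : closed (box [set chi b] setT).
Proof.
have [_ inj per surj] := pchi.
rewrite -openC (_ : ~` _ = box (chi @` `]b, (b + 2 * pi)[) (chi @` `]b, (b + 2 * pi)[)).
  by apply: open_box; apply: open_arcs; have := pi_gt0 R; lra.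
have notb z : z <> chi b <-> (chi @` `]b, (b + 2 * pi)[) z.
  split=> [zb|[x]].
    have [x hx xz] := surj b z; exists x => //; rewrite /= in_itv /=.
    have xb : b <> x by move=> bx; apply: zb; rewrite -xz bx.
    by case/andP: hx => hx ->; rewrite andbT lt_neqAle hx andbT; apply/eqP.
  rewrite /= in_itv /= => hx <- /inj e.
  by have := e (ltac:(rewrite ltr_norml; lra)); lra.
apply/seteqP; split=> q.
  move=> hq; pose x := (val (repr q)).1; pose y := (val (repr q)).2.
  have e : ends q = [set x; y] by [].
  exists x, y; split=> //; apply/notb => xb; apply: hq.
    by exists x, y.
  by exists y, x; split=> //; rewrite e setUC.
move=> [x [y [/notb xb /notb yb e]]] [_ [z [-> _]]].
by rewrite e => /set2_inj[[? _]|[_ ?]].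
Qed.

Lemma measurable_pencil b : <<s @open (upair X)>> (box [set chi b] setT).
Proof.
rewrite -[box _ _]setCK; apply: sigma_setC; apply: sub_sigma_algebra.
by rewrite openC; exact: closed_pencil.
Qed.

Lemma measurable_pencils : <<s @open (upair X)>> pencils.
Proof. by apply: sigma_setU; exact: measurable_pencil. Qed.

Lemma open_rational_box n : open (rational_box n).
Proof.
rewrite /rational_box; case: (unpickle n) => [w|]; [exact: open_arc_box|exact: open0].
Qed.

Lemma rational_boxP n : (exists v, rational_box n = arc_box v) \/ rational_box n = set0.
Proof. by rewrite /rational_box; case: (unpickle n) => [w|]; [left; eexists|right]. Qed.

Lemma rational_boxD n : rational_box n `\` pencils = rational_box n.
Proof. by have [[v ->]|->] := rational_boxP n; rewrite ?arc_boxD ?set0D. Qed.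

Lemma box_system_pencilU n : box_system (rational_box n `|` pencils).
Proof.
split.
  apply: sigma_setU; last exact: measurable_pencils.
  by apply: sub_sigma_algebra; exact: open_rational_box.
rewrite setDUl setDv setU0 rational_boxD.
exact: rational_boxP.
Qed.

Lemma sigma_box_system : <<s @open (upair X)>> = <<s box_system>>.
Proof.
apply/seteqP; split; last first.
  by apply: smallest_sub; [exact: smallest_sigma_algebra|move=> A []].
apply: smallest_sub; first exact: smallest_sigma_algebra.
move=> U oU; rewrite (_ : U = (U `&` pencils) `|` (U `\` pencils)); last first.
  apply/seteqP; split=> q /=; last tauto.
  by move=> Uq; have [] := pselect (pencils q); tauto.
apply: sigma_setU.
  apply: sub_sigma_algebra; split.
    by apply: sigma_setI; [exact: sub_sigma_algebra|exact: measurable_pencils].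
  by right; apply/seteqP; split=> q // [[_ h] /(_ h)].
rewrite open_arc_boxes//; apply: sigma_bigcup => n.
case: ifP => _; last exact: sigma_set0.
apply: sub_sigma_algebra; split; first by apply: sub_sigma_algebra; exact: open_rational_box.
rewrite rational_boxD; exact: rational_boxP.
Qed.

End pi_system.

(** * Equal cross ratios give equal Liouville currents *)

Section measure_uniqueness.
Context {R : realType} {X : topologicalType}.
Local Notation circle := (circle (R := R)).

(** The base points make [borel x1] and [borel x2] different types; m2 is brought to the first by
    pushing it forward along the identity. *)
Lemma borel_measure_unique (T : topologicalType) (x1 x2 : T) (G : set (set T))
    (g : nat -> set T) : <<s @open T>> = <<s G>> -> setI_closed G ->
  (forall n, G (g n)) -> \bigcup_n g n = setT ->
  forall (m1 : {measure set (borel x1) -> \bar R}) (m2 : {measure set (borel x2) -> \bar R}),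
  (forall A, G A -> m1 A = m2 A) -> (forall n, (m1 (g n) < +oo)%E) ->
  forall A, <<s @open T>> A -> m1 A = m2 A.
Proof.
move=> GE GI Gg gT m1 m2 m12 m1g A mA.
have [nu hnu] : exists nu : {measure set (borel x1) -> \bar R}, forall A, nu A = m2 A.
  pose f : borel x2 -> borel x1 := id.
  have mf : measurable_fun setT f by move=> _ B mB; rewrite setTI.
  by exists (pushforward m2 (mfun_Sub (mem_set mf) : {mfun borel x2 >-> borel x1})).
have m1nu B : G B -> m1 B = nu B by move=> /m12 ->; rewrite hnu.
rewrite -hnu.
exact: (@measure_unique _ R (borel x1) G g GE GI Gg gT m1 nu m1nu m1g A mA).
Unshelve. all: exact: mf.
Qed.

Lemma liouville_unique (h : bool -> X -> circle) (p : bool -> upair X)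
    (mu : forall b, {measure set (borel (p b)) -> \bar R}) :
  (forall b, homeomorphism (h b)) ->
  (forall a b c d, a != d -> b != c ->
     cross_ratio (fun b x => val (h b x) : R[i]^o) true a b c d =
     cross_ratio (fun b x => val (h b x) : R[i]^o) false a b c d) ->
  (forall b A, <<s open>> A -> mu b A = liouville (upair_image (h b) A)) ->
  forall A, <<s open>> A -> mu true A = mu false A.
Proof.
move=> hh cr hmu A mA.
have [f hg gh] : bijective (h true) by case: (hh true).
pose one : circle := exist _ 1 (mem_set (circle_point (Normc.normc1 R))).
have [chi pchi chi0] := circle_param_exists (f one) (hh true).
have [cc inj per surj] := pchi.
have [g' hg' gh'] : bijective (h false) by case: (hh false).
(* The first structure sends [chi 0] to 1, the second sends [chi beta] to 1. *)
have [beta hb eb] := surj 0 (g' one); rewrite add0r in hb.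
have oarc s t : s < t -> t <= s + 2 * pi -> open (chi @` `]s, t[).
  have [/bij_inj ih ch _] := hh true.
  exact: (open_arc ch ih pchi).
have hbij b : bijective (h b) by case: (hh b).
have mu_pencil b x : mu b (box [set x] setT) = 0%E.
  have [x' _ <-] := surj 0 x.
  by rewrite hmu ?liouville_pencil//; exact: (measurable_pencil pchi oarc).
have mu_pencils b : mu b (pencils chi beta) = 0%E.
  by apply: etrans (measureU0 _ _ (mu_pencil b (chi beta))) (mu_pencil b (chi 0));
    exact: (measurable_pencil pchi oarc).
have chi_neq x y : [&& 0 < x, x < y & y < 2 * pi] -> chi x != chi y.
  move=> xy; apply/eqP => /(chi_inj pchi) e.
  move: (e) xy; clear => e xy; have exy : x = y by apply: e; lra.
  by move: xy; rewrite exy ltxx andbF.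
have hval b x : 0 < x < 2 * pi -> x != beta -> val (h b (chi x)) != 1 :> R[i].
  move=> hx xb; apply/eqP => h1; have {}h1 : h b (chi x) = one by exact: val_inj.
  have [b0|b0] := pselect (b = true).
    rewrite b0 in h1; have := chi_inj pchi (x := x) (y := 0).
    rewrite chi0 -[chi x]hg h1 => e.
    by have := e (ltac:(lra)) (ltac:(have := pi_gt0 R; lra)) erefl; lra.
  have {}b0 : b = false by case: b b0 h1.
  rewrite b0 in h1; have := chi_inj pchi (x := x) (y := beta).
  rewrite eb -[chi x]hg' h1 => e; move: xb.
  by rewrite (e (ltac:(lra)) (ltac:(lra)) erefl) eqxx.
pose H b x : R[i]^o := val (h b x).
have mu_box b v : arcs_ok beta v -> mu b (arc_box chi beta v) =
    (`|ln (Normc.normc (cross_ratio H b (chi v.1.1) (chi v.1.2) (chi v.2.1) (chi v.2.2)))|)%:E.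
  move=> ok; have [ o1 o2 o3 o4 o5] := and5P ok.
  rewrite hmu; last by apply: sub_sigma_algebra; exact: (open_arc_box beta oarc).
  rewrite (_ : arc_box chi beta v = box (chi @` `]v.1.1, v.1.2[) (chi @` `]v.2.1, v.2.2[)); last first.
    by apply/seteqP; split=> q // [].
  apply: etrans (@liouville_arcs R X (h b) chi v.1.1 v.1.2 v.2.1 v.2.2 _ _ _ _ _ _ _) _.
  - exact: bij_inj (hbij b).
  - by case/andP: o1.
  - by case/andP: o2.
  - by case/andP: o2.
  - move=> x; apply: continuous_comp (@initial_continuous _ _ _ _).
    apply: continuous_comp; first exact: cc.
    by have [_ ch _] := hh b; exact: ch.
  - move=> x y; rewrite !in_itv /= => hx hy /val_inj/(bij_inj (hbij b)).
    by apply: (chi_inj pchi); move: o1 o2 o3 hx hy; clear; lra.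
  - move=> x hx; apply: hval; first lra.
    move: hx => /orP[] hx; [apply: contraNneq o4|apply: contraNneq o5] => <- //.
  rewrite /cross_ratio Normc.normcM Normc.normcV !Normc.normcM.
  by [].
have Hcr v : arcs_ok beta v -> cross_ratio H true (chi v.1.1) (chi v.1.2) (chi v.2.1) (chi v.2.2) =
    cross_ratio H false (chi v.1.1) (chi v.1.2) (chi v.2.1) (chi v.2.2).
  move=> /and5P[ o1 o2 o3 _ _]; apply: cr; apply: chi_neq.
    by move: o1 o2 o3; clear; lra.
  by move: o1 o2 o3; clear; lra.
have mu_eq v : mu true (arc_box chi beta v) = mu false (arc_box chi beta v).
  have [ok|nok] := boolP (arcs_ok beta v); first by rewrite !mu_box// Hcr.
  rewrite (_ : arc_box chi beta v = set0) ?measure0//.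
  by apply/seteqP; split=> q // -[]; rewrite (negbTE nok).
have mu_fin v : (mu true (arc_box chi beta v) < +oo)%E.
  have [ok|nok] := boolP (arcs_ok beta v); first by rewrite mu_box// ltry.
  rewrite (_ : arc_box chi beta v = set0) ?measure0//.
  by apply/seteqP; split=> q // -[]; rewrite (negbTE nok).
have muD b B : <<s open>> B -> mu b B = mu b (B `\` pencils chi beta).
  move=> mB; have mp := measurable_pencils beta pchi oarc.
  rewrite [in LHS](_ : B = (B `\` pencils chi beta) `|` (B `&` pencils chi beta)); last first.
    by apply/seteqP; split=> q /=; [have [] := pselect (pencils chi beta q)|]; tauto.
  apply: measureU0.
  - by rewrite setDE; apply: sigma_setI => //; exact: sigma_setC.
  - exact: sigma_setI.
  - apply/eqP; rewrite eq_le measure_ge0 andbT -(mu_pencils b).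
    by apply: le_measure; rewrite ?inE //; exact: sigma_setI.
(* With the null set [pencils] added, the rational boxes cover the whole space by sets of finite
   measure. *)
pose g n := rational_box chi beta n `|` pencils chi beta.
have g_cover : \bigcup_n g n = setT.
  apply/seteqP; split=> // q _.
  have [Pq|nPq] := pselect (pencils chi beta q); first by exists 0%N => //; right.
  have : (setT `\` pencils chi beta) q by [].
  rewrite (open_arc_boxes pchi hb openT) => -[n _].
  by case: ifP => // _ hn; exists n => //; left.
have g_fin n : (mu true (g n) < +oo)%E.
  have mn := (box_system_pencilU pchi hb oarc n).1.
  rewrite (muD true _ mn) /g setDUl setDv setU0 (rational_boxD pchi hb).
  by have [[v ->]|->] := rational_boxP chi beta n; rewrite ?mu_fin ?measure0 ?ltry.
have mu_agree B : box_system chi beta B -> mu true B = mu false B.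
  move=> [mB hB]; rewrite (muD true _ mB) (muD false _ mB).
  by case: hB => [[v ->]|->]; rewrite ?mu_eq ?measure0.
exact: (borel_measure_unique (sigma_box_system pchi hb oarc) (setI_closed_box_system pchi)
  (box_system_pencilU pchi hb oarc) g_cover mu_agree g_fin mA).
Qed.

End measure_uniqueness.

(** * Developing maps of marked surfaces *)

Section liouville_family.
Context {R : realType} (S : oriented_surface R) (St : topologicalType).
Context (p : St -> S) (y0 : St) (E : seq (pi1 R (p y0))).
Context {I : finType} (m : I -> marked_surface S) (phi : I -> St -> R[i]^o).

(** Near y and near y', [phi i] is an isometry of the disc applied to the same chart at the common
    point of the marked surface; A is the quotient of these two isometries. *)
Lemma lifted_isometry_local (i : I) (y y' : St) : continuous p ->
  lifted_isometry p (m i) (phi i) -> p y = p y' -> exists A, su11 A /\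
    \forall z \near y & z' \near y', p z = p z' -> phi i z' = su_act A (phi i z).
Proof.
move=> cp [_ rphi loc] pyy'.
have [[hemb hcov] hdisc _] := hyperbolic_chartsP (marked_target (m i)).
have [ch hc dc] := hcov (m i (p y)).
have [od _ _ _] := hemb _ hc.
have near_dom (x : St) : chart_dom ch (m i (p x)) -> \forall z \near x, chart_dom ch (m i (p z)).
  move=> dx.
  have cmp : {for x, continuous (m i \o p)}.
    apply: continuous_comp; first exact: cp.
    by have [_ cm _] := marking_homeo (m i); exact: cm.
  by apply: cmp; apply: open_nbhs_nbhs.
have dc' : chart_dom ch (m i (p y')) by rewrite -pyy'.
have [a [b [ab hy]]] := loc y ch hc dc.
have [a' [b' [ab' hy']]] := loc y' ch hc dc'.
have sA : su11 (a, b) by rewrite /su11 /= -!normCK.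
have sA' : su11 (a', b') by rewrite /su11 /= -!normCK.
exists (su_mul (a', b') (su_inv (a, b))); split.
  by apply: su11_mul => //; exact: su11_inv.
have nphi z : Normc.normc (phi i z) <= 1.
  have : unit_disc R (phi i z) by rewrite -rphi; exists z.
  by rewrite /unit_disc /= normE -(rmorph1 (real_complex R)) ltcR => /ltW.
exists ([set z | phi i z = mobius a b (ch (m i (p z))) /\ chart_dom ch (m i (p z))],
        [set z | phi i z = mobius a' b' (ch (m i (p z)))]).
  split; last exact: hy'.
  by apply: filterI; [exact: hy|exact: near_dom].
move=> [z z'] /= [[e dz] e'] pz.
have nw : Normc.normc (ch (m i (p z))) <= 1.
  have : unit_disc R (ch (m i (p z))) by apply: (hdisc ch hc); exists (m i (p z)).
  by rewrite /unit_disc /= normE -(rmorph1 (real_complex R)) ltcR => /ltW.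
rewrite su_act_mul; last by apply: su_den_neq0 (nphi z); exact: su11_inv.
rewrite e' -pz e -[mobius a b _]/(su_act (a, b) _) su_actK//.
Qed.

Lemma lifted_isometry_developing : closed_connected S -> universal_covering R p ->
  (forall i, lifted_isometry p (m i) (phi i)) -> developing p phi.
Proof.
move=> [cS _] [cov [pc _]] hphi; split=> //.
- by move=> i; have [] := hphi i.
- by move=> i; have [] := hphi i.
- by move=> i y y'; apply: lifted_isometry_local => //; case: cov.
Qed.

End liouville_family.

Theorem theorem1p1 (R : realType) (S : oriented_surface R) (g : nat)
    (St : topologicalType) (p : St -> S) (y0 : St)
    (E : seq (pi1 R (p y0))) :
  closed_connected S -> has_genus R S g -> (2 <= g)%N ->
  universal_covering R p -> generates E ->
  linearly_independent (liouville_currents E).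
Proof.
move=> cS _ _ cov _ n v vinj hv c sum0 i0.
apply: contrapT => /eqP ci0.
have /choice[mL hmL] : forall i, exists mL : marked_surface S * geodesic_current R E,
    is_liouville_current mL.1 mL.2 /\ v i = current_vector mL.2.
  by move=> i; have [_ [m [L [_ hL ->]]]] := hv i; exists (m, L).
have /choice[f hf] : forall i, exists f : (St -> R[i]^o) * (gromov_boundary E -> circle (R := R)),
    [/\ lifted_isometry p (mL i).1 f.1, homeomorphism f.2, boundary_extension f.1 f.2 &
      forall A : set (double_boundary E), <<s @open (double_boundary E) >> A ->
        (mL i).2 A = liouville (upair_image f.2 A)].
  by move=> i; have [[phi [bphi H]] _] := hmL i; exists (phi, bphi).
pose phi i := (f i).1; pose bphi i := (f i).2.
have dev : developing p phi.
  by apply: (lifted_isometry_developing (m := fun i => (mL i).1)) => // i; case: (hf i).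
have hb i : homeomorphism (bphi i) by case: (hf i).
have eb i : boundary_extension (phi i) (bphi i) by case: (hf i).
have hL i A : <<s @open (double_boundary E) >> A -> (mL i).2 A = liouville (upair_image (bphi i) A).
  by case: (hf i) => _ _ _; exact.
have null (A : set (double_boundary E)) : open A ->
    (exists2 K : set (double_boundary E), compact K & A `<=` K) ->
    \sum_i c i * fine (liouville (upair_image (bphi i) A)) = 0.
  move=> oA bA; have mA : <<s @open (double_boundary E) >> A by exact: sub_sigma_algebra.
  (* Being open and relatively compact, A is among the sets on which [current_vector] is the actual
     measure and not the dummy value. *)
  have := congr1 (fun F => F A) sum0; rewrite fct_sumE => h.
  rewrite -[RHS]h; apply: eq_bigr => i _.
  have [_ ->] := hmL i.
  rewrite -hL// /current_vector -[RHS]/(c i * (if pselect _ then _ else _)).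
  by case: pselect => // -[].
have hbox := null_box_relation i0 hb null.
have hD := boundary_deck_system dev hb eb.
have [i [j [ij cr]]] := deck_independence hD hbox ci0.
(* The two currents will agree on Borel sets, hence have the same vector, against the injectivity of
   v. *)
move/eqP: ij; apply; apply: vinj.
have [_ ->] := hmL i; have [_ ->] := hmL j.
have LE A : <<s @open (double_boundary E) >> A -> (mL i).2 A = (mL j).2 A.
  pose L b := if b then (mL i).2 else (mL j).2.
  apply: (@liouville_unique R _ (fun b : bool => if b then bphi i else bphi j)
    (fun b => current_base (L b)) (fun b => current_measure (L b))).
  - by case; exact: hb.
  - move=> a b x y ay bx; exact: cr.
  - by case=> B mB; exact: hL.
apply/funext => A; rewrite /current_vector.
by case: pselect => // hA; rewrite LE//; case: hA.
Qed.
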